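(* For any function $f\in\mathcal{C}$ consider the probability model $\mathbb{Q}_{n,f,\theta}$ on $S_n$, where $\theta\in\mathbb{R}$ is fixed. Then the following conclusions hold. (a) $$\lim_{n\to\infty}\frac{Z_n(f,\theta)-Z_n(0)}{n}=Z(f,\theta):=\sup_{\mu\in\mathcal{M}}\{\theta\mu[f]-D(\mu\|u)\}.$$ (b) If $\pi\in S_n$ is a random permutation from the model $\mathbb{Q}_{n,f,\theta}$, then the random probability measure $$\nu_\pi:=\frac1n\sum_{i=1}^n\delta_{\left(\frac in,\frac{\pi(i)}{n}\right)}$$ on the unit square converges weakly in probability to the probability measure $\mu_{f,\theta}\in\mathcal{M}$, where $\mu_{f,\theta}$ is the unique maximizer of part (a). (c) The measure $\mu_{f,\theta}$ of part (b) has density $$g_{f,\theta}(x,y):=e^{\theta f(x,y)+a_{f,\theta}(x)+b_{f,\theta}(y)}$$ with respect to Lebesgue measure on $[0,1]^2$, with the functions $a_{f,\theta}(\cdot),b_{f,\theta}(\cdot)\in L^1[0,1]$, which are unique almost surely. Consequently one has $$\sup_{\mu\in\mathcal{M}}\{\theta\mu[f]-D(\mu\|u)\}=-\int_0^1[a_{f,\theta}(x)+b_{f,\theta}(x)]\,dx.$$ (d) The function $Z(f,\theta)$ of part (a) is a differentiable convex function (of $\theta$) with a continuous and strictly increasing derivative $Z'(f,\theta)$, which satisfies $$Z'(f,\theta)=\lim_{n\to\infty}\frac1n Z_n'(f,\theta)=\mu_{f,\theta}[f].$$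
   Context: $S_n$ is the set of permutations of $\{1,\dots,n\}$. $\mathcal{C}$ is the set of all continuous functions $f$ on $[0,1]^2$, not identically $0$, with $\int_0^1 f(x,z)\,dz=0$ for all $x\in[0,1]$ and $\int_0^1 f(z,y)\,dz=0$ for all $y\in[0,1]$. For $\theta\in\mathbb{R}$, $\mathbb{Q}_{n,f,\theta}$ is the probability mass function on $S_n$ given by $\mathbb{Q}_{n,f,\theta}(\pi)=e^{\theta\sum_{i=1}^n f(i/n,\pi(i)/n)-Z_n(f,\theta)}$, where $Z_n(f,\theta)$ is the log normalizing constant, i.e. $Z_n(f,\theta)=\log\sum_{\pi\in S_n}e^{\theta\sum_{i=1}^n f(i/n,\pi(i)/n)}$; $Z_n(0):=Z_n(f,0)=\log n!$, which does not depend on $f$. $\mathcal{M}$ is the space of all probability distributions on the unit square $[0,1]^2$ with uniform marginals; $u$ is the uniform distribution on the unit square; $\mu[f]:=\int f\,d\mu$ is the expectation of $f$ with respect to $\mu$; $D(\cdot\|\cdot)$ is the Kullback-Leibler divergence. Primes on $Z$ and $Z_n$ denote derivatives with respect to $\theta$.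
   Formalization: In (c), ''unique almost surely'' is false as written, since (a+c, b−c) gives the same density for every constant c; it is proved as uniqueness almost everywhere on [0,1] up to replacing (a, b) by (a+c, b−c). *)

(* Defs.v *)
From HB Require Import structures.
From mathcomp Require Import all_boot all_order all_algebra all_fingroup.
From mathcomp Require Import all_classical all_reals all_analysis.

Set Implicit Arguments.
Unset Strict Implicit.
Unset Printing Implicit Defensive.
Import Order.TTheory GRing.Theory Num.Theory.
Import numFieldNormedType.Exports.

Local Open Scope classical_set_scope.
Local Open Scope ring_scope.

(* The plane with the product of the Borel sigma-algebras; probability measures
   on the unit square are the probability measures on the plane that are carried
   by [unit_square]. *)
Notation plane R := (measurableTypeR R * measurableTypeR R)%type.

Definition unit_square (R : realType) : set (R * R) :=
  `[0, 1]%classic `*` `[0, 1]%classic.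
Arguments unit_square : clear implicits.

(* A function on the unit square is represented by a total function on the
   plane, whose values off the square are never used. *)
Definition class_C (R : realType) (f : R * R -> R) : Prop :=
  [/\ {within unit_square R, continuous f},
      (exists2 z, unit_square R z & f z != 0),
      (forall x : R, x \in `[0, 1] ->
         \int[lebesgue_measure]_(z in `[0, 1]) f (x, z) = 0) &
      (forall y : R, y \in `[0, 1] ->
         \int[lebesgue_measure]_(z in `[0, 1]) f (z, y) = 0)].

(* The point (i/n, s(i)/n); 'I_n is indexed from 0, hence the successors. *)
Definition perm_point (R : realType) (n : nat) (s : 'S_n) (i : 'I_n) : R * R :=
  (i.+1%:R / n%:R, (s i).+1%:R / n%:R).

Definition perm_stat (R : realType) (n : nat) (f : R * R -> R) (s : 'S_n) : R :=
  \sum_(i < n) f (perm_point R s i).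

Definition Zn (R : realType) (n : nat) (f : R * R -> R) (theta : R) : R :=
  ln (\sum_(s : 'S_n) expR (theta * perm_stat f s)).

Definition Qn (R : realType) (f : R * R -> R) (theta : R) (n : nat)
    (s : 'S_n) : R :=
  expR (theta * perm_stat f s - Zn n f theta).

(* nu_s = (1/n) * (sum of the Dirac masses at (i/n, s(i)/n)); for n = 0 it is
   the zero measure. *)
Definition perm_measure (R : realType) (n : nat) (s : 'S_n) :
    {measure set (plane R) -> \bar R} :=
  mscale (n%:R^-1)%:nng
    (msum (fun k => match insub k : option 'I_n with
                    | Some i => \d_(perm_point R s i : plane R)
                    | None => mzero
                    end) n).

Definition uniform01 (R : realType) : probability (measurableTypeR R) R :=
  uniform_prob (@ltr01 R).

(* The marginal condition forces mu to be carried by the unit square. *)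
Definition uniform_marginals (R : realType) (mu : probability (plane R) R) :
    Prop :=
  forall A : set (measurableTypeR R), measurable A ->
    pushforward mu fst A = uniform01 R A /\
    pushforward mu snd A = uniform01 R A.

Definition uniform_square (R : realType) : probability (plane R) R :=
  (uniform01 R \x uniform01 R)%E.

Definition KL (d : measure_display) (T : measurableType d) (R : realType)
    (mu nu : probability T R) : \bar R :=
  if `[< mu `<< nu >] then
    (\int[mu]_x
       (ln (fine (Radon_Nikodym (charge_of_finite_measure mu) nu x)))%:E)%E
  else +oo%E.

Definition mean (R : realType) (mu : {measure set (plane R) -> \bar R})
    (f : R * R -> R) : R :=
  \int[mu]_(z in unit_square R) f z.

Definition objective (R : realType) (f : R * R -> R) (theta : R)
    (mu : probability (plane R) R) : \bar R :=
  ((theta * mean mu f)%:E - KL mu (uniform_square R))%E.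

Definition Zsup (R : realType) (f : R * R -> R) (theta : R) : \bar R :=
  ereal_sup [set objective f theta mu |
              mu in [set mu : probability (plane R) R | uniform_marginals mu]].

Definition Zlim (R : realType) (f : R * R -> R) (theta : R) : R :=
  fine (Zsup f theta).

Definition maximizer (R : realType) (f : R * R -> R) (theta : R)
    (mu : probability (plane R) R) : Prop :=
  uniform_marginals mu /\ objective f theta mu = Zsup f theta.

(* Uniqueness is as a measure, that is, on measurable sets. *)
Definition unique_maximizer (R : realType) (f : R * R -> R) (theta : R)
    (mu : probability (plane R) R) : Prop :=
  maximizer f theta mu /\
  forall nu : probability (plane R) R, maximizer f theta nu ->
    forall A : set (plane R), measurable A -> nu A = mu A.

(* For s drawn from the mass function P n on 'S_n, the random measures nu n s
   converge weakly in probability to mu: the integral of each continuous test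
   function on the unit square converges in probability. *)
Definition weakly_in_prob (R : realType) (P : forall n, 'S_n -> R)
    (nu : forall n, 'S_n -> {measure set (plane R) -> \bar R})
    (mu : {measure set (plane R) -> \bar R}) : Prop :=
  forall h : R * R -> R, {within unit_square R, continuous h} ->
  forall eps : R, 0 < eps ->
    (\sum_(s : 'S_n | eps <= `|mean (nu n s) h - mean mu h|) P n s)
      @[n --> \oo] --> (0 : R).

(* mu has density g with respect to Lebesgue measure on the unit square. *)
Definition has_density (R : realType) (mu : probability (plane R) R)
    (g : R * R -> R) : Prop :=
  forall A : set (plane R), measurable A ->
    mu A = (\int[@lebesgue_measure R \x @lebesgue_measure R]_(z in
              A `&` unit_square R) (g z)%:E)%E.

Definition exp_density (R : realType) (f : R * R -> R) (theta : R)
    (a b : R -> R) : R * R -> R :=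
  fun z => expR (theta * f z + a z.1 + b z.2).

Definition L1_01 (R : realType) (a : R -> R) : Prop :=
  (@lebesgue_measure R).-integrable `[0, 1]%classic (EFin \o a).

(* Main.v *)
From HB Require Import structures.
Require Import Defs.
From mathcomp Require Import all_boot all_order all_algebra all_fingroup.
From mathcomp Require Import all_classical all_reals all_analysis.
From mathcomp Require Import measurable_realfun.
From mathcomp Require Import ring lra.
Import Order.TTheory GRing.Theory Num.Theory.
Import numFieldNormedType.Exports.
Set Implicit Arguments.
Unset Strict Implicit.
Unset Printing Implicit Defensive.
Local Open Scope ring_scope.

(** The weights [expR (theta * perm_stat f s)] sum to the permanent of the matrix
    [expR (w (i / n, j / n))] with [w := theta * f], and everything rests on
    rescaling its rows and columns.  There are functions [a] and [b] such that
    [v (x, y) := w (x, y) + a x + b y] is the logarithm of a density with uniform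
    marginals (potentials_exist, by contraction of the Sinkhorn iteration in an
    oscillation distance: sinkhorn_scaling).  As a permutation visits every row
    and every column once, passing from [w] to [v] multiplies all weights by the
    same constant: the law on permutations does not change, and the log partition
    function changes by a Riemann sum of [a + b].

    The permanent of [expR v] is compared with independent sampling.  Cut the
    interval into [k] blocks and draw [n] independent pairs of blocks from the
    block masses of [expR v].  Sorting both coordinates moves the [i]-th letter
    close to [i / n] unless the letter counts deviate, which is exponentially
    unlikely (most_words_aligned), and the pairing of the sorted coordinates is a
    permutation.  Averaging over it converts the sum over pairs of words into the
    permanent, up to a factor [expR (n * e)].  This gives an upper bound
    [n! * (integral of expR v) ^ n] for every continuous [v] (gibbs_sum_upper) and
    the matching lower bound [n!] when [expR v] has uniform marginals
    (gibbs_sum_lower).  Together they yield the limit of the log partition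
    functions, equal to [- integral of (a + b)].  Applying the upper bound to
    [v + t * h] and the lower bound to [v] yields a Chernoff bound: the average of
    a continuous [h] along the graph of a random permutation concentrates at its
    mean under the density [expR v] (gibbs_concentration).  This is the weak
    convergence, it identifies the limit of the derivatives of the log partition
    functions, and for [v = 0] it even provides the Riemann sums above.

    For the variational problem, uniform marginals give
    [theta * mu[f] = mu[v] - integral of (a + b)], so the claim becomes
    [mu[v] <= KL mu u] with equality only for the density [expR v]
    (gibbs_variational), a form of [1 + y <= expR y].  Uniqueness of [a] and [b] is
    Fubini's theorem (potentials_unique).

    As functions of the parameter, the value at [s] is bounded below by letting the
    maximizer for [t] compete, and above by the variational inequality for the
    density at [t] tilted by [(s - t) * f]; the two bounds differ by a multiple of
    [(s - t) ^ 2].  A function pinched in this way is convex and differentiable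
    with continuous derivative, here the mean of [f] under the maximizer.  The
    derivative is strictly increasing because the potentials drop out of
    [(t - s) * (m t - m s)], which leaves a strongly monotone expression bounded
    below by the square integral of [f] (mean_increasing); here the vanishing
    marginals of [f] make it orthogonal to all separated functions. *)

(** * Sampling words and sorting them: bounds for permanents *)

Lemma expR_le_quadratic (R : realType) (u : R) :
  u <= 2^-1 -> expR u <= 1 + u + 2 * u ^+ 2.
Proof.
move=> u2; have e1 := expR_ge1Dx (- u).
have p1 : 0 < 1 - u by lra.
have e2 : expR u * expR (- u) = 1 by rewrite -expRD subrr expR0.
have e3 : expR u * (1 - u) <= 1.
  by rewrite -[leRHS]e2 ler_wpM2l// expR_ge0.
rewrite -(ler_pM2r p1); apply: (le_trans e3).
have : 0 <= u ^+ 2 * (1 - 2 * u) by rewrite mulr_ge0 ?sqr_ge0//; lra.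
by nra.
Qed.

(** Summing over all words of length [n] is integrating against a product
    measure, up to normalization. *)
Lemma sum_ffun_prod (R : realType) (n k : nat) (F : 'I_k -> R) :
  \sum_(x : {ffun 'I_n -> 'I_k}) \prod_i F (x i) = (\sum_a F a) ^+ n.
Proof.
rewrite -(bigA_distr_bigA (fun (_ : 'I_n) a => F a)).
by rewrite prodr_const card_ord.
Qed.

Lemma sum_indicator_card (R : realType) (T : finType) (P : pred T) :
  \sum_(x | P x) (1 : R) = #|[set x | P x]|%:R.
Proof.
by rewrite sumr_const; congr (_ *+ _); apply: eq_card => x; rewrite inE.
Qed.

(** Exponential Markov inequality: over all words, [expR (t * sum phi)] has a
    product form, so its total is a plain power. *)
Lemma chernoff_words (R : realType) (n k : nat) (phi : 'I_k -> R) (dlt : R) :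
  (forall a, `|phi a| <= 1) -> \sum_a phi a = 0 -> 0 < dlt <= 1 ->
  #|[set x : {ffun 'I_n -> 'I_k} | dlt * n%:R <= \sum_i phi (x i)]|%:R
  <= k%:R ^+ n * expR (- (n%:R * (dlt ^+ 2 / 8))).
Proof.
move=> phi1 phi0 /andP[d0 d1]; (* [dlt / 4] minimizes the exponent [2 * t ^+ 2 - t * dlt]. *)
set t := dlt / 4.
have t0 : 0 < t by rewrite divr_gt0.
have tot : \sum_(x : {ffun 'I_n -> 'I_k}) expR (t * \sum_i phi (x i))
           <= (k%:R * expR (2 * t ^+ 2)) ^+ n.
  under eq_bigr do rewrite mulr_sumr expR_sum.
  rewrite (sum_ffun_prod n (fun a => expR (t * phi a))).
  apply: lerXn2r; rewrite ?nnegrE ?mulr_ge0 ?ler0n ?expR_ge0//.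
    by apply: sumr_ge0 => *; exact: expR_ge0.
  apply: (@le_trans _ _ (\sum_(a < k) (1 + t * phi a + 2 * t ^+ 2))).
    apply: ler_sum => a _; have /ler_normlP[h1 h2] := phi1 a.
    have tphi : t * phi a <= 2^-1 by rewrite /t; nra.
    apply: (le_trans (expR_le_quadratic tphi)).
    have : (t * phi a) ^+ 2 <= t ^+ 2.
      rewrite exprMn -[leRHS]mulr1 ler_wpM2l ?sqr_ge0//.
      by rewrite -real_normK ?num_real// expr_le1.
    by lra.
  rewrite !big_split/= -mulr_sumr phi0 mulr0 addr0 !sumr_const card_ord.
  rewrite -mulrnDl -[leLHS]mulr_natl ler_wpM2l//; exact: expR_ge1Dx.
have low : #|[set x : {ffun 'I_n -> 'I_k} | dlt * n%:R <= \sum_i phi (x i)]|%:R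
    * expR (t * (dlt * n%:R)) <=
    \sum_(x : {ffun 'I_n -> 'I_k}) expR (t * \sum_i phi (x i)).
  rewrite -sum_indicator_card mulr_suml [leRHS](bigID
     (fun x : {ffun 'I_n -> 'I_k} => dlt * n%:R <= \sum_i phi (x i)))/=.
  rewrite -[leLHS]addr0 lerD//; last by apply: sumr_ge0 => *; exact: expR_ge0.
  by apply: ler_sum => x hx; rewrite mul1r ler_expR ler_pM2l.
have := le_trans low tot; rewrite -ler_pdivlMr ?expR_gt0// => h.
apply: (le_trans h); rewrite exprMn -mulrA ler_wpM2l ?exprn_ge0//.
rewrite -expRM_natl -expRN -expRD ler_expR /t le_eqVlt; apply/orP; left; apply/eqP.
by field.
Qed.

Lemma card_ord_ltn (n m : nat) : (m <= n)%N -> #|[set j : 'I_n | (j < m)%N]| = m.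
Proof.
move=> mn; rewrite -sum1_card.
rewrite (eq_bigl (fun j : 'I_n => (j < m)%N)); last by move=> j; rewrite inE.
by rewrite -(big_ord_widen n (fun=> 1%N) mn) sum1_card card_ord.
Qed.

Lemma sort_word (n k : nat) (x : {ffun 'I_n -> 'I_k}) :
  exists s : 'S_n, forall i j : 'I_n, (i <= j)%N -> (x (s i) <= x (s j))%N.
Proof.
pose r : rel 'I_k := [rel a b : 'I_k | (a <= b)%N].
pose t := [tuple x i | i < n].
have rtot : total r by move=> a b; exact: leq_total.
have rtr : transitive r by move=> a b c; exact: leq_trans.
have /tuple_permP[s hs] : perm_eq (sort r t) t by rewrite perm_sort.
exists s => i j ij.
have nthE l : nth (x i) (sort r t) (nat_of_ord l) = x (s l).
  by rewrite hs -tnth_nth !tnth_mktuple.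
rewrite -!nthE; apply: (sorted_leq_nth rtr) ij.
- by move=> a; rewrite /r/=.
- exact: (sort_sorted rtot).
- by rewrite inE size_sort size_tuple ltn_ord.
- by rewrite inE size_sort size_tuple ltn_ord.
Qed.

Definition letters_below (n k : nat) (x : {ffun 'I_n -> 'I_k}) (a : nat) : nat :=
  #|[set i | (x i < a)%N]|.

(** In a sorted word the strictly smaller letters come first, which locates the
    position of a letter between two counts. *)
Lemma sorted_position (n k : nat) (x : {ffun 'I_n -> 'I_k}) (s : 'S_n) i :
  (forall i j : 'I_n, (i <= j)%N -> (x (s i) <= x (s j))%N) ->
  (letters_below x (x (s i)) <= i < letters_below x (x (s i)).+1)%N.
Proof.
move=> hs.
have relabel a : letters_below x a = #|[set j | (x (s j) < a)%N]|.
  rewrite /letters_below -[LHS](card_preimset _ (@perm_inj _ s)).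
  by apply: eq_card => j; rewrite !inE.
rewrite !relabel; apply/andP; split.
  rewrite -[leqRHS](card_ord_ltn (ltnW (ltn_ord i))) subset_leq_card//.
  apply/fintype.subsetP => j; rewrite !inE => h; rewrite ltnNge; apply/negP => /hs.
  by rewrite leqNgt h.
rewrite -[leqLHS](card_ord_ltn (ltn_ord i)) subset_leq_card//.
by apply/fintype.subsetP => j; rewrite !inE !ltnS => /hs.
Qed.

(** The sorting permutation is existentially quantified, which makes the notion
    invariant under permutation of the positions; [2 / k] absorbs the width of a
    block and the fluctuation of the letter counts. *)
Definition aligned (R : realType) (n k : nat) (x : {ffun 'I_n -> 'I_k}) : bool :=
  [exists s : 'S_n, [forall i : 'I_n, `|i.+1%:R / n%:R - (x (s i))%:R / k%:R|
                               <= 2 / k%:R :> R]].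

Lemma aligned_perm (R : realType) (n k : nat) (x : {ffun 'I_n -> 'I_k}) (s : 'S_n) :
  aligned R [ffun i => x (s i)] = aligned R x.
Proof.
apply/existsP/existsP => -[t /forallP ht].
  by exists (t * s)%g; apply/forallP => i; have := ht i; rewrite ffunE permM.
exists (t * s^-1)%g; apply/forallP => i; have := ht i.
by rewrite ffunE permM permKV.
Qed.

(** The centred indicator of the letters below [a]: its sum over a word is the
    deviation of the empirical distribution function from the uniform one. *)
Definition count_deviation (R : realType) (k : nat) (a : 'I_k.+1) (c : 'I_k) : R :=
  (c < a)%N%:R - a%:R / k%:R.

Lemma sum_count_deviation (R : realType) (n k : nat) (x : {ffun 'I_n -> 'I_k}) a :
  \sum_i count_deviation R a (x i) =
  (letters_below x a)%:R - n%:R * (a%:R / k%:R).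
Proof.
rewrite big_split/= sumr_const card_ord mulNrn; congr (_ - _); last first.
  by rewrite -[LHS]mulr_natl.
rewrite -natr_sum; congr (_%:R); rewrite /letters_below -sum1_card.
by rewrite [RHS]big_mkcond/=; apply: eq_bigr => i _; rewrite inE; case: ifP.
Qed.

Lemma count_deviation0 (R : realType) (k : nat) (a : 'I_k.+1) :
  (0 < k)%N -> \sum_c count_deviation R a c = 0.
Proof.
move=> k0; rewrite big_split/= sumr_const card_ord mulNrn.
rewrite -(mulr_natr (_ / _) k) divfK ?pnatr_eq0 -?lt0n//.
rewrite -natr_sum; apply/eqP; rewrite subr_eq0 eqr_nat -big_mkcondr/=.
by rewrite -(big_ord_widen k (fun=> 1%N)) ?sum1_card ?card_ord// -ltnS.
Qed.

Lemma count_deviation_le1 (R : realType) (k : nat) (a : 'I_k.+1) (c : 'I_k) :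
  `|count_deviation R a c| <= 1.
Proof.
have k0 : 0 < k%:R :> R by rewrite ltr0n (leq_trans _ (ltn_ord c)).
have : a%:R / k%:R <= 1 :> R by rewrite ler_pdivrMr// mul1r ler_nat -ltnS.
have : 0 <= a%:R / k%:R :> R by rewrite divr_ge0.
rewrite /count_deviation; set q := _ / _ => h1 h2.
by case: (_ < _)%N; rewrite ?mulr1n ?mulr0n; apply/ler_normlP; split; lra.
Qed.

(** If all the counts are within [n / k] of their expectation, a sorting
    permutation aligns the word: the counting error [k^-1] and the width [k^-1] of
    a block add up to [2 / k]. *)
Lemma not_aligned_deviates (R : realType) (n k : nat) (x : {ffun 'I_n -> 'I_k}) :
  (0 < n)%N -> (0 < k)%N -> ~~ aligned R x ->
  exists a, k%:R^-1 * n%:R <= `|\sum_i count_deviation R a (x i)|.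
Proof.
move=> n0 k0; apply: contraNP => /forallNP dev.
have [s hs] := sort_word x; apply/existsP; exists s; apply/forallP => i.
have {}dev (m : nat) : (m <= k)%N ->
    `|(letters_below x m)%:R - n%:R * (m%:R / k%:R)| < k%:R^-1 * n%:R :> R.
  rewrite -ltnS => mk; have /negP := dev (Ordinal mk).
  by rewrite -ltNge sum_count_deviation.
have /andP[lo hi] := sorted_position i hs.
set m : nat := x (s i) in lo hi *.
have mk : (m < k)%N by rewrite /m.
have /ltr_normlP[d1 _] := dev _ (ltnW mk); have /ltr_normlP[_ d2] := dev _ mk.
have nR : 0 < n%:R :> R by rewrite ltr0n.
have loR : (letters_below x m)%:R <= i%:R :> R by rewrite ler_nat.
have hiR : i%:R + 1 <= (letters_below x m.+1)%:R :> R.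
  by rewrite natr1 ler_nat.
have kk : 0 < k%:R^-1 :> R by rewrite invr_gt0 ltr0n.
rewrite -(natr1 m) in d2.
rewrite -(@ler_pM2r _ n%:R)// -[X in _ * X <= _](gtr0_norm nR) -normrM mulrBl divfK ?gt_eqF//.
rewrite -(natr1 i); apply/ler_normlP; split; lra.
Qed.

Lemma card_deviates (R : realType) (n k : nat) (a : 'I_k.+1) : (0 < k)%N ->
  #|[set x : {ffun 'I_n -> 'I_k} |
      k%:R^-1 * n%:R <= `|\sum_i count_deviation R a (x i)|]|%:R
  <= 2 * (k%:R ^+ n * expR (- (n%:R * (k%:R^-1 ^+ 2 / 8)))) :> R.
Proof.
move=> k0; set d := k%:R^-1.
have d01 : 0 < d <= 1.
  by rewrite invr_gt0 ltr0n k0/= invf_le1 ?ltr0n// ler1n.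
have le1 := @count_deviation_le1 R k a.
have sum0 := @count_deviation0 R k a k0.
have hi := @chernoff_words R n k (count_deviation R a) d le1 sum0 d01.
have lo : #|[set x : {ffun 'I_n -> 'I_k} |
    d * n%:R <= \sum_i - count_deviation R a (x i)]|%:R
  <= k%:R ^+ n * expR (- (n%:R * (d ^+ 2 / 8))).
  apply: (@chernoff_words R n k (fun c => - count_deviation R a c) d) => //.
    by move=> c; rewrite normrN.
  by rewrite sumrN sum0 oppr0.
rewrite mulr_natl mulr2n; apply: (le_trans _ (lerD hi lo)).
rewrite -natrD ler_nat; apply: leq_trans (leq_card_setU _ _).
apply: subset_leq_card; apply/fintype.subsetP => x; rewrite !inE.
by rewrite sumrN ler_normr.
Qed.

(** Union bound over the letter counts, each of which is exponentially unlikely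
    to deviate. *)
Lemma most_words_aligned (R : realType) (k : nat) : (0 < k)%N ->
  exists N : nat, forall n : nat, (N <= n)%N ->
  4 * #|[set x : {ffun 'I_n -> 'I_k} | ~~ aligned R x]|%:R <= k%:R ^+ n :> R.
Proof.
move=> k0; set d : R := k%:R^-1 ^+ 2 / 8.
have d0 : 0 < d by rewrite divr_gt0// exprn_gt0// invr_gt0 ltr0n.
(* [k.+1] counts, two signs and the factor 4 of the claim. *)
pose B : R := 8 * k.+1%:R.
exists (Num.Def.archi_bound (B / d)).+1 => n Nn.
have n0 : (0 < n)%N by apply: leq_trans Nn.
have Bn : B <= n%:R * d.
  rewrite -ler_pdivrMr//; apply: ltW; apply: (lt_le_trans (archi_boundP _)).
    by rewrite divr_ge0 ?(ltW d0)// mulr_ge0.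
  by rewrite ler_nat (ltnW Nn).
have cover : #|[set x : {ffun 'I_n -> 'I_k} | ~~ aligned R x]|%:R <=
    \sum_(a < k.+1) #|[set x : {ffun 'I_n -> 'I_k} |
      k%:R^-1 * n%:R <= `|\sum_i count_deviation R a (x i)|]|%:R :> R.
  rewrite -natr_sum ler_nat.
  apply: (@leq_trans #|\bigcup_(a : 'I_k.+1) [set x : {ffun 'I_n -> 'I_k} |
      k%:R^-1 * n%:R <= `|\sum_i count_deviation R a (x i)|]|); last first.
    elim/big_ind2 : _ => [|A1 m1 A2 m2 h1 h2|//]; first by rewrite cards0.
    exact: leq_trans (leq_card_setU _ _) (leq_add h1 h2).
  apply: subset_leq_card; apply/fintype.subsetP => x; rewrite inE => hx.
  have [a ha] := not_aligned_deviates n0 k0 hx.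
  by apply/finset.bigcupP; exists a; rewrite ?inE.
have total := le_trans cover (ler_sum _ (fun a _ => card_deviates R n a k0)).
rewrite sumr_const card_ord in total.
have e1 : expR (- (n%:R * d)) * B <= 1.
  rewrite expRN mulrC ler_pdivrMr ?expR_gt0// mul1r.
  apply: (le_trans Bn); apply: le_trans (expR_ge1Dx _); lra.
apply: (@le_trans _ _ (k%:R ^+ n * (expR (- (n%:R * d)) * B))); last first.
  by rewrite -[leRHS]mulr1 ler_wpM2l// exprn_ge0.
apply: (le_trans (ler_wpM2l _ total)) => //.
rewrite -[X in 4 * X]mulr_natl /B -/d; lra.
Qed.

(** Relabelling the positions of either word is a change of variables in the
    sum over permutations. *)
Lemma sum_perm_relabel (R : realType) (n k : nat) (P : 'I_k -> 'I_k -> R)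
    (x y : {ffun 'I_n -> 'I_k}) (s t : 'S_n) :
  \sum_(p : 'S_n) \prod_i P (x i) (y (p i)) =
  \sum_(p : 'S_n) \prod_i P (x (s i)) (y (t (p i))).
Proof.
rewrite (reindex_inj (h := fun p : 'S_n => (s^-1 * p * t)%g)); last first.
  by move=> p q /mulIg /mulgI.
apply: eq_bigr => p _; rewrite (reindex_inj (@perm_inj _ s)).
by apply: eq_bigr => i _; rewrite !permM permK.
Qed.

Section symmetrization.
Variables (R : realType) (n k : nat) (P : 'I_k -> 'I_k -> R).
Variables (V : 'I_n -> 'I_n -> R) (e : R).
Hypothesis k0 : (0 < k)%N.
Hypothesis P0 : forall a b, 0 <= P a b.
Hypothesis V0 : forall i j, 0 <= V i j.
Let close (a : 'I_k) (i : 'I_n) :=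
  `|i.+1%:R / n%:R - a%:R / k%:R| <= 2 / k%:R :> R.
Hypothesis near : forall a b i j, close a i -> close b j ->
  expR (- e) * V i j <= k%:R ^+ 2 * P a b <= expR e * V i j.

Let perm_sum := \sum_(s : 'S_n) \prod_i V i (s i).
Let word_sum (x y : {ffun 'I_n -> 'I_k}) :=
  \sum_(s : 'S_n) \prod_i P (x i) (y (s i)).

(** The sorting permutations of [x] and [y] turn the average over all pairings
    of the two words into the permanent of [V], entry by entry. *)
Lemma aligned_words_approx (x y : {ffun 'I_n -> 'I_k}) :
  aligned R x -> aligned R y ->
  expR (- (n%:R * e)) * perm_sum <= k%:R ^+ n ^+ 2 * word_sum x y
    <= expR (n%:R * e) * perm_sum.
Proof.
move=> /existsP[s /forallP hs] /existsP[t /forallP ht].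
rewrite /word_sum (sum_perm_relabel _ _ _ s t).
have scale (c : R) (F : 'I_n -> R) :
    c ^+ n * \prod_i F i = \prod_i (c * F i).
  by rewrite big_split/= prodr_const card_ord.
rewrite -mulrN !expRM_natl exprAC !mulr_sumr.
apply/andP; split; apply: ler_sum => p _; rewrite !scale; apply: ler_prod => i _.
  by case/andP: (near (hs i) (ht (p i))) => -> _; rewrite mulr_ge0 ?expR_ge0.
case/andP: (near (hs i) (ht (p i))) => _ ->.
by rewrite mulr_ge0 ?exprn_ge0.
Qed.

Let perm_sum_ge0 : 0 <= perm_sum.
Proof. by apply: sumr_ge0 => s _; apply: prodr_ge0. Qed.

Let count_aligned : R := #|[set x : {ffun 'I_n -> 'I_k} | aligned R x]|%:R.

Hypothesis most : 4 * #|[set x : {ffun 'I_n -> 'I_k} | ~~ aligned R x]|%:R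
                  <= k%:R ^+ n :> R.

Let count_alignedE : count_aligned +
  #|[set x : {ffun 'I_n -> 'I_k} | ~~ aligned R x]|%:R = k%:R ^+ n.
Proof.
rewrite -natrD -natrX -[X in (_ ^ X)%N](card_ord n) -[X in (X ^ _)%N](card_ord k).
rewrite -card_ffun; congr (_%:R).
rewrite -[RHS](cardC (fun x : {ffun 'I_n -> 'I_k} => aligned R x)).
by congr (_ + _)%N; apply: eq_card => x; rewrite !inE.
Qed.

Let aligned_sum (F : R) :
  \sum_(x : {ffun 'I_n -> 'I_k} | aligned R x)
    \sum_(y : {ffun 'I_n -> 'I_k} | aligned R y) F = count_aligned ^+ 2 * F.
Proof.
rewrite /count_aligned -sum_indicator_card expr2 -mulrA mulr_suml.
apply: eq_bigr => x _; rewrite mul1r mulr_suml.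
by apply: eq_bigr => y _; rewrite mul1r.
Qed.

Let kn0 : 0 < k%:R ^+ n :> R. Proof. by rewrite exprn_gt0// ltr0n. Qed.

Let all_words_sum (s : 'S_n) :
  \sum_(x : {ffun 'I_n -> 'I_k}) \sum_(y : {ffun 'I_n -> 'I_k})
    \prod_i P (x i) (y (s i)) = (\sum_a \sum_b P a b) ^+ n.
Proof.
transitivity (\sum_(x : {ffun 'I_n -> 'I_k}) \prod_i (\sum_b P (x i) b)).
  apply: eq_bigr => x _.
  rewrite (bigA_distr_bigA (fun i b => P (x i) b)).
  rewrite (reindex_inj (h := fun y : {ffun 'I_n -> 'I_k} => [ffun i => y (s^-1 i)%g])).
    by apply: eq_bigr => y _; apply: eq_bigr => i _; rewrite ffunE permK.
  move=> y z /ffunP yz; apply/ffunP => i; have := yz (s i).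
  by rewrite !ffunE permK.
exact: (sum_ffun_prod n (fun a => \sum_b P a b)).
Qed.

(** The sum over aligned pairs is at most the sum over all pairs, which
    factorizes for each permutation; the factor 2 covers [(4 / 3) ^+ 2], the loss
    from the non-aligned words. *)
Lemma perm_sum_upper :
  perm_sum <= 2 * n`!%:R * expR (n%:R * e) * (\sum_a \sum_b P a b) ^+ n.
Proof.
have lo : count_aligned ^+ 2 * (expR (- (n%:R * e)) * perm_sum) <=
    k%:R ^+ n ^+ 2 * (n`!%:R * (\sum_a \sum_b P a b) ^+ n).
  rewrite -aligned_sum; apply: (@le_trans _ _
    (\sum_(x : {ffun 'I_n -> 'I_k} | aligned R x)
      \sum_(y : {ffun 'I_n -> 'I_k} | aligned R y)
        k%:R ^+ n ^+ 2 * word_sum x y)).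
    apply: ler_sum => x hx; apply: ler_sum => y hy.
    by case/andP: (aligned_words_approx hx hy).
  under eq_bigr do rewrite -mulr_sumr.
  rewrite -mulr_sumr ler_wpM2l ?exprn_ge0//.
  have term0 x y (s : 'S_n) : 0 <= \prod_i P (x i) (y (s i)).
    by apply: prodr_ge0.
  apply: (@le_trans _ _ (\sum_(x : {ffun 'I_n -> 'I_k})
      \sum_(y : {ffun 'I_n -> 'I_k}) word_sum x y)).
    have w0 x y : 0 <= word_sum x y by apply: sumr_ge0.
    rewrite [leLHS]big_mkcond/=; apply: ler_sum => x _.
    have h : \sum_(y : {ffun 'I_n -> 'I_k} | aligned R y) word_sum x y <=
             \sum_y word_sum x y.
      by rewrite [leLHS]big_mkcond/=; apply: ler_sum => y _; case: ifP.
    by case: ifP => // _; apply: sumr_ge0.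
  under eq_bigr do rewrite exchange_big.
  rewrite exchange_big/=; under eq_bigr do rewrite all_words_sum.
  by rewrite sumr_const card_Sn mulr_natl.
have c34 : 3 / 4 * k%:R ^+ n <= count_aligned by move: count_alignedE most; lra.
have c2 : 2^-1 * k%:R ^+ n ^+ 2 <= count_aligned ^+ 2.
  have : (3 / 4 * k%:R ^+ n) ^+ 2 <= count_aligned ^+ 2.
    by rewrite lerXn2r ?nnegrE// mulr_ge0// ltW.
  apply: le_trans; rewrite exprMn ler_wpM2r ?exprn_ge0//; lra.
have ep : 0 < expR (n%:R * e) by exact: expR_gt0.
have := ler_wpM2r (mulr_ge0 (expR_ge0 (- (n%:R * e))) perm_sum_ge0) c2.
move=> /le_trans/(_ lo); rewrite [X in X * _ <= _]mulrC -[leLHS]mulrA ler_pM2l ?exprn_gt0 ?ltr0n//.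
by rewrite expRN mulrCA ler_pdivrMl//; lra.
Qed.

(** With uniform marginals almost all of the mass of the product measure sits
    on aligned pairs, whose set is invariant under permuting one of the words;
    averaging over that permutation gives the bound. *)
Lemma perm_sum_lower :
  (forall a, \sum_b P a b = k%:R^-1) -> (forall b, \sum_a P a b = k%:R^-1) ->
  n`!%:R <= 2 * expR (n%:R * e) * perm_sum.
Proof.
move=> row col.
pose A := [pred x : {ffun 'I_n -> 'I_k} | aligned R x].
pose W (s : 'S_n) := \sum_(x | A x) \sum_(y | A y) \prod_i P (x i) (y (s i)).
have WE s : W s = W 1%g.
  apply: eq_bigr => x _.
  rewrite [RHS](reindex_inj (h := fun y : {ffun 'I_n -> 'I_k} => [ffun i => y (s i)])).
    apply: eq_big => y; first by rewrite /A /= aligned_perm.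
    by move=> _; apply: eq_bigr => i _; rewrite ffunE perm1.
  move=> y z /ffunP yz; apply/ffunP => i; have := yz (s^-1 i)%g.
  by rewrite !ffunE permKV.
have sumW : \sum_s W s = n`!%:R * W 1%g.
  by rewrite (eq_bigr _ (fun s _ => WE s)) sumr_const card_Sn mulr_natl.
have hi : k%:R ^+ n ^+ 2 * \sum_s W s <= count_aligned ^+ 2 * (expR (n%:R * e) * perm_sum).
  rewrite exchange_big/=; under eq_bigr do rewrite exchange_big/=.
  rewrite -aligned_sum mulr_sumr; apply: ler_sum => x hx.
  rewrite mulr_sumr; apply: ler_sum => y hy.
  by case/andP: (aligned_words_approx hx hy).
pose bad : R := #|[set x : {ffun 'I_n -> 'I_k} | ~~ aligned R x]|%:R.
pose w (x y : {ffun 'I_n -> 'I_k}) := \prod_i P (x i) (y i).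
have w0 x y : 0 <= w x y by apply: prodr_ge0.
have rowW x : \sum_y w x y = (k%:R ^+ n)^-1.
  rewrite -(bigA_distr_bigA (fun i b => P (x i) b)).
  by under eq_bigr do rewrite row; rewrite prodr_const card_ord exprVn.
have colW y : \sum_x w x y = (k%:R ^+ n)^-1.
  rewrite -(bigA_distr_bigA (fun i a => P a (y i))).
  by under eq_bigr do rewrite col; rewrite prodr_const card_ord exprVn.
have tot : \sum_x \sum_y w x y = 1.
  under eq_bigr do rewrite rowW.
  rewrite sumr_const card_ffun !card_ord -[_ *+ _]mulr_natl natrX divff//.
  exact: lt0r_neq0.
have badE : \sum_(x | ~~ A x) (k%:R ^+ n)^-1 <= 4^-1 :> R.
  rewrite (eq_bigr (fun=> 1 * (k%:R ^+ n)^-1)); last by move=> *; rewrite mul1r.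
  rewrite -mulr_suml sum_indicator_card ler_pdivrMr//.
  by move: most; rewrite /A/=; lra.
have half : 2^-1 <= W 1%g.
  have W1 : W 1%g = \sum_(x | A x) \sum_(y | A y) w x y.
    by apply: eq_bigr => x _; apply: eq_bigr => y _; apply: eq_bigr => i _; rewrite perm1.
  rewrite W1; have : \sum_x \sum_y w x y <= \sum_(x | A x) \sum_(y | A y) w x y
      + \sum_(y | ~~ A y) (k%:R ^+ n)^-1 + \sum_(x | ~~ A x) (k%:R ^+ n)^-1.
    rewrite [leLHS](bigID A)/=; apply: lerD; last first.
      by rewrite le_eqVlt; apply/orP; left; apply/eqP; apply: eq_bigr.
    under eq_bigr do rewrite (bigID A)/=.
    rewrite big_split/= lerD2l exchange_big/=; apply: ler_sum => y _.
    rewrite -(colW y) [leRHS](bigID A)/= lerDl; exact: sumr_ge0.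
  by rewrite tot; lra.
have c1 : count_aligned ^+ 2 <= k%:R ^+ n ^+ 2.
  by rewrite lerXn2r ?nnegrE ?(ltW kn0)// -count_alignedE lerDl.
have := le_trans hi (ler_wpM2r (mulr_ge0 (expR_ge0 (n%:R * e)) perm_sum_ge0) c1).
rewrite ler_pM2l ?exprn_gt0 ?ltr0n//.
rewrite sumW => h.
have := ler_wpM2l (ler0n R n`!) half; lra.
Qed.

End symmetrization.

Local Open Scope classical_set_scope.
Local Open Scope ring_scope.

(** * Averages of bounded measurable functions *)

Definition bounded_measurable d (T : measurableType d) (R : realType)
    (h : T -> R) : Prop :=
  measurable_fun setT h /\ exists M : R, forall x, `|h x| <= M.

(** For bounded measurable integrands the real valued integral behaves as an
    expectation, without integrability conditions. *)
Definition avg d (T : measurableType d) (R : realType) (P : probability T R)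
    (h : T -> R) : R := \int[P]_x h x.

Section bounded_measurable_theory.
Context d (T : measurableType d) (R : realType).
Implicit Types g h : T -> R.

Lemma bounded_measurable_bound h : bounded_measurable h ->
  exists2 M : R, 0 < M & forall x, `|h x| <= M.
Proof.
move=> [_ [M hM]]; exists (`|M| + 1); first by rewrite ltr_wpDl.
by move=> x; apply: (le_trans (hM x)); rewrite (le_trans (ler_norm _))// lerDl.
Qed.

Lemma bounded_measurable_cst (c : R) : bounded_measurable (fun _ : T => c).
Proof. by split; [exact: measurable_cst|exists `|c|]. Qed.

Lemma bounded_measurableD g h : bounded_measurable g -> bounded_measurable h ->
  bounded_measurable (fun x => g x + h x).
Proof.
move=> [mg [M hM]] [mh [N hN]]; split; first exact: measurable_funD.
by exists (M + N) => x; rewrite (le_trans (ler_normD _ _))// lerD.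
Qed.

Lemma bounded_measurableN g : bounded_measurable g ->
  bounded_measurable (fun x => - g x).
Proof.
move=> [mg [M hM]]; split; first exact: measurableT_comp.
by exists M => x; rewrite normrN.
Qed.

Lemma bounded_measurableB g h : bounded_measurable g -> bounded_measurable h ->
  bounded_measurable (fun x => g x - h x).
Proof.
by move=> bg bh; apply: bounded_measurableD => //; exact: bounded_measurableN.
Qed.

Lemma bounded_measurableM g h : bounded_measurable g -> bounded_measurable h ->
  bounded_measurable (fun x => g x * h x).
Proof.
move=> [mg [M hM]] [mh [N hN]]; split; first exact: measurable_funM.
by exists (M * N) => x; rewrite normrM ler_pM.
Qed.

Lemma bounded_measurableZ (c : R) g : bounded_measurable g ->
  bounded_measurable (fun x => c * g x).
Proof.
by move=> bg; apply: bounded_measurableM => //; exact: bounded_measurable_cst.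
Qed.

Lemma bounded_measurable_expR g : bounded_measurable g ->
  bounded_measurable (fun x => expR (g x)).
Proof.
move=> [mg [M hM]]; split; first exact: (measurableT_comp (@measurable_expR R)).
exists (expR M) => x; rewrite ger0_norm ?expR_ge0// ler_expR.
by rewrite (le_trans (ler_norm _)).
Qed.

Lemma bounded_measurable_ln g (m : R) : bounded_measurable g -> 0 < m ->
  (forall x, m <= g x) -> bounded_measurable (fun x => ln (g x)).
Proof.
move=> [mg [M hM]] m0 mgx; split; first exact: (measurableT_comp (@measurable_ln R)).
exists (`|ln m| + `|ln M|) => x; have gx0 := lt_le_trans m0 (mgx x).
have gM : g x <= M by rewrite (le_trans (ler_norm _)).
have M0 := lt_le_trans gx0 gM.
have l1 : ln m <= ln (g x) by rewrite ler_ln.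
have l2 : ln (g x) <= ln M by rewrite ler_ln.
have := ler_norm (ln M); have := ler_norm (- ln m); rewrite normrN.
have := normr_ge0 (ln M); have := normr_ge0 (ln m).
by move=> ? ? ? ?; apply/ler_normlP; split; lra.
Qed.

Lemma bounded_measurable_comp d' (T' : measurableType d') (h : T' -> R)
    (phi : T -> T') : bounded_measurable h -> measurable_fun setT phi ->
  bounded_measurable (fun x => h (phi x)).
Proof.
move=> [mh [M hM]] mphi; split; first exact: (measurableT_comp mh).
by exists M => x.
Qed.

Variable P : probability T R.

Lemma bounded_measurable_integrable h : bounded_measurable h ->
  P.-integrable setT (EFin \o h).
Proof.
move=> [mh [M hM]]; apply: measurable_bounded_integrable => //.
  exact: le_lt_trans (probability_le1 P measurableT) (ltry 1).
by exists M; split; [exact: num_real|move=> N MN x _; exact: le_trans (hM x) (ltW MN)].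
Qed.

Lemma avgD g h : bounded_measurable g -> bounded_measurable h ->
  avg P (fun x => g x + h x) = avg P g + avg P h.
Proof. by move=> bg bh; apply: RintegralD => //; exact: bounded_measurable_integrable. Qed.

Lemma avgZ (c : R) g : bounded_measurable g ->
  avg P (fun x => c * g x) = c * avg P g.
Proof. by move=> bg; apply: RintegralZl => //; exact: bounded_measurable_integrable. Qed.

Lemma avgN g : bounded_measurable g -> avg P (fun x => - g x) = - avg P g.
Proof.
move=> bg; rewrite -[RHS]mulN1r -avgZ//.
by apply: eq_Rintegral => x _; rewrite mulN1r.
Qed.

Lemma avgB g h : bounded_measurable g -> bounded_measurable h ->
  avg P (fun x => g x - h x) = avg P g - avg P h.
Proof. by move=> bg bh; rewrite avgD ?avgN//; exact: bounded_measurableN. Qed.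

Lemma avg_cst (c : R) : avg P (fun=> c) = c.
Proof.
rewrite /avg Rintegral_cst// [X in _ * fine X](_ : _ = 1%E) ?mulr1//.
exact: (probability_setT P).
Qed.

Lemma avg_le g h : bounded_measurable g -> bounded_measurable h ->
  (forall x, g x <= h x) -> avg P g <= avg P h.
Proof. by move=> bg bh gh; apply: le_Rintegral => //; exact: bounded_measurable_integrable. Qed.

Lemma avg_ge0 g : (forall x, 0 <= g x) -> 0 <= avg P g.
Proof. by move=> g0; apply: Rintegral_ge0. Qed.

Lemma avg_norm_le g (M : R) : bounded_measurable g -> (forall x, `|g x| <= M) ->
  `|avg P g| <= M.
Proof.
move=> bg gM; have bc := bounded_measurable_cst.
by apply/ler_normlP; split; rewrite -[leRHS](avg_cst M) -?avgN//; apply: avg_le;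
  rewrite //=; [exact: bounded_measurableN|move=> x; rewrite (le_trans (ler_norm _))//
  normrN|move=> x; rewrite (le_trans (ler_norm _))].
Qed.

Lemma avg_expR_gt0 g : bounded_measurable g -> 0 < avg P (fun x => expR (g x)).
Proof.
move=> bg; have [M M0 gM] := bounded_measurable_bound bg.
apply: (lt_le_trans (expR_gt0 (- M))); rewrite -[leLHS]avg_cst.
apply: avg_le; [exact: bounded_measurable_cst|exact: bounded_measurable_expR|].
by move=> x; rewrite ler_expR; have /ler_normlP[] := gM x; lra.
Qed.

Lemma EFin_avg g : bounded_measurable g -> (\int[P]_x (g x)%:E)%E = (avg P g)%:E.
Proof.
move=> bg; rewrite /avg /Rintegral fineK//.
by apply: integrable_fin_num => //; exact: bounded_measurable_integrable.
Qed.

End bounded_measurable_theory.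

Section fubini_avg.
Context d1 d2 (T1 : measurableType d1) (T2 : measurableType d2) (R : realType).
Variables (P1 : probability T1 R) (P2 : probability T2 R).
Variable w : T1 * T2 -> R.
Hypothesis bw : bounded_measurable w.

Lemma bounded_measurable_pair1 x : bounded_measurable (fun y => w (x, y)).
Proof. by apply: (bounded_measurable_comp bw); exact: measurable_pair1. Qed.

Lemma bounded_measurable_pair2 y : bounded_measurable (fun x => w (x, y)).
Proof. by apply: (bounded_measurable_comp bw); exact: measurable_pair2. Qed.

Let iw : (P1 \x P2)%E.-integrable setT (EFin \o w).
Proof. exact: (bounded_measurable_integrable (P1 \x P2)%E bw). Qed.

Lemma bounded_measurable_avg1 :
  bounded_measurable (fun x => avg P2 (fun y => w (x, y))).
Proof.
have [M M0 wM] := bounded_measurable_bound bw; split; last first.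
  exists M => x; apply: avg_norm_le => //; exact: bounded_measurable_pair1.
have /(measurableT_comp (fine_measurable measurableT)) := measurable_fubini_F iw.
by [].
Qed.

Lemma bounded_measurable_avg2 :
  bounded_measurable (fun y => avg P1 (fun x => w (x, y))).
Proof.
have [M M0 wM] := bounded_measurable_bound bw; split; last first.
  exists M => x; apply: avg_norm_le => //; exact: bounded_measurable_pair2.
have /(measurableT_comp (fine_measurable measurableT)) := measurable_fubini_G iw.
by [].
Qed.

Lemma avg_prod12 :
  avg (P1 \x P2)%E w = avg P1 (fun x => avg P2 (fun y => w (x, y))).
Proof.
rewrite /avg {1}/Rintegral -integral12_prod_meas1//; congr fine.
apply: eq_integral => x _; rewrite /fubini_F/= EFin_avg//.
exact: bounded_measurable_pair1.
Qed.

Lemma avg_prod21 :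
  avg (P1 \x P2)%E w = avg P2 (fun y => avg P1 (fun x => w (x, y))).
Proof.
rewrite /avg {1}/Rintegral -integral21_prod_meas1//; congr fine.
apply: eq_integral => x _; rewrite /fubini_G/= EFin_avg//.
exact: bounded_measurable_pair2.
Qed.

End fubini_avg.

(** * Sinkhorn scaling of a bounded kernel *)

Definition log_avg_exp d (T : measurableType d) (R : realType)
    (P : probability T R) (h : T -> R) : R := ln (avg P (fun x => expR (h x))).

Section log_avg_exp_theory.
Context d (T : measurableType d) (R : realType) (P : probability T R).
Implicit Types g h : T -> R.

Lemma expR_log_avg_exp h : bounded_measurable h ->
  expR (log_avg_exp P h) = avg P (fun x => expR (h x)).
Proof. by move=> bh; rewrite lnK// posrE; exact: avg_expR_gt0. Qed.

(** Exponential averages are monotone and commute with shifts, hence move by at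
    most the uniform distance of the exponents. *)
Lemma log_avg_exp_le g h (e : R) : bounded_measurable g -> bounded_measurable h ->
  (forall x, g x <= h x + e) -> log_avg_exp P g <= log_avg_exp P h + e.
Proof.
move=> bg bh gh; rewrite -ler_expR expRD !expR_log_avg_exp// mulrC.
rewrite -avgZ; last exact: bounded_measurable_expR.
apply: avg_le; [exact: bounded_measurable_expR| |].
  by apply: bounded_measurableZ; exact: bounded_measurable_expR.
by move=> x; rewrite -expRD ler_expR addrC.
Qed.

Let avg_comb3 (a b c : R) (f g h : T -> R) : bounded_measurable f ->
  bounded_measurable g -> bounded_measurable h ->
  avg P (fun x => a * f x + (b * g x - c * h x)) =
  a * avg P f + (b * avg P g - c * avg P h).
Proof.
move=> bf bg bh; rewrite avgD; [|exact: bounded_measurableZ|].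
  by rewrite avgB ?avgZ//; exact: bounded_measurableZ.
by apply: bounded_measurableB; exact: bounded_measurableZ.
Qed.

(** Normalized densities that are comparable up to the factor [expR (2 * C)]
    share the proportion [eta := expR (- (2 * C))] of their mass, and only the
    rest feels the oscillation of [u]. *)
Lemma tilted_ratio_contracts (h g u : T -> R) (C K : R) :
  bounded_measurable h -> bounded_measurable g -> bounded_measurable u ->
  (forall y, `|h y - g y| <= C) ->
  0 <= K -> (forall y y', expR (u y - u y') <= 1 + K) ->
  expR (log_avg_exp P (fun y => h y + u y) - log_avg_exp P h
        - (log_avg_exp P (fun y => g y + u y) - log_avg_exp P g))
  <= 1 + (1 - expR (- (2 * C))) * K.
Proof.
move=> bh bg bu hg K0 osc.
have bhu := bounded_measurableD bh bu; have bgu := bounded_measurableD bg bu.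
(* Names without a body, so that comparing two of them does not unfold the
   averages. *)
have abstr (r : R) : exists s, s = r by exists r.
have [lh lhE] := abstr (log_avg_exp P h); have [lg lgE] := abstr (log_avg_exp P g).
have [lhu lhuE] := abstr (log_avg_exp P (fun y => h y + u y)).
have [lgu lguE] := abstr (log_avg_exp P (fun y => g y + u y)).
rewrite -lhE -lgE -lhuE -lguE.
have [eta etaE] := abstr (expR (- (2 * C))).
rewrite -etaE.
have lhg : lh <= lg + C.
  rewrite lhE lgE; apply: log_avg_exp_le => // y.
  by rewrite -lerBlDl (le_trans (ler_norm _)).
have dens y : eta * expR (g y - lg) <= expR (h y - lh).
  have gh : g y - h y <= C by rewrite (le_trans (ler_norm _))// distrC.
  have -> : h y - lh = - (2 * C) + (g y - lg) + (C - (g y - h y)) + (lg + C - lh) by ring.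
  rewrite etaE -expRD ler_expR -addrA lerDl addr_ge0// subr_ge0//.
have bexp (f : T -> R) (c : R) : bounded_measurable f ->
    bounded_measurable (fun y => expR (f y - c)).
  move=> bf; apply: bounded_measurable_expR.
  by apply: bounded_measurableB => //; exact: bounded_measurable_cst.
have avgE (f : T -> R) (c : R) : bounded_measurable f ->
    avg P (fun y => expR (f y - c)) = expR (log_avg_exp P f - c).
  move=> bf; rewrite expRD expR_log_avg_exp// mulrC -avgZ; last exact: bounded_measurable_expR.
  by apply: eq_Rintegral => y _; rewrite expRD mulrC.
have umax y : expR (u y) <= (1 + K) * expR (lgu - lg).
  have -> : expR (u y) = avg P (fun y' => expR (u y) * expR (g y' - lg)).
    by rewrite avgZ ?avgE -?lgE ?subrr ?expR0 ?mulr1//; exact: bexp.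
  have -> : (1 + K) * expR (lgu - lg) =
      avg P (fun y' => (1 + K) * expR (g y' + u y' - lg)).
    by rewrite avgZ ?avgE -?lguE//; exact: bexp.
  apply: avg_le; [exact/bounded_measurableZ/bexp|exact/bounded_measurableZ/bexp|].
  move=> y'; rewrite -expRD.
  have -> : u y + (g y' - lg) = (u y - u y') + (g y' + u y' - lg) by ring.
  by rewrite expRD ler_wpM2r ?expR_ge0.
have [A' A'E] := abstr (expR (lgu - lg)).
rewrite -A'E in umax *.
have key : expR (lhu - lh) <= eta * A' + (1 - eta) * ((1 + K) * A').
  have dens_fun (f : T -> R) (c : R) : bounded_measurable f ->
      exists F : T -> R, [/\ forall y, F y = expR (f y - c), bounded_measurable F &
        avg P F = expR (log_avg_exp P f - c)].
    by move=> bf; exists (fun y => expR (f y - c)); split => //; [exact: bexp|exact: avgE].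
  have [f1 [E1 b1 a1]] := dens_fun _ lg bgu; have [f2 [E2 b2 a2]] := dens_fun _ lh bh.
  have [f3 [E3 b3 a3]] := dens_fun _ lg bg; have [f4 [E4 b4 a4]] := dens_fun _ lh bhu.
  rewrite -lguE -A'E in a1; rewrite -lhE subrr expR0 in a2.
  rewrite -lgE subrr expR0 in a3; rewrite -lhuE in a4.
  have -> : eta * A' + (1 - eta) * ((1 + K) * A') =
      avg P (fun y => eta * f1 y + ((1 + K) * A' * f2 y - (1 + K) * A' * eta * f3 y)).
    by rewrite (avg_comb3 _ _ _ b1 b2 b3) a1 a2 a3; ring.
  rewrite -a4; apply: avg_le; [by []|apply: bounded_measurableD|move=> y].
  - exact: bounded_measurableZ.
  - by apply: bounded_measurableB; exact: bounded_measurableZ.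
  have split_u f c : expR (f + u y - c) = expR (f - c) * expR (u y).
    by rewrite -expRD; congr expR; ring.
  rewrite E1 E2 E3 E4 (split_u (g y) lg) (split_u (h y) lh).
  have := umax y; have := dens y.
  move: (expR (h y - lh)) (expR (g y - lg)) (expR (u y)) => p p' U d1 d2.
  have : 0 <= (p - eta * p') * ((1 + K) * A' - U) by rewrite mulr_ge0// subr_ge0.
  clear; lra.
rewrite expRD [expR (- _)]expRN ler_pdivrMr ?expR_gt0//; apply: (le_trans key).
by rewrite -A'E le_eqVlt; apply/orP; left; apply/eqP; ring.
Qed.

End log_avg_exp_theory.

(** The corrected sequences [u n - C * rho ^+ n] and [u n + C * rho ^+ n] are
    monotone in opposite directions and enclose the limit, at a rate. *)
Lemma geometric_limit (R : realType) (u : nat -> R) (K rho : R) :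
  0 <= rho < 1 -> (forall n, `|u n.+1 - u n| <= K * rho ^+ n) ->
  exists l, forall n, `|l - u n| <= K / (1 - rho) * rho ^+ n.
Proof.
move=> /andP[r0 r1] du; set C := K / (1 - rho).
have CK : C * (1 - rho) = K by rewrite divfK// gt_eqF// subr_gt0.
have step n : C * rho ^+ n - C * rho ^+ n.+1 = K * rho ^+ n.
  by rewrite -CK exprS; lra.
pose lo n := u n - C * rho ^+ n; pose hi n := u n + C * rho ^+ n.
have lo_up : {homo lo : m n / (m <= n)%N >-> m <= n}.
  apply: homo_leq => [x|x y z|n]; [exact: lexx|exact: le_trans|].
  by rewrite /lo; have /ler_normlP[] := du n; have := step n; lra.
have hi_dn : {homo hi : m n / (m <= n)%N >-> n <= m}.
  apply: homo_leq => [x|x y z ab bc|n]; [exact: lexx|exact: le_trans bc ab|].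
  by rewrite /hi; have /ler_normlP[] := du n; have := step n; lra.
have K0 : 0 <= K by have := du 0%N; rewrite expr0 mulr1; apply: le_trans.
have C0 : 0 <= C by rewrite divr_ge0// subr_ge0 ltW.
have lohi m n : lo m <= hi n.
  apply: (le_trans (lo_up _ _ (leq_maxl m n))).
  apply: le_trans (hi_dn _ _ (leq_maxr m n)).
  have : 0 <= C * rho ^+ maxn m n by rewrite mulr_ge0// exprn_ge0.
  by rewrite /lo /hi; lra.
exists (sup (range lo)) => n.
have h1 : lo n <= sup (range lo).
  apply: ub_le_sup; last by exists n.
  by exists (hi 0%N) => _ [m _ <-].
have h2 : sup (range lo) <= hi n.
  apply: ge_sup; first by exists (lo 0%N); exists 0%N.
  by move=> _ [m _ <-].
by move: h1 h2; rewrite /lo /hi => h1 h2; apply/ler_normlP; split; lra.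
Qed.

Lemma cvg_geometric_bound (R : realType) (u : nat -> R) (l C rho : R) :
  0 <= rho < 1 -> (forall n, `|l - u n| <= C * rho ^+ n) -> u n @[n --> \oo] --> l.
Proof.
move=> /andP[r0 r1] hu.
have gc : C * rho ^+ n @[n --> \oo] --> (0 : R).
  rewrite -(mulr0 C); apply: cvgM; [exact: cvg_cst|apply: cvg_expr].
  by rewrite ger0_norm.
apply/cvgrPdist_le => e e0; move/cvgrPdist_le : gc => /(_ _ e0).
apply: filterS => n; rewrite sub0r normrN => h.
exact: le_trans (hu n) (le_trans (ler_norm _) h).
Qed.

Lemma geometric_bound_eq0 (R : realType) (z C rho : R) :
  0 <= rho < 1 -> (forall n, `|z| <= C * rho ^+ n) -> z = 0.
Proof.
move=> hr hz; have h : (0 : R) @[n --> \oo] --> z.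
  by apply: (@cvg_geometric_bound _ (fun=> 0) z C rho hr) => n; rewrite subr0.
by apply/esym; apply: (cvg_unique _ (@cvg_cst _ (0 : R) _ _ _)) h.
Qed.

(* The arithmetic tactics compare real atoms up to conversion, which must not
   unfold integrals. *)
Local Opaque avg log_avg_exp.

Section sinkhorn.
Context d1 d2 (T1 : measurableType d1) (T2 : measurableType d2) (R : realType).
Variables (P1 : probability T1 R) (P2 : probability T2 R).
Variable w : T1 * T2 -> R.
Hypothesis bw : bounded_measurable w.

(** One step of the Sinkhorn iteration in logarithmic form, for each of the two
    marginals. *)
Definition row_scaling (b : T2 -> R) (x : T1) : R :=
  - log_avg_exp P2 (fun y => w (x, y) + b y).
Definition col_scaling (a : T1 -> R) (y : T2) : R :=
  - log_avg_exp P1 (fun x => w (x, y) + a x).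

Let bwb b x : bounded_measurable b ->
  bounded_measurable (fun y : T2 => w (x, y) + b y).
Proof. by move=> bb; apply: bounded_measurableD => //; exact: bounded_measurable_pair1. Qed.

Let bwa a y : bounded_measurable a ->
  bounded_measurable (fun x : T1 => w (x, y) + a x).
Proof. by move=> ba; apply: bounded_measurableD => //; exact: bounded_measurable_pair2. Qed.

Let lower_bound_exp d (T : measurableType d) (P : probability T R) (h : T -> R) M :
  bounded_measurable h -> (forall x, `|h x| <= M) ->
  expR (- M) <= avg P (fun x => expR (h x)).
Proof.
move=> bh hM; rewrite -[leLHS](avg_cst P); apply: avg_le.
- exact: bounded_measurable_cst.
- exact: bounded_measurable_expR.
- by move=> x; rewrite ler_expR; have /ler_normlP[] := hM x; lra.
Qed.

Lemma bounded_measurable_row_scaling b : bounded_measurable b ->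
  bounded_measurable (row_scaling b).
Proof.
move=> bb; apply: bounded_measurableN.
have bW : bounded_measurable (fun z : T1 * T2 => w z + b z.2).
  by apply: bounded_measurableD => //; exact: (bounded_measurable_comp bb measurable_snd).
have [M M0 hM] := bounded_measurable_bound bW.
apply: (@bounded_measurable_ln _ _ _ _ (expR (- M))); last 2 first.
- exact: expR_gt0.
- by move=> x; apply: lower_bound_exp => [|y]; [exact: bwb|exact: (hM (x, y))].
have := bounded_measurable_avg1 P1 P2 (bounded_measurable_expR bW).
by [].
Qed.

Lemma bounded_measurable_col_scaling a : bounded_measurable a ->
  bounded_measurable (col_scaling a).
Proof.
move=> ba; apply: bounded_measurableN.
have bW : bounded_measurable (fun z : T1 * T2 => w z + a z.1).
  by apply: bounded_measurableD => //; exact: (bounded_measurable_comp ba measurable_fst).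
have [M M0 hM] := bounded_measurable_bound bW.
apply: (@bounded_measurable_ln _ _ _ _ (expR (- M))); last 2 first.
- exact: expR_gt0.
- by move=> y; apply: lower_bound_exp => [|x]; [exact: bwa|exact: (hM (x, y))].
have := bounded_measurable_avg2 P1 P2 (bounded_measurable_expR bW).
by [].
Qed.

(** [oscillates u K] bounds the Hilbert projective distance of [expR u] to a
    constant, in the scale in which a scaling step contracts linearly. *)
Definition oscillates (T : Type) (u : T -> R) (K : R) : Prop :=
  forall y y', expR (u y - u y') <= 1 + K.

Lemma oscillates_norm (T : Type) (u : T -> R) (K : R) y0 y :
  oscillates u K -> u y0 = 0 -> `|u y| <= K.
Proof.
move=> osc u0; apply/ler_normlP; split.
  have := le_trans (expR_ge1Dx (u y0 - u y)) (osc y0 y); rewrite u0; lra.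
have := le_trans (expR_ge1Dx (u y - u y0)) (osc y y0); rewrite u0; lra.
Qed.

(** Any two rows of the kernel are within a factor [expR (2 * M)] of each other,
    whence the common proportion [expR (- (2 * (2 * M)))] of the normalized
    densities. *)
Lemma scaling_contracts : exists2 rho : R, 0 <= rho < 1 &
  (forall b b' K, bounded_measurable b -> bounded_measurable b' -> 0 <= K ->
    oscillates (fun y => b' y - b y) K ->
    oscillates (fun x => row_scaling b' x - row_scaling b x) (rho * K)) /\
  (forall a a' K, bounded_measurable a -> bounded_measurable a' -> 0 <= K ->
    oscillates (fun x => a' x - a x) K ->
    oscillates (fun y => col_scaling a' y - col_scaling a y) (rho * K)).
Proof.
have [M M0 wM] := bounded_measurable_bound bw.
exists (1 - expR (- (2 * (2 * M)))).
  have h1 : expR (- (2 * (2 * M))) <= 1 by rewrite expR_le1; lra.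
  by have := expR_gt0 (- (2 * (2 * M))); lra.
split.
- move=> b b' K bb bb' K0 osc x x'.
  have := @tilted_ratio_contracts _ _ _ P2 (fun y => w (x', y) + b y)
    (fun y => w (x, y) + b y) (fun y => b' y - b y) (2 * M) K (bwb _ bb) (bwb _ bb)
    (bounded_measurableB bb' bb) _ K0 osc.
  have close y : `|w (x', y) + b y - (w (x, y) + b y)| <= 2 * M.
    have /ler_normlP[] := wM (x, y); have /ler_normlP[] := wM (x', y).
    by move=> *; apply/ler_normlP; split; lra.
  have E z : (fun y => w (z, y) + b y + (b' y - b y)) = (fun y => w (z, y) + b' y).
    by apply/funext => y; ring.
  move=> /(_ close); rewrite !E; apply: le_trans; rewrite ler_expR /row_scaling.
  move: (log_avg_exp _ _) (log_avg_exp _ _) (log_avg_exp _ _) (log_avg_exp _ _).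
  by move=> *; lra.
- move=> a a' K ba ba' K0 osc y y'.
  have := @tilted_ratio_contracts _ _ _ P1 (fun x => w (x, y') + a x)
    (fun x => w (x, y) + a x) (fun x => a' x - a x) (2 * M) K (bwa _ ba) (bwa _ ba)
    (bounded_measurableB ba' ba) _ K0 osc.
  have close x : `|w (x, y') + a x - (w (x, y) + a x)| <= 2 * M.
    have /ler_normlP[] := wM (x, y); have /ler_normlP[] := wM (x, y').
    by move=> *; apply/ler_normlP; split; lra.
  have E z : (fun x => w (x, z) + a x + (a' x - a x)) = (fun x => w (x, z) + a' x).
    by apply/funext => x; ring.
  move=> /(_ close); rewrite !E; apply: le_trans; rewrite ler_expR /col_scaling.
  move: (log_avg_exp _ _) (log_avg_exp _ _) (log_avg_exp _ _) (log_avg_exp _ _).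
  by move=> *; lra.
Qed.

Lemma row_scaling_nonexpansive b b' e x : bounded_measurable b -> bounded_measurable b' ->
  (forall y, `|b y - b' y| <= e) -> `|row_scaling b x - row_scaling b' x| <= e.
Proof.
move=> bb bb' bbe.
have h1 : log_avg_exp P2 (fun y => w (x, y) + b y) <=
    log_avg_exp P2 (fun y => w (x, y) + b' y) + e.
  apply: log_avg_exp_le => [||y]; [exact: bwb..|].
  by have /ler_normlP[] := bbe y; lra.
have h2 : log_avg_exp P2 (fun y => w (x, y) + b' y) <=
    log_avg_exp P2 (fun y => w (x, y) + b y) + e.
  apply: log_avg_exp_le => [||y]; [exact: bwb..|].
  by have /ler_normlP[] := bbe y; lra.
rewrite /row_scaling; move: h1 h2; move: (log_avg_exp _ _) (log_avg_exp _ _).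
by move=> r s h1 h2; apply/ler_normlP; split; lra.
Qed.

Lemma col_scaling_nonexpansive a a' e y : bounded_measurable a -> bounded_measurable a' ->
  (forall x, `|a x - a' x| <= e) -> `|col_scaling a y - col_scaling a' y| <= e.
Proof.
move=> ba ba' aae.
have h1 : log_avg_exp P1 (fun x => w (x, y) + a x) <=
    log_avg_exp P1 (fun x => w (x, y) + a' x) + e.
  apply: log_avg_exp_le => [||x]; [exact: bwa..|].
  by have /ler_normlP[] := aae x; lra.
have h2 : log_avg_exp P1 (fun x => w (x, y) + a' x) <=
    log_avg_exp P1 (fun x => w (x, y) + a x) + e.
  apply: log_avg_exp_le => [||x]; [exact: bwa..|].
  by have /ler_normlP[] := aae x; lra.
rewrite /col_scaling; move: h1 h2; move: (log_avg_exp _ _) (log_avg_exp _ _).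
by move=> r s h1 h2; apply/ler_normlP; split; lra.
Qed.

Variable y0 : T2.

(** A full round of scalings has a fixed point up to a constant: successive
    iterates approach each other geometrically in oscillation, and scalings are
    nonexpansive for the uniform distance, so that the limit is again fixed. *)
Lemma scaling_fixpoint : exists2 b : T2 -> R, bounded_measurable b &
  exists c, forall y, col_scaling (row_scaling b) y = b y + c.
Proof.
(* The iterates are pinned to vanish at [y0]: the scalings commute with additive
   constants, so that only the oscillation has to be controlled. *)
have [iterate [iterate0 iterateS]] : exists it : nat -> T2 -> R, it 0%N = (fun=> 0) /\
    forall n, it n.+1 = (fun z => col_scaling (row_scaling (it n)) z
                                  - col_scaling (row_scaling (it n)) y0).
  by exists (fun n => iter n (fun b y => col_scaling (row_scaling b) y
                                  - col_scaling (row_scaling b) y0) (fun=> 0)).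
have bounded_measurable_iterate n : bounded_measurable (iterate n).
  elim: n => [|n ih]; first by rewrite iterate0; exact: bounded_measurable_cst.
  rewrite iterateS; apply: bounded_measurableB; last exact: bounded_measurable_cst.
  exact/bounded_measurable_col_scaling/bounded_measurable_row_scaling.
have [rho /andP[rho0 rho1] [rowK colK]] := scaling_contracts.
have rr0 : 0 <= rho * rho by rewrite mulr_ge0.
have rr : 0 <= rho * rho < 1 by rewrite rr0 /= -[ltRHS]mul1r ltr_pM.
have brow n := bounded_measurable_row_scaling (bounded_measurable_iterate n).
have [M M0 itM] := bounded_measurable_bound (bounded_measurable_iterate 1).
pose K := expR (2 * M).
have K0 : 0 <= K by exact: expR_ge0.
have osc n : oscillates (fun y => iterate n.+1 y - iterate n y) (K * (rho * rho) ^+ n).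
  elim: n => [|n ih].
    move=> y y'; rewrite expr0 mulr1 /K; apply: (@le_trans _ _ (expR (2 * M))).
      rewrite ler_expR; have /ler_normlP[] := itM y; have /ler_normlP[] := itM y'.
      rewrite iterate0 !subr0.
      by move: (iterate 1 y) (iterate 1 y') => p q *; lra.
    by rewrite lerDr.
  have Kn0 : 0 <= K * (rho * rho) ^+ n by rewrite mulr_ge0// exprn_ge0.
  have h1 := rowK _ _ _ (bounded_measurable_iterate n) (bounded_measurable_iterate n.+1) Kn0 ih.
  have h2 := colK _ _ _ (brow n) (brow n.+1) (mulr_ge0 rho0 Kn0) h1.
  move=> y y'; have -> : K * (rho * rho) ^+ n.+1 = rho * (rho * (K * (rho * rho) ^+ n)).
    by rewrite exprS; ring.
  apply: le_trans (h2 y y'); rewrite ler_expR le_eqVlt; apply/orP; left; apply/eqP.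
  have step m z : iterate m.+1 z = col_scaling (row_scaling (iterate m)) z -
      col_scaling (row_scaling (iterate m)) y0 by rewrite iterateS.
  have unpin (F G : T2 -> R) (c e : R) : F y - c - (G y - e) - (F y' - c - (G y' - e)) =
      F y - G y - (F y' - G y') by ring.
  by rewrite (step n.+1 y) (step n.+1 y') (step n y) (step n y') unpin.
have it0 n : iterate n y0 = 0 by case: n => [|n]; rewrite ?iterate0// iterateS subrr.
have du y n : `|iterate n.+1 y - iterate n y| <= K * (rho * rho) ^+ n.
  by apply: (@oscillates_norm _ _ _ y0 y (osc n)); rewrite /= !it0 subrr.
have /choice[b hb] : forall y, exists l, forall n,
    `|l - iterate n y| <= K / (1 - rho * rho) * (rho * rho) ^+ n.
  by move=> y; exact: (geometric_limit rr (du y)).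
set C := K / (1 - rho * rho) in hb.
have C0 : 0 <= C by rewrite divr_ge0// subr_ge0; case/andP : rr => _ /ltW.
have bb : bounded_measurable b.
  split.
    apply: (@measurable_fun_cvg _ _ _ _ iterate) => [n|y _].
      by case: (bounded_measurable_iterate n).
    exact: (cvg_geometric_bound rr (hb y)).
  by exists C => y; have := hb y 0%N; rewrite iterate0 subr0 expr0 mulr1.
exists b => //; exists (col_scaling (row_scaling b) y0) => y.
have close n z : `|col_scaling (row_scaling b) z - col_scaling (row_scaling (iterate n)) z|
    <= C * (rho * rho) ^+ n.
  apply: col_scaling_nonexpansive => [||x]; [exact: bounded_measurable_row_scaling|exact: brow|].
  by apply: row_scaling_nonexpansive.
apply/eqP; rewrite -subr_eq0; apply/eqP.
apply: (@geometric_bound_eq0 _ _ (3 * C) (rho * rho)) => // n.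
have arith (p q c1 c2 c3 c4 z : R) : q <= p -> `|z - (c2 - c4)| <= q ->
    `|c3 - c4| <= p -> `|c1 - c2| <= p -> `|c1 - (z + c3)| <= 3 * p.
  move=> qp /ler_normlP[h1 h2] /ler_normlP[h3 h4] /ler_normlP[h5 h6].
  by apply/ler_normlP; split; lra.
have decr : C * (rho * rho) ^+ n.+1 <= C * (rho * rho) ^+ n.
  rewrite ler_wpM2l// exprS ler_piMl ?exprn_ge0//; case/andP : rr => _ /ltW//.
have hbn := hb y n.+1; rewrite iterateS in hbn.
by rewrite -[3 * C * _]mulrA; exact: arith decr hbn (close n y0) (close n y).
Qed.

(** Any positive kernel can be rescaled to have uniform marginals: at the fixed
    point the rows are normalized and the columns all have the same mass, which
    Fubini then identifies as one. *)
Theorem sinkhorn_scaling : exists (a : T1 -> R) (b : T2 -> R),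
  [/\ bounded_measurable a, bounded_measurable b,
    (forall x, avg P2 (fun y => expR (w (x, y) + a x + b y)) = 1) &
    (forall y, avg P1 (fun x => expR (w (x, y) + a x + b y)) = 1)].
Proof.
have [b bb [c bc]] := scaling_fixpoint; pose a := row_scaling b.
have ba : bounded_measurable a by exact: bounded_measurable_row_scaling.
have rowE x : avg P2 (fun y => expR (w (x, y) + a x + b y)) = 1.
  transitivity (avg P2 (fun y => expR (a x) * expR (w (x, y) + b y))).
    by apply: congr1; apply/funext => y; rewrite -expRD; congr expR; ring.
  rewrite avgZ; last by apply: bounded_measurable_expR; exact: bwb.
  by rewrite -(expR_log_avg_exp P2 (bwb x bb)) -expRD /a /row_scaling addNr expR0.
have colE y : avg P1 (fun x => expR (w (x, y) + a x + b y)) = expR (- c).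
  transitivity (avg P1 (fun x => expR (b y) * expR (w (x, y) + a x))).
    by apply: congr1; apply/funext => x; rewrite -expRD; congr expR; ring.
  rewrite avgZ; last by apply: bounded_measurable_expR; exact: bwa.
  rewrite -(expR_log_avg_exp P1 (bwa y ba)) -expRD; congr expR.
  by have := bc y; rewrite -/a /col_scaling; move: (log_avg_exp _ _) => l; lra.
have bE : bounded_measurable (fun z : T1 * T2 => expR (w z + a z.1 + b z.2)).
  apply: bounded_measurable_expR; apply: bounded_measurableD.
    by apply: bounded_measurableD => //; exact: (bounded_measurable_comp ba measurable_fst).
  exact: (bounded_measurable_comp bb measurable_snd).
have mass1 : expR (- c) = 1.
  rewrite -(avg_cst P2 (expR (- c))); transitivity (avg (P1 \x P2)%E
      (fun z : T1 * T2 => expR (w z + a z.1 + b z.2))).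
    by rewrite (avg_prod21 P1 P2 bE); apply: congr1; apply/funext => y; rewrite /= colE.
  rewrite (avg_prod12 P1 P2 bE) -(avg_cst P1 1).
  by apply: congr1; apply/funext => x; rewrite /= rowE.
by exists a, b; split => // y; rewrite colE.
Qed.

End sinkhorn.

Local Transparent avg log_avg_exp.

(** * Uniformly continuous functions on the square and cells *)

(** Retraction of the line onto the unit interval: composing with it replaces a
    function on the square by one on the plane with the same uniform continuity. *)
Definition clamp (R : realType) (x : R) : R := Num.max 0 (Num.min x 1).

Section clamp_theory.
Variable R : realType.
Implicit Types x : R.

Lemma clamp_itv x : 0 <= clamp x <= 1.
Proof. by rewrite /clamp le_max lexx/= ge_max ler01 ge_min lexx orbT. Qed.

Lemma clamp_in x : clamp x \in `[0, 1]. Proof. by rewrite in_itv/= clamp_itv. Qed.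

Lemma clamp_id x : x \in `[0, 1] -> clamp x = x.
Proof.
by rewrite in_itv/= => /andP[x0 x1]; rewrite /clamp min_l// max_r.
Qed.

Lemma measurable_clamp : measurable_fun setT (@clamp R).
Proof.
apply: measurable_maxr; first exact: measurable_cst.
by apply: measurable_minr => //; exact: measurable_cst.
Qed.

End clamp_theory.

(** Uniform continuity on the unit square for functions of the plane that only
    depend on the clamped coordinates; the clamping makes such functions bounded
    and measurable everywhere. *)
Definition clamped_uc (R : realType) (w : R * R -> R) : Prop :=
  forall e : R, 0 < e -> exists2 d : R, 0 < d & forall p q : R * R,
    `|clamp p.1 - clamp q.1| <= d -> `|clamp p.2 - clamp q.2| <= d ->
    `|w p - w q| <= e.

Section clamped_uc_theory.
Variable R : realType.
Implicit Types v w : R * R -> R.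

(** Heine's theorem, extended from the square to the plane by clamping. *)
Lemma within_continuous_clamped_uc (f : R * R -> R) :
  {within unit_square R, continuous f} ->
  clamped_uc (fun z => f (clamp z.1, clamp z.2)).
Proof.
move=> /subspace_continuousP cf e e0.
have csq : compact (unit_square R).
  by apply: compact_setX; exact: segment_compact.
pose P (d : R) (p : R * R) := unit_square R p -> forall q, unit_square R q ->
  `|p.1 - q.1| <= d -> `|p.2 - q.2| <= d -> `|f p - f q| <= e.
have cov : \forall d \near (0 : R)^'+, unit_square R `<=` P d.
  apply: (compact_near_coveringP _).1 => // x sqx.
  have /cvgrPdist_le/(_ _ (divr_gt0 e0 (ltr0n R 2)))/= := cf _ sqx.
  rewrite near_withinE => /nbhs_ballP[r /= r0 hr].
  have r2 : 0 < r / 2 by rewrite divr_gt0.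
  exists (ball x (r / 2), [set d | 0 < d < r / 2]) => /=.
    split; first exact: nbhsx_ballx.
    by near=> d; apply/andP; split => //; near: d; exact: nbhs_right_lt.
  move=> [p d] /= [[xp1 xp2] /andP[d0 dr]] sqp q sqq pq1 pq2.
  have close (s t u : R) : ball s (r / 2) t -> `|t - u| <= d -> ball s r u.
    rewrite -!ball_normE /= => st tu.
    rewrite -(subrKA t) (le_lt_trans (ler_normD _ _))//; lra.
  have rr : r / 2 <= r by lra.
  have fp : `|f x - f p| <= e / 2.
    by apply: hr sqp; split; [exact: le_ball rr _ xp1|exact: le_ball rr _ xp2].
  have fq : `|f x - f q| <= e / 2.
    by apply: hr sqq; split; [exact: close xp1 pq1|exact: close xp2 pq2].
  rewrite -(subrKA (f x)) (le_trans (ler_normD _ _))// distrC; lra.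
have both : \forall d \near (0 : R)^'+, unit_square R `<=` P d /\ 0 < d.
  by apply: filterI cov _; exact: nbhs_right_gt.
have [d [dP d0]] := @filter_ex _ _ (at_right_proper_filter (0 : R)) _ both.
exists d => // p q h1 h2.
have insq (z : R * R) : unit_square R (clamp z.1, clamp z.2).
  by split => /=; exact: clamp_in.
exact: (dP _ (insq p) (insq p) _ (insq q)).
Unshelve. all: by end_near. Qed.

Lemma clamped_ucD v w : clamped_uc v -> clamped_uc w ->
  clamped_uc (fun z => v z + w z).
Proof.
move=> uv uw e e0; have e2 : 0 < e / 2 by rewrite divr_gt0.
have [d d0 hd] := uv _ e2; have [d' d'0 hd'] := uw _ e2.
exists (Num.min d d'); first by rewrite lt_min d0.
move=> p q; rewrite !le_min => /andP[a1 a2] /andP[b1 b2].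
by rewrite opprD addrACA (le_trans (ler_normD _ _))// [leRHS]splitr lerD ?hd ?hd'.
Qed.

Lemma clamped_ucZ (c : R) w : clamped_uc w -> clamped_uc (fun z => c * w z).
Proof.
move=> uw e e0; have c0 : 0 < `|c| + 1 by rewrite ltr_wpDl.
have [d d0 hd] := uw _ (divr_gt0 e0 c0); exists d => // p q h1 h2.
rewrite -mulrBr normrM; apply: (@le_trans _ _ ((`|c| + 1) * (e / (`|c| + 1)))).
  by apply: ler_pM => //; [rewrite lerDl|exact: hd].
by rewrite mulrC divfK// gt_eqF.
Qed.

Lemma clamped_ucN w : clamped_uc w -> clamped_uc (fun z => - w z).
Proof.
move=> uw e e0; have [d d0 hd] := uw _ e0; exists d => // p q h1 h2.
by rewrite -opprD normrN; exact: hd.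
Qed.

Lemma clamped_uc_cst (c : R) : clamped_uc (fun=> c).
Proof. by move=> e e0; exists 1 => // p q _ _; rewrite subrr normr0 ltW. Qed.

End clamped_uc_theory.

Section bounded_measurable_sums.
Context d (T : measurableType d) (R : realType).

Lemma bounded_measurable_sum (I : Type) (s : seq I) (h : I -> T -> R) :
  (forall i, bounded_measurable (h i)) ->
  bounded_measurable (fun x => \sum_(i <- s) h i x).
Proof.
move=> bh; elim: s => [|i s ih].
  by under eq_fun do rewrite big_nil; exact: bounded_measurable_cst.
by under eq_fun do rewrite big_cons; exact: bounded_measurableD.
Qed.

Lemma avg_sum (P : probability T R) (I : Type) (s : seq I) (h : I -> T -> R) :
  (forall i, bounded_measurable (h i)) ->
  avg P (fun x => \sum_(i <- s) h i x) = \sum_(i <- s) avg P (h i).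
Proof.
move=> bh; elim: s => [|i s ih].
  by rewrite big_nil; under eq_fun do rewrite big_nil; exact: avg_cst.
rewrite big_cons -ih -avgD//; last exact: bounded_measurable_sum.
by congr avg; apply/funext => x; rewrite big_cons.
Qed.

End bounded_measurable_sums.

Section cells.
Variable R : realType.
Implicit Types x : R.

(** The [K] cells are consecutive intervals of length [K^-1], the last one closed
    on the right.  They are defined as differences of indicators of half-lines so
    that their sums telescope. *)
Definition grid_tail (K j : nat) x : R :=
  ((j < K)%N && (j%:R / K%:R <= clamp x))%:R.
Definition cell (K a : nat) x : R := grid_tail K a x - grid_tail K a.+1 x.

Lemma measurable_tail (t : R) : measurable [set x : R | t <= clamp x].
Proof.
have -> : [set x : R | t <= clamp x] = (@clamp R) @^-1` `[t, +oo[.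
  by apply/seteqP; split => x /=; rewrite in_itv/= andbT.
rewrite -[_ @^-1` _]setTI; exact: measurable_clamp.
Qed.

Lemma grid_tailE K j : grid_tail K j =
  if (j < K)%N then \1_[set x : R | j%:R / K%:R <= clamp x] else (fun=> 0).
Proof.
apply/funext => x; rewrite /grid_tail; case: ifP => //= _.
by rewrite indicE/= mem_setE.
Qed.

Lemma bounded_measurable_grid_tail K j : bounded_measurable (grid_tail K j).
Proof.
split; last by exists 1 => x; rewrite /grid_tail; case: (_ && _); rewrite ?normr0 ?normr1.
rewrite grid_tailE; case: ifP => _; last exact: measurable_cst.
by apply: measurable_indic; exact: measurable_tail.
Qed.

Lemma bounded_measurable_cell K a : bounded_measurable (cell K a).
Proof. by apply: bounded_measurableB; exact: bounded_measurable_grid_tail. Qed.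

Lemma cell_ge0 K a x : 0 <= cell K a x.
Proof.
rewrite /cell /grid_tail subr_ge0 ler_nat.
have [/andP[h1 h2]|//] := boolP ((a.+1 < K)%N && _).
rewrite (ltn_trans _ h1)//= (le_trans _ h2)// ler_wpM2r ?invr_ge0//.
by rewrite ler_nat.
Qed.

Lemma cell_close K a x : (a < K)%N -> cell K a x != 0 ->
  `|clamp x - a%:R / K%:R| <= K%:R^-1.
Proof.
move=> aK; have K0 : 0 < K%:R :> R by rewrite ltr0n (leq_trans _ aK).
rewrite /cell /grid_tail aK /=.
have [h1|h1] := leP (a%:R / K%:R) (clamp x); last first.
  suff -> : a.+1%:R / K%:R <= clamp x = false by rewrite andbF subrr eqxx.
  by apply/negbTE; rewrite -ltNge (lt_trans h1)// ltr_pM2r ?invr_gt0// ltr_nat.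
have [a1K|Ka] := ltnP a.+1 K.
  have [h2|h2 _] := leP (a.+1%:R / K%:R) (clamp x); first by rewrite subrr eqxx.
  rewrite ger0_norm ?subr_ge0// lerBlDr; apply: (le_trans (ltW h2)).
  by rewrite -natr1 mulrDl mul1r addrC.
move=> _; rewrite ger0_norm ?subr_ge0// lerBlDr.
have /andP[_ c1] := clamp_itv x; apply: (le_trans c1).
by rewrite -[X in X + _]mul1r -mulrDl ler_pdivlMr// mul1r nat1r ler_nat.
Qed.

Lemma sum_cell K x : (0 < K)%N -> \sum_(a < K) cell K a x = 1.
Proof.
move=> K0; rewrite -(big_mkord xpredT (fun a => cell K a x)).
under eq_bigr do rewrite /cell -opprB.
rewrite sumrN telescope_sumr// opprB /grid_tail ltnn/= subr0 K0 mul0r.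
by case/andP: (clamp_itv x) => ->.
Qed.

Lemma avg_tail (t : R) : 0 <= t <= 1 ->
  fine (uniform01 R [set x | t <= clamp x]) = 1 - t.
Proof.
move=> /andP[t0 t1]; rewrite /uniform01/= /uniform_prob integral_uniform_pdf.
have -> : [set x : R | t <= clamp x] `&` `[0, 1]%classic = `[t, 1]%classic.
  apply/seteqP; split => x /=; rewrite !in_itv/=.
    by move=> [tx x01]; rewrite clamp_id ?in_itv// in tx; rewrite tx; case/andP: x01.
  move=> /andP[tx x1]; have x01 : 0 <= x <= 1 by rewrite x1 (le_trans t0).
  by split => //; rewrite clamp_id// in_itv.
rewrite (eq_integral (fun=> 1%E)); last first.
  move=> x; rewrite inE/= in_itv/= => /andP[tx x1].
  by rewrite /uniform_pdf x1 (le_trans t0 tx)/= subr0 invr1.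
rewrite integral_cst//= mul1e.
rewrite lebesgue_measure_itv/= lte_fin.
by case: ltP => //= h; apply/esym/eqP; rewrite subr_eq0 eq_le t1 h.
Qed.

Lemma avg_grid_tail K j : (0 < K)%N -> (j <= K)%N ->
  avg (uniform01 R) (grid_tail K j) = 1 - j%:R / K%:R.
Proof.
move=> K0 jK; have KR : 0 < K%:R :> R by rewrite ltr0n.
rewrite grid_tailE; case: ltnP => [jK'|Kj].
  rewrite -avg_tail; last by rewrite divr_ge0//= ler_pdivrMr// mul1r ler_nat.
  by rewrite /avg /Rintegral integral_indic ?setIT//; exact: measurable_tail.
have -> : j = K by apply/eqP; rewrite eqn_leq jK Kj.
by rewrite avg_cst divff ?subrr// gt_eqF.
Qed.

Lemma avg_cell K a : (a < K)%N -> avg (uniform01 R) (cell K a) = K%:R^-1.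
Proof.
move=> aK; have K0 : (0 < K)%N by exact: leq_trans aK.
rewrite avgB; try exact: bounded_measurable_grid_tail.
rewrite !avg_grid_tail// ?(ltnW aK)// -(natr1 a); lra.
Qed.

End cells.

Section clamped_uc_measurable.
Variable R : realType.
Implicit Types w : R * R -> R.

(** The constant 3 leaves room for a sample point at distance [2 / K] from a
    block corner and a point of the block at distance [1 / K] from it. *)
Lemma clamped_uc_mesh w (e : R) : clamped_uc w -> 0 < e ->
  exists2 K : nat, (0 < K)%N & forall p q : R * R,
    `|clamp p.1 - clamp q.1| <= 3 / K%:R -> `|clamp p.2 - clamp q.2| <= 3 / K%:R ->
    `|w p - w q| <= e.
Proof.
move=> uw e0; have [d d0 hd] := uw _ e0.
have d3 : 0 <= 3 / d by rewrite divr_ge0// ltW.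
exists (Num.Def.archi_bound (3 / d)).+1 => // p q h1 h2.
have Kd : 3 / (Num.Def.archi_bound (3 / d)).+1%:R <= d.
  rewrite ler_pdivrMr// mulrC -ler_pdivrMr//.
  by apply: (le_trans (ltW (archi_boundP d3))); rewrite ler_nat.
by apply: hd; apply: le_trans Kd.
Qed.

Definition step_function (K : nat) w (z : R * R) : R :=
  \sum_(a < K) \sum_(b < K)
    w (a%:R / K%:R, b%:R / K%:R) * (cell K a z.1 * cell K b z.2).

Lemma bounded_measurable_cell2 K a b :
  bounded_measurable (fun z : plane R => cell K a z.1 * cell K b z.2).
Proof.
apply: bounded_measurableM.
  exact: (bounded_measurable_comp (@bounded_measurable_cell R K a) measurable_fst).
exact: (bounded_measurable_comp (@bounded_measurable_cell R K b) measurable_snd).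
Qed.

Lemma bounded_measurable_step_function K w :
  bounded_measurable (step_function K w : plane R -> R).
Proof.
apply: bounded_measurable_sum => a; apply: bounded_measurable_sum => b.
by apply: bounded_measurableZ; exact: bounded_measurable_cell2.
Qed.

Lemma grid_point_itv (K a : nat) : (a < K)%N -> a%:R / K%:R \in `[(0 : R), 1].
Proof.
move=> aK; rewrite in_itv/= divr_ge0//= ler_pdivrMr ?mul1r ?ler_nat ?(ltnW aK)//.
by rewrite ltr0n (leq_trans _ aK).
Qed.

Lemma sum_cell2 K (x y : R) : (0 < K)%N ->
  \sum_(a < K) \sum_(b < K) cell K a x * cell K b y = 1.
Proof.
move=> K0; under eq_bigr do rewrite -mulr_sumr sum_cell// mulr1.
exact: sum_cell.
Qed.

Lemma step_function_approx K w (e : R) (z : R * R) : (0 < K)%N ->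
  (forall p q : R * R,
    `|clamp p.1 - clamp q.1| <= 3 / K%:R -> `|clamp p.2 - clamp q.2| <= 3 / K%:R ->
    `|w p - w q| <= e) ->
  `|w z - step_function K w z| <= e.
Proof.
move=> K0 hw; have KR : 0 < K%:R^-1 :> R by rewrite invr_gt0 ltr0n.
have split_unit (c : R) : c = \sum_(a < K) \sum_(b < K) c * (cell K a z.1 * cell K b z.2).
  by rewrite -[LHS]mulr1 -[X in c * X](sum_cell2 z.1 z.2 K0) mulr_sumr;
    apply: eq_bigr => a _; rewrite mulr_sumr.
rewrite [X in `|X - _|]split_unit -sumrB [leRHS]split_unit.
apply: (le_trans (ler_norm_sum _ _ _)); apply: ler_sum => a _.
rewrite -sumrB; apply: (le_trans (ler_norm_sum _ _ _)).
apply: ler_sum => b _; rewrite -mulrBl normrM.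
have c0 : 0 <= cell K a z.1 * cell K b z.2 by rewrite mulr_ge0 ?cell_ge0.
rewrite (ger0_norm c0).
have [->|na] := eqVneq (cell K a z.1) 0; first by rewrite !(mul0r, mulr0).
have [->|nb] := eqVneq (cell K b z.2) 0; first by rewrite !(mul0r, mulr0).
have := cell_close (ltn_ord a) na; have := cell_close (ltn_ord b) nb => hb ha.
rewrite ler_wpM2r//; apply: hw => /=.
  by rewrite (clamp_id (grid_point_itv (ltn_ord a))) (le_trans ha)//; lra.
by rewrite (clamp_id (grid_point_itv (ltn_ord b))) (le_trans hb)//; lra.
Qed.

(** Uniform limits of step functions on product cells are measurable for the
    product sigma-algebra. *)
Lemma clamped_uc_bounded_measurable w : clamped_uc w ->
  bounded_measurable (w : plane R -> R).
Proof.
move=> uw.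
have /choice[K hK] : forall n, exists K, forall z, `|w z - step_function K w z| <= n.+1%:R^-1.
  move=> n; have n0 : 0 < n.+1%:R^-1 :> R by rewrite invr_gt0.
  have [K K0 hK] := clamped_uc_mesh uw n0.
  by exists K => z; exact: step_function_approx.
split; last first.
  have [M M0 hM] := bounded_measurable_bound (bounded_measurable_step_function (K 0%N) w).
  exists (1 + M) => z; rewrite -(subrK (step_function (K 0%N) w z) (w z)).
  rewrite (le_trans (ler_normD _ _))// lerD//.
  by rewrite (le_trans (hK 0%N z))// invr1.
apply: (@measurable_fun_cvg _ _ _ _ (fun n => step_function (K n) w)) => [n|z _].
  by case: (bounded_measurable_step_function (K n) w).
apply/cvgrPdist_le => e e0; near=> n.
apply: (le_trans (hK n z)); apply: ltW; near: n; exact: (near_infty_natSinv_lt (PosNum e0)).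
Unshelve. all: by end_near. Qed.

End clamped_uc_measurable.

(** * Permanents of continuous weights *)

(** The permanent of the matrix [expR (v (i / n, j / n))]. *)
Definition gibbs_sum (R : realType) (n : nat) (v : R * R -> R) : R :=
  \sum_(s : 'S_n) expR (perm_stat v s).

Section gibbs_sum_bounds.
Variable R : realType.
Implicit Types v : R * R -> R.
Local Notation U := (uniform01 R).

Lemma perm_point_clamp n (s : 'S_n) i :
  clamp (perm_point R s i).1 = (perm_point R s i).1 /\
  clamp (perm_point R s i).2 = (perm_point R s i).2.
Proof.
suff h (j : 'I_n) : clamp (j.+1%:R / n%:R : R) = j.+1%:R / n%:R by split; exact: h.
have n0 : 0 < n%:R :> R by rewrite ltr0n (leq_trans _ (ltn_ord j)).
by apply: clamp_id; rewrite in_itv/= divr_ge0//= ler_pdivrMr ?mul1r ?ler_nat.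
Qed.

Definition block_mass (K : nat) v (a b : nat) : R :=
  avg (uniform_square R) (fun z => expR (v z) * (cell K a z.1 * cell K b z.2)).

Let bexp v : clamped_uc v -> bounded_measurable (fun z : plane R => expR (v z)).
Proof.
by move=> uv; apply: bounded_measurable_expR; exact: clamped_uc_bounded_measurable.
Qed.

Let bterm v K a b : clamped_uc v ->
  bounded_measurable (fun z : plane R => expR (v z) * (cell K a z.1 * cell K b z.2)).
Proof.
by move=> uv; apply: bounded_measurableM; [exact: bexp|exact: bounded_measurable_cell2].
Qed.

Lemma block_mass_ge0 K v a b : 0 <= block_mass K v a b.
Proof. by apply: avg_ge0 => z; rewrite !mulr_ge0 ?expR_ge0 ?cell_ge0. Qed.

Lemma avg_cell2 (K a b : nat) : (a < K)%N -> (b < K)%N ->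
  avg (uniform_square R) (fun z => cell K a z.1 * cell K b z.2) = K%:R ^- 2.
Proof.
move=> aK bK; rewrite (avg_prod12 U U (bounded_measurable_cell2 R K a b)) /=.
transitivity (avg U (fun x => K%:R^-1 * cell K a x)).
  congr avg; apply/funext => x.
  by rewrite avgZ ?avg_cell// 1?mulrC//; exact: bounded_measurable_cell.
rewrite avgZ ?avg_cell//; last exact: bounded_measurable_cell.
by rewrite -invfM expr2.
Qed.

Lemma sum_block_mass K v : clamped_uc v -> (0 < K)%N ->
  \sum_(a < K) \sum_(b < K) block_mass K v a b =
  avg (uniform_square R) (fun z => expR (v z)).
Proof.
move=> uv K0; rewrite /block_mass.
under eq_bigr => a _ do rewrite -(avg_sum _ _ (fun b : 'I_K => bterm K a b uv)).
rewrite -avg_sum; last by move=> a; apply: bounded_measurable_sum => b; exact: bterm.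
congr avg; apply/funext => z.
under eq_bigr do rewrite -mulr_sumr.
by rewrite -mulr_sumr sum_cell2// mulr1.
Qed.

Lemma block_mass_row K v (a : 'I_K) : clamped_uc v ->
  (forall x, avg U (fun y => expR (v (x, y))) = 1) ->
  \sum_(b < K) block_mass K v a b = K%:R^-1.
Proof.
move=> uv row; have K0 : (0 < K)%N by exact: leq_trans (ltn_ord a).
rewrite -(avg_sum _ _ (fun b : 'I_K => bterm K a b uv)).
rewrite -(avg_cell R (ltn_ord a)); set F := (X in avg _ X = _).
have FE : F = (fun z => expR (v z) * cell K a z.1).
  apply/funext => z; rewrite /F -mulr_sumr -mulr_sumr sum_cell//.
  by rewrite mulr1.
have bF : bounded_measurable (F : plane R -> R).
  by apply: bounded_measurable_sum => b; exact: bterm.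
rewrite (avg_prod12 U U bF) FE /=; congr avg; apply/funext => x.
rewrite -[RHS]mulr1 -(row x) -avgZ; last by exact: bounded_measurable_pair1 (bexp uv) x.
by congr avg; apply/funext => y; rewrite mulrC.
Qed.

Lemma block_mass_col K v (b : 'I_K) : clamped_uc v ->
  (forall y, avg U (fun x => expR (v (x, y))) = 1) ->
  \sum_(a < K) block_mass K v a b = K%:R^-1.
Proof.
move=> uv col; have K0 : (0 < K)%N by exact: leq_trans (ltn_ord b).
rewrite -(avg_sum _ _ (fun a : 'I_K => bterm K a b uv)).
rewrite -(avg_cell R (ltn_ord b)); set F := (X in avg _ X = _).
have FE : F = (fun z => expR (v z) * cell K b z.2).
  apply/funext => z; rewrite /F -mulr_sumr -mulr_suml sum_cell//.
  by rewrite mul1r.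
have bF : bounded_measurable (F : plane R -> R).
  by apply: bounded_measurable_sum => a; exact: bterm.
rewrite (avg_prod21 U U bF) FE /=; congr avg; apply/funext => y.
rewrite -[RHS]mulr1 -(col y) -avgZ; last by exact: bounded_measurable_pair2 (bexp uv) y.
by congr avg; apply/funext => x; rewrite mulrC.
Qed.

Let grid_value n v (i j : 'I_n) : R := expR (v (i.+1%:R / n%:R, j.+1%:R / n%:R)).

Let gibbs_sumE n v : gibbs_sum n v = \sum_(s : 'S_n) \prod_i grid_value v i (s i).
Proof. by apply: eq_bigr => s _; rewrite /perm_stat expR_sum. Qed.

(** On a block that an aligned letter points to, [expR v] stays within a factor
    [expR e] of its value at the sample point, and so does its block average. *)
Lemma block_mass_near n K v (e : R) (a b : 'I_K) (i j : 'I_n) :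
  clamped_uc v -> 
  (forall p q : R * R,
    `|clamp p.1 - clamp q.1| <= 3 / K%:R -> `|clamp p.2 - clamp q.2| <= 3 / K%:R ->
    `|v p - v q| <= e) ->
  `|i.+1%:R / n%:R - a%:R / K%:R| <= 2 / K%:R :> R ->
  `|j.+1%:R / n%:R - b%:R / K%:R| <= 2 / K%:R :> R ->
  expR (- e) * grid_value v i j <= K%:R ^+ 2 * block_mass K v a b
    <= expR e * grid_value v i j.
Proof.
move=> uv mesh ia jb; have K0 : (0 < K)%N by exact: leq_trans (ltn_ord a).
have K2 : 0 < K%:R ^+ 2 :> R by rewrite exprn_gt0// ltr0n.
set g := grid_value v i j.
pose c (z : R * R) := cell K a z.1 * cell K b z.2.
have c0 z : 0 <= c z by rewrite mulr_ge0 ?cell_ge0.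
have bc : bounded_measurable (c : plane R -> R) by exact: bounded_measurable_cell2.
have shift (t x : R) (m : nat) : `|t - m%:R / K%:R| <= 2 / K%:R ->
    `|x - m%:R / K%:R| <= K%:R^-1 -> `|x - t| <= 3 / K%:R.
  move=> /ler_normlP[h1 h2] /ler_normlP[h3 h4].
  by apply/ler_normlP; split; lra.
have ci (l : 'I_n) : clamp (l.+1%:R / n%:R : R) = l.+1%:R / n%:R.
  by have [] := perm_point_clamp (1%g : 'S_n) l.
have pt z : c z != 0 -> `|v z - v (i.+1%:R / n%:R, j.+1%:R / n%:R)| <= e.
  rewrite mulf_eq0 negb_or => /andP[ca cb].
  apply: mesh; rewrite /= ci.
    exact: shift ia (cell_close (ltn_ord a) ca).
  exact: shift jb (cell_close (ltn_ord b) cb).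
have lo z : expR (- e) * g * c z <= expR (v z) * c z.
  have [->|nc] := eqVneq (c z) 0; first by rewrite !mulr0.
  rewrite ler_wpM2r// -expRD ler_expR; have /ler_normlP[] := pt z nc; lra.
have hi z : expR (v z) * c z <= expR e * g * c z.
  have [->|nc] := eqVneq (c z) 0; first by rewrite !mulr0.
  rewrite ler_wpM2r// -expRD ler_expR; have /ler_normlP[] := pt z nc; lra.
have bv : bounded_measurable (fun z : plane R => expR (v z) * c z) by exact: bterm.
have avgc : avg (uniform_square R) c = K%:R ^- 2 by rewrite avg_cell2.
have := avg_le (uniform_square R) (bounded_measurableZ _ bc) bv lo.
have := avg_le (uniform_square R) bv (bounded_measurableZ _ bc) hi.
rewrite !avgZ// avgc -/(block_mass K v a b) !ler_pdivrMr// !ler_pdivlMr//.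
by rewrite [K%:R ^+ 2 * _]mulrC => -> ->.
Qed.

Lemma eventually_large (c e : R) : 0 < e -> exists N, forall n, (N <= n)%N -> c <= expR (n%:R * e).
Proof.
move=> e0; exists (Num.Def.archi_bound (`|c| / e)) => n Nn.
have h : `|c| / e <= n%:R.
  apply: (le_trans (ltW (archi_boundP _))); first by rewrite divr_ge0// ltW.
  by rewrite ler_nat.
rewrite ler_pdivrMr// in h; apply: (le_trans (ler_norm c)); apply: (le_trans h).
by apply: le_trans (expR_ge1Dx _); rewrite lerDr.
Qed.

(** A permanent is at most the sum over all pairs of words drawn from the block
    masses, up to a subexponential factor. *)
Lemma gibbs_sum_upper v (e : R) : clamped_uc v -> 0 < e ->
  exists N, forall n, (N <= n)%N ->
  gibbs_sum n v <= n`!%:R * expR (n%:R * e)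
                   * (avg (uniform_square R) (fun z => expR (v z))) ^+ n.
Proof.
move=> uv e0; have e2 : 0 < e / 2 by rewrite divr_gt0.
have [K K0 mesh] := clamped_uc_mesh uv e2.
have [N1 hN1] := most_words_aligned R K0.
have [N2 hN2] := eventually_large 2 e2.
exists (maxn N1 N2) => n; rewrite geq_max => /andP[n1 n2].
have m0 : 0 <= avg (uniform_square R) (fun z => expR (v z)).
  by apply: avg_ge0 => z; exact: expR_ge0.
have := @perm_sum_upper R n K (fun a b => block_mass K v a b) (grid_value v) (e / 2) K0
  (fun a b => block_mass_ge0 K v a b) (fun i j => expR_ge0 _)
  (fun a b i j => block_mass_near uv mesh) (hN1 n n1).
rewrite -gibbs_sumE sum_block_mass// => /le_trans; apply.
rewrite ler_wpM2r ?exprn_ge0//.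
have -> : expR (n%:R * e) = expR (n%:R * (e / 2)) * expR (n%:R * (e / 2)).
  by rewrite -expRD -mulrDr -splitr.
have := hN2 n n2; set E := expR _ => hE.
rewrite -mulrA mulrCA ler_wpM2l// ler_wpM2r//; exact: expR_ge0.
Qed.

(** For a density with uniform marginals the words are typically aligned under
    the density too, so that almost nothing is lost in the upper bound. *)
Lemma gibbs_sum_lower v (e : R) : clamped_uc v -> 0 < e ->
  (forall x, avg U (fun y => expR (v (x, y))) = 1) ->
  (forall y, avg U (fun x => expR (v (x, y))) = 1) ->
  exists N, forall n, (N <= n)%N -> n`!%:R <= expR (n%:R * e) * gibbs_sum n v.
Proof.
move=> uv e0 row col; have e2 : 0 < e / 2 by rewrite divr_gt0.
have [K K0 mesh] := clamped_uc_mesh uv e2.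
have [N1 hN1] := most_words_aligned R K0.
have [N2 hN2] := eventually_large 2 e2.
exists (maxn N1 N2) => n; rewrite geq_max => /andP[n1 n2].
have := @perm_sum_lower R n K (fun a b => block_mass K v a b) (grid_value v) (e / 2) K0
  (fun a b => block_mass_ge0 K v a b) (fun i j => expR_ge0 _)
  (fun a b i j => block_mass_near uv mesh) (hN1 n n1)
  (fun a => block_mass_row a uv row) (fun b => block_mass_col b uv col).
rewrite -gibbs_sumE => /le_trans; apply.
rewrite ler_wpM2r//; first by apply: sumr_ge0 => s _; exact: expR_ge0.
have -> : expR (n%:R * e) = expR (n%:R * (e / 2)) * expR (n%:R * (e / 2)).
  by rewrite -expRD -mulrDr -splitr.
by rewrite ler_wpM2r ?expR_ge0// hN2.
Qed.

End gibbs_sum_bounds.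

(** * Concentration of continuous statistics *)

Definition gibbs_prob (R : realType) (v : R * R -> R) (n : nat) (s : 'S_n) : R :=
  expR (perm_stat v s) / gibbs_sum n v.

Section perm_stat_theory.
Variable R : realType.
Implicit Types v h : R * R -> R.

Lemma perm_statD n v h (s : 'S_n) :
  perm_stat (fun z => v z + h z) s = perm_stat v s + perm_stat h s.
Proof. by rewrite /perm_stat big_split. Qed.

Lemma perm_statZ n (c : R) h (s : 'S_n) :
  perm_stat (fun z => c * h z) s = c * perm_stat h s.
Proof. by rewrite /perm_stat mulr_sumr. Qed.

Lemma perm_statN n h (s : 'S_n) : perm_stat (fun z => - h z) s = - perm_stat h s.
Proof. by rewrite /perm_stat sumrN. Qed.

Lemma perm_stat_norm n h (H : R) (s : 'S_n) : (forall z, `|h z| <= H) ->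
  `|perm_stat h s| <= n%:R * H.
Proof.
move=> hH; apply: (le_trans (ler_norm_sum _ _ _)).
apply: (@le_trans _ _ (\sum_(i < n) H)); first by apply: ler_sum.
by rewrite sumr_const card_ord mulr_natl.
Qed.

Lemma gibbs_sum_gt0 n v : 0 < gibbs_sum n v.
Proof.
apply: (@lt_le_trans _ _ (expR (perm_stat v (1%g : 'S_n)))); first exact: expR_gt0.
rewrite /gibbs_sum (bigD1 (1%g : 'S_n))//= lerDl.
by apply: sumr_ge0 => s _; exact: expR_ge0.
Qed.

Lemma gibbs_prob_ge0 n v (s : 'S_n) : 0 <= gibbs_prob v s.
Proof. by rewrite divr_ge0 ?expR_ge0// ltW ?gibbs_sum_gt0. Qed.

Lemma sum_gibbs_prob n v : \sum_(s : 'S_n) gibbs_prob v s = 1.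
Proof. by rewrite -mulr_suml divff// gt_eqF// gibbs_sum_gt0. Qed.

End perm_stat_theory.

Section concentration.
Variables (R : realType) (v : R * R -> R).
Local Notation U := (uniform01 R).
Hypothesis uv : clamped_uc v.
Hypothesis row : forall x, avg U (fun y => expR (v (x, y))) = 1.
Hypothesis col : forall y, avg U (fun x => expR (v (x, y))) = 1.

Let bv : bounded_measurable (fun z : plane R => expR (v z)).
Proof. exact/bounded_measurable_expR/clamped_uc_bounded_measurable. Qed.

Lemma avg_density1 : avg (uniform_square R) (fun z => expR (v z)) = 1.
Proof.
rewrite (avg_prod12 U U bv) -[RHS](avg_cst U); congr avg.
by apply/funext => x; rewrite row.
Qed.

(** Second order expansion of the moment generating function of [h] under the
    density [expR v]. *)
Lemma avg_tilt_le (h : R * R -> R) (H t : R) :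
  bounded_measurable (h : plane R -> R) -> (forall z, `|h z| <= H) ->
  `|t| * H <= 2^-1 ->
  avg (uniform_square R) (fun z => expR (v z + t * h z)) <=
  1 + t * avg (uniform_square R) (fun z => expR (v z) * h z) + 2 * (t * H) ^+ 2.
Proof.
move=> bh hH tH; set c := 2 * (t * H) ^+ 2.
have bvh : bounded_measurable (fun z : plane R => expR (v z) * h z).
  exact: bounded_measurableM.
apply: (@le_trans _ _ (avg (uniform_square R)
    (fun z => (1 + c) * expR (v z) + t * (expR (v z) * h z)))); last first.
  rewrite avgD ?avgZ ?avg_density1//; try exact: bounded_measurableZ.
  by rewrite mulr1 addrAC.
apply: avg_le => [||z].
- have -> : (fun z => expR (v z + t * h z)) = (fun z => expR (v z) * expR (t * h z)).
    by apply/funext => z; rewrite expRD.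
  by apply: bounded_measurableM => //; exact/bounded_measurable_expR/bounded_measurableZ.
- by apply: bounded_measurableD; exact: bounded_measurableZ.
have th : `|t * h z| <= `|t| * H by rewrite normrM ler_wpM2l.
have th2 : (t * h z) ^+ 2 <= (t * H) ^+ 2.
  rewrite -[leLHS]real_normK ?num_real// [leRHS]exprMn -[t ^+ 2]real_normK ?num_real//.
  by rewrite -exprMn lerXn2r ?nnegrE// (le_trans _ th).
have q := expR_le_quadratic (le_trans (ler_norm _) (le_trans th tH)).
rewrite expRD; apply: (le_trans (ler_wpM2l (expR_ge0 _) q)).
have := ler_wpM2l (expR_ge0 (v z)) th2; rewrite /c.
by move: (expR (v z)) ((t * h z) ^+ 2) ((t * H) ^+ 2) => A B C; nra.
Qed.

(** Chernoff's bound: the exponential moment of the statistic is a ratio of two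
    permanents, bounded above for the tilted weight [v + t * h] and below for [v];
    the slack in both bounds is chosen after [t]. *)
Lemma upper_deviation (h : R * R -> R) (e : R) :
  clamped_uc h -> 0 < e ->
  exists2 c : R, 0 < c & exists N, forall n, (N <= n)%N ->
  \sum_(s : 'S_n | n%:R * (avg (uniform_square R) (fun z => expR (v z) * h z) + e)
                   <= perm_stat h s) expR (perm_stat v s)
  <= expR (- (n%:R * c)) * gibbs_sum n v.
Proof.
move=> uh e0; set m := avg _ _.
have bh := clamped_uc_bounded_measurable uh.
have [H H0 hH] := bounded_measurable_bound bh.
(* Small enough for the quadratic bound and for the second order term to cost
   at most a quarter of the gain [t * e]. *)
pose t := Num.min (2 * H)^-1 (e / (8 * H ^+ 2)).
have t0 : 0 < t.
  by rewrite lt_min invr_gt0 mulr_gt0//= divr_gt0// mulr_gt0// exprn_gt0.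
have tH : `|t| * H <= 2^-1.
  rewrite gtr0_norm// -ler_pdivlMr// -invfM; by rewrite ge_min lexx.
have tH2 : 2 * (t * H) ^+ 2 <= t * (e / 4).
  have h1 : t * (8 * H ^+ 2) <= e.
    by rewrite -ler_pdivlMr ?mulr_gt0 ?exprn_gt0//; by rewrite ge_min lexx orbT.
  have := ler_wpM2l (ltW t0) h1; nra.
have e'0 : 0 < t * (e / 8) by rewrite mulr_gt0// divr_gt0.
have [N1 up] := gibbs_sum_upper (clamped_ucD uv (clamped_ucZ t uh)) e'0.
have [N2 lo] := gibbs_sum_lower uv e'0 row col.
exists (t * (e / 2)); first by rewrite mulr_gt0// divr_gt0.
exists (maxn N1 N2) => n; rewrite geq_max => /andP[n1 n2].
have markov : \sum_(s : 'S_n | n%:R * (m + e) <= perm_stat h s) expR (perm_stat v s)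
    <= expR (- (t * (n%:R * (m + e)))) * gibbs_sum n (fun z => v z + t * h z).
  rewrite /gibbs_sum mulr_sumr [leLHS]big_mkcond/=; apply: ler_sum => s _.
  case: ifP => hs; last by rewrite mulr_ge0 ?expR_ge0.
  rewrite -expRD ler_expR perm_statD perm_statZ.
  have := ler_wpM2l (ltW t0) hs; lra.
apply: (le_trans markov).
have mass : avg (uniform_square R) (fun z => expR (v z + t * h z)) <=
    expR (t * m + t * (e / 4)).
  apply: (le_trans (avg_tilt_le bh hH tH)).
  apply: le_trans (expR_ge1Dx _); rewrite -/m; lra.
have mass0 : 0 <= avg (uniform_square R) (fun z => expR (v z + t * h z)).
  by apply: avg_ge0 => z; exact: expR_ge0.
have massn : avg (uniform_square R) (fun z => expR (v z + t * h z)) ^+ n <=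
    expR (n%:R * (t * m + t * (e / 4))).
  by rewrite expRM_natl lerXn2r// nnegrE expR_ge0.
apply: (le_trans (ler_wpM2l (expR_ge0 _) (up n n1))).
apply: (@le_trans _ _ (expR (- (t * (n%:R * (m + e)))) *
   (expR (n%:R * (t * (e / 8))) * gibbs_sum n v * expR (n%:R * (t * (e / 8))) *
     expR (n%:R * (t * m + t * (e / 4)))))).
  rewrite ler_wpM2l ?expR_ge0// ler_pM// ?mulr_ge0 ?expR_ge0 ?exprn_ge0//.
  by rewrite ler_wpM2r ?expR_ge0// lo.
rewrite le_eqVlt; apply/orP; left; apply/eqP.
have -> : expR (- (n%:R * (t * (e / 2)))) = expR (- (t * (n%:R * (m + e)))) *
   expR (n%:R * (t * (e / 8))) * expR (n%:R * (t * (e / 8))) *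
     expR (n%:R * (t * m + t * (e / 4))).
  by rewrite -!expRD; congr expR; field.
by ring.
Qed.

(** The lower tail of [h] is the upper tail of [- h]. *)
Lemma gibbs_concentration (h : R * R -> R) (e : R) : clamped_uc h -> 0 < e ->
  (\sum_(s : 'S_n | e <= `|perm_stat h s / n%:R
       - avg (uniform_square R) (fun z => (expR (v z) * h z)%R)|) gibbs_prob v s)
    @[n --> \oo] --> (0 : R).
Proof.
move=> uh e0; set m := avg _ _.
have bh := clamped_uc_bounded_measurable uh.
have [c c0 [N hN]] := upper_deviation uh e0.
have [c' c'0 [N' hN']] := upper_deviation (clamped_ucN uh) e0.
have mN : avg (uniform_square R) (fun z => expR (v z) * - h z) = - m.
  rewrite -avgN; last exact: bounded_measurableM.
  by congr avg; apply/funext => z; rewrite mulrN.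
apply/cvgrPdist_le => d d0.
have [N1 hN1] := eventually_large (2 / d) c0.
have [N2 hN2] := eventually_large (2 / d) c'0.
exists (maxn 1 (maxn (maxn N N') (maxn N1 N2))) => // n /=.
rewrite !geq_max => /andP[n0 /andP[/andP[nN nN'] /andP[nN1 nN2]]].
have nR : 0 < n%:R :> R by rewrite ltr0n.
rewrite sub0r normrN ger0_norm; last by apply: sumr_ge0 => s _; exact: gibbs_prob_ge0.
rewrite -mulr_suml ler_pdivrMr ?gibbs_sum_gt0//.
apply: (@le_trans _ _ (\sum_(s : 'S_n | n%:R * (m + e) <= perm_stat h s) expR (perm_stat v s)
   + \sum_(s : 'S_n | n%:R * (- m + e) <= perm_stat (fun z => - h z) s) expR (perm_stat v s))).
  rewrite [X in _ <= X + _]big_mkcond [X in _ <= _ + X]big_mkcond [leLHS]big_mkcond -big_split/=.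
  apply: ler_sum => s _; have E0 := expR_ge0 (perm_stat v s).
  case: ifP => [dev|_]; last by rewrite addr_ge0//; case: ifP.
  have [u1|l1] : (n%:R * (m + e) <= perm_stat h s) \/
      (n%:R * (- m + e) <= perm_stat (fun z => - h z) s).
    move: dev; rewrite ler_normr => /orP[dev|dev]; [left|right].
      by rewrite mulrC -ler_pdivlMr//; lra.
    rewrite perm_statN mulrC -ler_pdivlMr// mulNr.
    lra.
  + by rewrite u1 lerDl; case: ifP.
  + by rewrite l1 lerDr; case: ifP.
have small (b : R) : 2 / d <= expR (n%:R * b) -> expR (- (n%:R * b)) <= d / 2.
  by move=> hb; rewrite expRN -[leRHS]invrK lef_pV2 ?posrE ?expR_gt0 ?invr_gt0 ?divr_gt0// invf_div.
have h2 := hN' n nN'; rewrite mN in h2.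
apply: (le_trans (lerD (hN n nN) h2)); rewrite -mulrDl ler_wpM2r ?(ltW (gibbs_sum_gt0 _ _))//.
have := small _ (hN1 n nN1); have := small _ (hN2 n nN2).
lra.
Qed.

End concentration.

(** * Potentials and the log partition function *)

Definition tilted (R : realType) (w : R * R -> R) (a b : R -> R) (z : R * R) : R :=
  w z + a z.1 + b z.2.

(** Continuous solutions of the Schroedinger system for the kernel [expR w]: the
    scaled kernel [expR (tilted w a b)] is a density with uniform marginals. *)
Record potentials (R : realType) (w : R * R -> R) (a b : R -> R) : Prop := {
  potentials_kernel : clamped_uc w;
  potentials_row_uc : clamped_uc (fun z => a z.1);
  potentials_col_uc : clamped_uc (fun z => b z.2);
  potentials_row : forall x, avg (uniform01 R) (fun y => expR (tilted w a b (x, y))) = 1;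
  potentials_col : forall y, avg (uniform01 R) (fun x => expR (tilted w a b (x, y))) = 1 }.

Section potentials_theory.
Variable R : realType.
Implicit Types w h : R * R -> R.
Implicit Types a b : R -> R.
Local Notation U := (uniform01 R).

(** The potentials inherit the modulus of continuity of the kernel, because a
    change of [x] can move the normalization of a row by no more than it moves
    the kernel. *)
Lemma potentials_exist w : clamped_uc w -> exists a b, potentials w a b.
Proof.
move=> uw; have bw := clamped_uc_bounded_measurable uw.
have [a [b [ba bb row col]]] := sinkhorn_scaling U U bw (0 : R).
have modulus (g g' c : R -> R) (s s' e : R) : bounded_measurable g -> bounded_measurable g' ->
    bounded_measurable c -> (forall y, `|g y - g' y| <= e) ->
    avg U (fun y => expR (g y + s + c y)) = 1 -> avg U (fun y => expR (g' y + s' + c y)) = 1 ->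
    s' - s <= e.
  move=> bg bg' bc gg g1 g'1.
  have : 1 <= expR (e + s - s').
    rewrite -[leLHS]g1 -[leRHS]mulr1 -[X in _ * X]g'1 -avgZ; last first.
      apply: bounded_measurable_expR; apply: bounded_measurableD => //.
      by apply: bounded_measurableD => //; exact: bounded_measurable_cst.
    apply: avg_le => [||y].
    - apply: bounded_measurable_expR; apply: bounded_measurableD => //.
      by apply: bounded_measurableD => //; exact: bounded_measurable_cst.
    - apply: bounded_measurableZ.
      apply: bounded_measurable_expR; apply: bounded_measurableD => //.
      by apply: bounded_measurableD => //; exact: bounded_measurable_cst.
    by rewrite -expRD ler_expR; have /ler_normlP[] := gg y; lra.
  by rewrite -[leLHS](@expR0 R) ler_expR; lra.
exists a, b; split => //.
- move=> e e0; have [d d0 hd] := uw e e0; exists d => // p q h1 _.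
  have close y : `|w (p.1, y) - w (q.1, y)| <= e.
    by apply: hd => //=; rewrite subrr normr0 ltW.
  have close' y : `|w (q.1, y) - w (p.1, y)| <= e by rewrite distrC.
  have b1 := bounded_measurable_pair1 bw p.1; have b2 := bounded_measurable_pair1 bw q.1.
  have m1 := modulus _ _ _ _ _ _ b1 b2 bb close (row p.1) (row q.1).
  have m2 := modulus _ _ _ _ _ _ b2 b1 bb close' (row q.1) (row p.1).
  by apply/ler_normlP; split; lra.
- move=> e e0; have [d d0 hd] := uw e e0; exists d => // p q _ h2.
  have close x : `|w (x, p.2) - w (x, q.2)| <= e.
    by apply: hd => //=; rewrite subrr normr0 ltW.
  have close' x : `|w (x, q.2) - w (x, p.2)| <= e by rewrite distrC.
  have b1 := bounded_measurable_pair2 bw p.2; have b2 := bounded_measurable_pair2 bw q.2.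
  have swap y : avg U (fun x => expR (w (x, y) + b y + a x)) = 1.
    by rewrite -(col y); congr avg; apply/funext => x; congr expR; ring.
  have m1 := modulus _ _ _ _ _ _ b1 b2 ba close (swap p.2) (swap q.2).
  have m2 := modulus _ _ _ _ _ _ b2 b1 ba close' (swap q.2) (swap p.2).
  by apply/ler_normlP; split; lra.
Qed.

Section fixed_potentials.
Variables (w : R * R -> R) (a b : R -> R).
Hypothesis pot : potentials w a b.
Let v := tilted w a b.

Lemma tilted_clamped_uc : clamped_uc v.
Proof.
case: pot => uw ua ub _ _.
exact: (clamped_ucD (clamped_ucD uw ua) ub).
Qed.

Lemma bounded_measurable_row_potential : bounded_measurable (a : measurableTypeR R -> R).
Proof.
have := bounded_measurable_pair2 (clamped_uc_bounded_measurable (potentials_row_uc pot)) 0.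
by [].
Qed.

Lemma bounded_measurable_col_potential : bounded_measurable (b : measurableTypeR R -> R).
Proof.
have := bounded_measurable_pair1 (clamped_uc_bounded_measurable (potentials_col_uc pot)) 0.
by [].
Qed.

(** A permutation visits every row and every column exactly once. *)
Lemma perm_stat_additive n (s : 'S_n) :
  perm_stat (fun z => a z.1 + b z.2) s = perm_stat (fun z => a z.1 + b z.2) (1%g : 'S_n).
Proof.
rewrite /perm_stat !big_split /=; congr (_ + _).
rewrite [RHS](reindex_inj (@perm_inj _ s))/=.
by apply: eq_bigr => i _; rewrite perm1.
Qed.

Let shift n := perm_stat (fun z => a z.1 + b z.2) (1%g : 'S_n).

Lemma perm_stat_tilted n (s : 'S_n) : perm_stat v s = perm_stat w s + shift n.
Proof.
rewrite /shift -(perm_stat_additive s) -perm_statD.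
by apply: eq_bigr => i _; rewrite /v /tilted addrA.
Qed.

Lemma gibbs_sum_tilted n : gibbs_sum n v = expR (shift n) * gibbs_sum n w.
Proof.
rewrite /gibbs_sum mulr_sumr; apply: eq_bigr => s _.
by rewrite perm_stat_tilted expRD mulrC.
Qed.

Lemma gibbs_prob_tilted n (s : 'S_n) : gibbs_prob v s = gibbs_prob w s.
Proof.
rewrite /gibbs_prob gibbs_sum_tilted perm_stat_tilted expRD.
by rewrite [X in X / _]mulrC -mulf_div divff ?mul1r// gt_eqF// expR_gt0.
Qed.

Lemma avg_additive : avg (uniform_square R) (fun z => a z.1 + b z.2) = avg U a + avg U b.
Proof.
have ba := clamped_uc_bounded_measurable (potentials_row_uc pot).
have bb := clamped_uc_bounded_measurable (potentials_col_uc pot).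
rewrite avgD// (avg_prod12 U U ba) (avg_prod21 U U bb) /=; congr (_ + _).
  by congr avg; apply/funext => x; rewrite avg_cst.
by congr avg; apply/funext => x; rewrite avg_cst.
Qed.

(** Riemann sums, seen as the concentration of a statistic that is constant
    under uniform sampling. *)
Lemma shift_cvg : shift n / n%:R @[n --> \oo] --> avg U a + avg U b.
Proof.
have uh : clamped_uc (fun z => a z.1 + b z.2).
  exact: (clamped_ucD (potentials_row_uc pot) (potentials_col_uc pot)).
have one (x : R) : avg U (fun y => expR ((fun=> 0) (x, y))) = 1 by rewrite expR0 avg_cst.
have one' (x : R) : avg U (fun y => expR ((fun=> 0) (y, x))) = 1 by rewrite expR0 avg_cst.
apply/cvgrPdist_le => e e0.
have := gibbs_concentration (clamped_uc_cst 0) one one' uh e0.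
have -> : avg (uniform_square R) (fun z => expR 0 * (a z.1 + b z.2)) = avg U a + avg U b.
  by rewrite -avg_additive; congr avg; apply/funext => z; rewrite expR0 mul1r.
move/cvgrPdist_lt => /(_ 1 ltr01); apply: filterS => n.
rewrite sub0r normrN distrC; have [/ltW//|dev] := ltP `|shift n / n%:R - (avg U a + avg U b)| e.
rewrite (eq_bigl xpredT); last by move=> s; rewrite perm_stat_additive -/(shift n) dev.
by rewrite sum_gibbs_prob normr1 ltxx.
Qed.

Let log_fact n : R := ln (n`!%:R).

Lemma log_gibbs_sum_tilted_cvg :
  (ln (gibbs_sum n v) - log_fact n) / n%:R @[n --> \oo] --> (0 : R).
Proof.
have uv := tilted_clamped_uc.
have row := potentials_row pot; have col := potentials_col pot.
apply/cvgrPdist_le => e e0.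
have [N1 up] := gibbs_sum_upper uv e0; have [N2 lo] := gibbs_sum_lower uv e0 row col.
exists (maxn 1 (maxn N1 N2)) => // n /=; rewrite !geq_max => /andP[n0 /andP[n1 n2]].
have nR : 0 < n%:R :> R by rewrite ltr0n.
have fR : 0 < n`!%:R :> R by rewrite ltr0n fact_gt0.
have gR := gibbs_sum_gt0 n v.
have {}up := up n n1; rewrite (avg_density1 uv row) expr1n mulr1 in up.
have {}lo := lo n n2.
have lup : ln (gibbs_sum n v) <= log_fact n + n%:R * e.
  rewrite -[X in _ + X]expRK -lnM ?posrE ?expR_gt0// ler_ln ?posrE//.
  by rewrite mulr_gt0// expR_gt0.
have llo : log_fact n <= n%:R * e + ln (gibbs_sum n v).
  rewrite -[X in X + _]expRK -lnM ?posrE ?expR_gt0// ler_ln ?posrE//.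
  by rewrite mulr_gt0// expR_gt0.
rewrite sub0r normrN normrM [X in _ * X]gtr0_norm ?invr_gt0// ler_pdivrMr//.
by move: (ln _) (log_fact n) lup llo => A B lup llo; apply/ler_normlP; split; lra.
Qed.

(** The scaled kernel contributes nothing on the exponential scale, the additive
    shift contributes its Riemann sum. *)
Lemma log_gibbs_sum_cvg :
  (ln (gibbs_sum n w) - log_fact n) / n%:R @[n --> \oo] --> - (avg U a + avg U b).
Proof.
have -> : (fun n => (ln (gibbs_sum n w) - log_fact n) / n%:R) =
    (fun n => (ln (gibbs_sum n v) - log_fact n) / n%:R - shift n / n%:R).
  apply/funext => n; rewrite gibbs_sum_tilted lnM ?posrE ?expR_gt0 ?gibbs_sum_gt0//.
  by rewrite expRK; ring.
rewrite -[X in _ --> X]add0r.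
by apply: cvgB; [exact: log_gibbs_sum_tilted_cvg|exact: shift_cvg].
Qed.

(** Concentration transfers from the scaled kernel, which defines the same law on
    permutations. *)
Lemma kernel_concentration h (e : R) : clamped_uc h -> 0 < e ->
  (\sum_(s : 'S_n | e <= `|perm_stat h s / n%:R
       - avg (uniform_square R) (fun z => (expR (v z) * h z)%R)|) gibbs_prob w s)
    @[n --> \oo] --> (0 : R).
Proof.
move=> uh e0.
have := gibbs_concentration tilted_clamped_uc (potentials_row pot) (potentials_col pot) uh e0.
by under eq_fun => n do under eq_bigr do rewrite gibbs_prob_tilted.
Qed.

End fixed_potentials.
End potentials_theory.

(** * The Gibbs variational principle *)

Section relative_entropy.
Context d (T : measurableType d) (R : realType).
Variables (mu nu : probability T R).

(** Trades the Radon-Nikodym derivative for a finite nonnegative version of it,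
    for which changes of variables hold for all nonnegative integrands. *)
Lemma KL_density : mu `<< nu -> exists r : T -> R,
  [/\ measurable_fun setT r, (forall x, 0 <= r x),
      (forall A, measurable A -> mu A = \int[nu]_(x in A) (r x)%:E)%E,
      (forall h : T -> \bar R, (forall x, (0 <= h x)%E) -> measurable_fun setT h ->
         \int[mu]_x h x = \int[nu]_x (h x * (r x)%:E))%E &
      (KL mu nu = \int[mu]_x (ln (r x))%:E)%E].
Proof.
move=> dom; pose p := Radon_Nikodym_SigmaFinite.f mu nu.
have pfin x : p x \is a fin_num by exact: Radon_Nikodym_SigmaFinite.f_fin_num.
have mp : measurable_fun setT p.
  by apply: measurable_int; exact: Radon_Nikodym_SigmaFinite.f_integrable dom.
have pE x : (fine (p x))%:E = p x by rewrite fineK.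
exists (fine \o p); split.
- exact: (measurableT_comp (fine_measurable measurableT)).
- by move=> x; apply: fine_ge0; exact: Radon_Nikodym_SigmaFinite.f_ge0.
- move=> A mA; under eq_integral do rewrite /= pE.
  exact: Radon_Nikodym_SigmaFinite.f_integral.
- move=> h h0 mh; under [RHS]eq_integral do rewrite /= pE.
  by rewrite Radon_Nikodym_SigmaFinite.change_of_variables.
- rewrite /KL asboolT//; apply: ae_eq_integral => //.
  + apply/measurable_EFinP; apply: (measurableT_comp (@measurable_ln R)).
    apply: (measurableT_comp (fine_measurable measurableT)) => //.
  + apply/measurable_EFinP; apply: (measurableT_comp (@measurable_ln R)).
    exact: (measurableT_comp (fine_measurable measurableT)).
  + apply: (null_dominates_ae_eq measurableT dom).
    apply: (ae_eq_comp (fun x => (ln (fine x))%:E)).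
    exact/ae_eq_sym/ae_eq_Radon_Nikodym_SigmaFinite.
Qed.

Variable v : T -> R.
Hypothesis bv : bounded_measurable v.
Hypothesis mass1 : avg nu (fun x => expR (v x)) = 1.

Definition has_exp_density : Prop :=
  forall A, measurable A -> mu A = (\int[nu]_(x in A) (expR (v x))%:E)%E.

Let mev : measurable_fun setT (fun x => (expR (v x))%:E).
Proof.
by apply/measurable_EFinP; apply: (measurableT_comp (@measurable_expR R)); case: bv.
Qed.

Let mass1E : (\int[nu]_x (expR (v x))%:E = 1)%E.
Proof. by rewrite EFin_avg ?mass1//; exact: bounded_measurable_expR. Qed.

(** Two probability measures cannot be ordered without being equal: apply the
    bound to a set and to its complement. *)
Lemma dominated_has_exp_density :
  (forall A, measurable A -> (mu A <= \int[nu]_(x in A) (expR (v x))%:E)%E) ->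
  has_exp_density.
Proof.
move=> le A mA; have mAC := measurableC mA.
have split1 : ((\int[nu]_(x in A) (expR (v x))%:E) +
    (\int[nu]_(x in ~` A) (expR (v x))%:E) = 1)%E.
  rewrite -mass1E -(setUv A) ge0_integral_setU//.
  - by rewrite setUv.
  - by apply/disj_set2P; rewrite setICr.
have split2 : (mu A + mu (~` A) = 1)%E.
  by rewrite -(probability_setT mu) -(setUv A) measureU// setICr.
have d0 B : (0 <= \int[nu]_(x in B) (expR (v x))%:E)%E.
  by apply: integral_ge0 => x _; rewrite lee_fin expR_ge0.
have h1 := le _ mA; have h2 := le _ mAC; have h3 := d0 A; have h4 := d0 (~` A).
have h5 : (0 <= mu A)%E by []; have h6 : (0 <= mu (~` A))%E by [].
move: (mu A) (mu (~` A)) (\int[nu]_(x in A) _)%E (\int[nu]_(x in ~` A) _)%E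
  split1 split2 h1 h2 h3 h4 h5 h6.
case=> [p| |] [q| |] [r| |] [s| |] //=; rewrite -?EFinD ?lee_fin => -[e1] [e2] *.
by congr (_%:E); lra.
Qed.

Lemma KL_has_exp_density : has_exp_density -> KL mu nu = (avg mu v)%:E.
Proof.
move=> hd.
have dom : mu `<< nu.
  apply/null_content_dominatesP => A mA nA; rewrite hd//.
  by rewrite null_set_integral//; exact: measurable_funTS.
have [r [mr r0 rA _ ->]] := KL_density dom.
rewrite -EFin_avg//; apply: ae_eq_integral => //.
- by apply/measurable_EFinP; exact: (measurableT_comp (@measurable_ln R)).
- by apply/measurable_EFinP; case: bv.
apply: (null_dominates_ae_eq measurableT dom).
have : ae_eq nu setT (fun x => (expR (v x))%:E) (fun x => (r x)%:E).
  apply: integral_ae_eq => //; last by move=> E _ mE; rewrite -hd// rA.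
    exact/bounded_measurable_integrable/bounded_measurable_expR.
  exact/measurable_EFinP.
apply: filterS => x /= + _ => /(_ I)[<-].
by rewrite expRK.
Qed.

(** With [y] the logarithm of the ratio of the two densities, the claim is
    Jensen's inequality in the form [1 + y <= expR y]; equality forces [y] to
    vanish almost everywhere. *)
Lemma gibbs_variational : ((avg mu v)%:E <= KL mu nu)%E /\
  (KL mu nu = (avg mu v)%:E -> has_exp_density).
Proof.
have [dom|ndom] := pselect (mu `<< nu); last first.
  by rewrite /KL asboolF//; split; rewrite ?leey.
have [r [mr r0 rA rchange KLE]] := KL_density dom.
have mv : measurable_fun setT v by case: bv.
pose y x := if 0 < r x then v x - ln (r x) else 0.
have my : measurable_fun setT y.
  apply: measurable_fun_if => //; first exact: measurable_fun_ltr.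
    apply: measurable_funTS; apply: measurable_funB => //.
    exact: (measurableT_comp (@measurable_ln R)).
have yae : ae_eq mu setT (fun x => (ln (r x))%:E) (fun x => (v x - y x)%:E).
  have mr0 : measurable [set x | r x = 0].
    rewrite -[X in measurable X]setTI (_ : [set x | r x = 0] = r @^-1` [set 0])//.
    exact: mr.
  exists [set x | r x = 0]; split => //.
  - apply: eq_trans (rA _ mr0) _.
    by rewrite (eq_integral (fun=> 0%E)) ?integral0// => x; rewrite inE/= => ->.
  - move=> x /= h; apply: contrapT => rx; apply: h => _; congr (_%:E).
    have rx0 : 0 < r x by rewrite lt_neqAle r0 eq_sym andbT; exact/eqP.
    by rewrite /y rx0; ring.
have mvy : measurable_fun setT (fun x => v x - y x) by exact: measurable_funB.
have {KLE} KLE : (KL mu nu = \int[mu]_x (v x - y x)%:E)%E.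
  rewrite KLE; apply: ae_eq_integral => //; last exact/measurable_EFinP.
  by apply/measurable_EFinP; exact: (measurableT_comp (@measurable_ln R)).
have mey : measurable_fun setT (fun x => (expR (y x))%:E).
  by apply/measurable_EFinP; exact: (measurableT_comp (@measurable_expR R)).
have ey1 : (\int[mu]_x (expR (y x))%:E <= 1)%E.
  rewrite rchange//.
  rewrite -mass1E; apply: ge0_le_integral => //.
  - by move=> x _; rewrite mule_ge0// lee_fin ?expR_ge0.
  - by apply: emeasurable_funM => //; exact/measurable_EFinP.
  move=> x _; rewrite -EFinM lee_fin /y; case: ifPn => rx.
    by rewrite expRB lnK// divfK// gt_eqF.
  by rewrite (_ : r x = 0) ?mulr0 ?expR_ge0//; apply/eqP; rewrite eq_le r0 leNgt rx.
have iey : mu.-integrable setT (fun x => (expR (y x))%:E).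
  apply/integrableP; split => //.
  under eq_integral do rewrite gee0_abs ?lee_fin ?expR_ge0//.
  exact: le_lt_trans ey1 (ltry 1).
have iv : mu.-integrable setT (EFin \o v) by exact: bounded_measurable_integrable.
have ic (c : R) : mu.-integrable setT (EFin \o (fun=> c)).
  exact/bounded_measurable_integrable/bounded_measurable_cst.
(* If [y] is not integrable the entropy is infinite: the positive part of [y]
   is below [expR y], so the divergence comes from the other side. *)
have [iy|niy] := pselect (mu.-integrable setT (EFin \o y)).
  have KLr : KL mu nu = (avg mu v - \int[mu]_x y x)%:E.
    rewrite KLE -RintegralB// /Rintegral fineK//.
    by apply: integrable_fin_num => //; exact: (integrableB measurableT iv iy).
  have eyr : \int[mu]_x expR (y x) <= 1.
    by rewrite -lee_fin /Rintegral fineK//; exact: integrable_fin_num.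
  have i1 : mu.-integrable setT (EFin \o (fun x => expR (y x) - 1)).
    exact: (integrableB measurableT iey (ic 1)).
  have i2 : mu.-integrable setT (EFin \o (fun x => expR (y x) - 1 - y x)).
    exact: (integrableB measurableT i1 iy).
  have gap0 x : 0 <= expR (y x) - 1 - y x by have := expR_ge1Dx (y x); lra.
  have gapE : \int[mu]_x (expR (y x) - 1 - y x) = \int[mu]_x expR (y x) - 1 - \int[mu]_x y x.
    by rewrite RintegralB// RintegralB//; congr (_ - _ - _); exact: avg_cst.
  have gapge : 0 <= \int[mu]_x (expR (y x) - 1 - y x) by exact: Rintegral_ge0.
  rewrite KLr; split; first by rewrite lee_fin; lra.
  move=> [eqKL].
  have gapz : \int[mu]_x (expR (y x) - 1 - y x) = 0 by apply/eqP; rewrite eq_le gapge andbT; lra.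
  have : ae_eq mu setT (EFin \o (fun x => expR (y x) - 1 - y x)) (cst 0%E).
    apply/ae_eq_integral_abs => //; first by case/integrableP : i2.
    under eq_integral do rewrite gee0_abs ?lee_fin ?gap0//.
    by rewrite -[LHS]fineK ?[fine _]gapz//; exact: integrable_fin_num.
  move=> [N [mN N0 hN]].
  apply: dominated_has_exp_density => A mA.
  have mAN : measurable (A `\` N) by exact: measurableD.
  have -> : mu A = mu (A `\` N).
    apply/eqP; rewrite eq_le; apply/andP; split; last by rewrite le_measure ?inE.
    have -> : mu (A `\` N) = (mu (A `\` N) + mu N)%E by rewrite N0 adde0.
    apply: le_trans (measureU2 _ mAN mN); rewrite le_measure ?inE//.
      exact: measurableU.
    by move=> x Ax; have [Nx|nNx] := pselect (N x); [right|left].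
  rewrite rA//; apply: (@le_trans _ _ (\int[nu]_(x in A `\` N) (expR (v x))%:E)%E).
    apply: ge0_le_integral => //.
    - by move=> x _; rewrite lee_fin.
    - by apply/measurable_EFinP; exact: measurable_funTS.
    - exact: measurable_funTS.
    move=> x [Ax nNx]; rewrite lee_fin.
    have y0 : y x = 0.
      apply: contrapT => /eqP yx; apply: nNx; apply: hN => /= /(_ I)[].
      by have := expR_gt1Dx yx; lra.
    move: y0; rewrite /y; case: ifPn => [rx|]; last first.
      by rewrite -leNgt => /le_trans -> //; exact: expR_ge0.
    by move=> /eqP; rewrite subr_eq0 => /eqP ->; rewrite lnK.
  by apply: ge0_subset_integral => //; exact: measurable_funTS.
suff -> : KL mu nu = +oo%E by split; rewrite ?leey.
rewrite KLE integralE.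
have [M M0 vM] := bounded_measurable_bound bv.
have neg : (\int[mu]_x ((fun z => (v z - y z)%:E)^\- x) < +oo)%E.
  apply: (@le_lt_trans _ _ (\int[mu]_x (expR (y x) + M)%:E)%E); last first.
    have : mu.-integrable setT (EFin \o (fun x => expR (y x) + M)).
      exact: (integrableD measurableT iey (ic M)).
    by move=> /(integrable_fin_num measurableT); rewrite fin_numElt => /andP[].
  apply: ge0_le_integral => //.
  - by apply: measurable_funeneg; exact/measurable_EFinP.
  - by apply/measurable_EFinP; apply: measurable_funD => //; exact/measurable_EFinP.
  move=> x _; rewrite funenegE ge_max -EFinN !lee_fin; apply/andP; split.
    have := expR_ge1Dx (y x); have /ler_normlP[] := vM x; lra.
  by rewrite addr_ge0 ?expR_ge0// ltW.
have pos : (\int[mu]_x ((fun z => (v z - y z)%:E)^\+ x) = +oo)%E.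
  apply: contrapT => /eqP; rewrite -ltey => posfin; apply: niy.
  have ivy : mu.-integrable setT (EFin \o (fun x => v x - y x)).
    apply/integrableP; split; first exact/measurable_EFinP.
    under eq_integral do rewrite -[X in abse X]/((EFin \o (fun x => v x - y x)) _).
    rewrite (_ : (fun x => `|(EFin \o _) x|%E) = abse \o (EFin \o (fun x => v x - y x)))//.
    rewrite fune_abse ge0_integralD//; first exact: lte_add_pinfty.
    - by apply: measurable_funepos; exact/measurable_EFinP.
    - by apply: measurable_funeneg; exact/measurable_EFinP.
  have := integrableB measurableT iv ivy; apply: eq_integrable => // x _ /=.
  by rewrite -EFinB; congr (_%:E); ring.
by rewrite pos addye// eqe_oppLR /= -ltey.
Qed.

End relative_entropy.

Lemma avg_exp_density d (T : measurableType d) (R : realType) (mu nu : probability T R)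
    (v h : T -> R) : bounded_measurable v -> has_exp_density mu nu v ->
  bounded_measurable h -> avg mu h = avg nu (fun x => expR (v x) * h x).
Proof.
move=> bv hd bh.
have bev := bounded_measurable_expR bv.
have mev : measurable_fun setT (fun x => (expR (v x))%:E).
  by apply/measurable_EFinP; case: bev.
have dom : mu `<< nu.
  apply/null_content_dominatesP => A mA nA; rewrite hd//.
  by rewrite null_set_integral//; exact: measurable_funTS.
have [r [mr r0 rA rchange _]] := KL_density dom.
have aer : ae_eq nu setT (fun x => (expR (v x))%:E) (fun x => (r x)%:E).
  apply: integral_ae_eq => //; last by move=> E _ mE; rewrite -hd// rA.
    exact: bounded_measurable_integrable.
  exact/measurable_EFinP.
have ge0E g : bounded_measurable g -> (forall x, 0 <= g x) ->
    avg mu g = avg nu (fun x => expR (v x) * g x).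
  move=> bg g0; have mg : measurable_fun setT (fun x => (g x)%:E).
    by apply/measurable_EFinP; case: bg.
  rewrite /avg /Rintegral rchange//; congr fine; apply: ae_eq_integral => //.
  - by apply: emeasurable_funM => //; exact/measurable_EFinP.
  - by apply/measurable_EFinP; case: (bounded_measurableM bev bg).
  by move: aer; apply: filterS => x /(_ I) <- _; rewrite muleC EFinM.
have [M M0 hM] := bounded_measurable_bound bh.
have bc := @bounded_measurable_cst _ T R M.
have hM0 x : 0 <= h x + M by have /ler_normlP[] := hM x; lra.
have e1 := ge0E _ (bounded_measurableD bh bc) hM0.
have e2 := ge0E _ bc (fun=> ltW M0).
have e3 : avg nu (fun x => expR (v x) * (h x + M)) =
    avg nu (fun x => expR (v x) * h x) + avg nu (fun x => expR (v x) * M).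
  rewrite -avgD; [|exact: bounded_measurableM..].
  by congr avg; apply/funext => x; rewrite mulrDr.
by move: e1; rewrite avgD// e3 -e2 => /addIr.
Qed.

(** * Measures on the square with uniform marginals *)

Section exp_density_measure.
Context d (T : measurableType d) (R : realType) (nu : probability T R).
Variable v : T -> R.
Hypothesis bv : bounded_measurable v.
Hypothesis mass1 : avg nu (fun x => expR (v x)) = 1.

(** The hypotheses are arguments so that the measure instances below can depend
    on them. *)
Definition exp_density_measure of bounded_measurable v &
    avg nu (fun x => expR (v x)) = 1 : set T -> \bar R :=
  fun A => (\int[nu]_(x in A) (expR (v x))%:E)%E.
Local Notation m := (exp_density_measure bv mass1).

Let m0 : m set0 = 0%E. Proof. exact: integral_set0. Qed.

Let m_ge0 A : (0 <= m A)%E.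
Proof. by apply: integral_ge0 => x _; rewrite lee_fin expR_ge0. Qed.

Let mexp : measurable_fun setT (fun x => (expR (v x))%:E).
Proof. by apply/measurable_EFinP; case: (bounded_measurable_expR bv). Qed.

Let m_sigma_additive : semi_sigma_additive m.
Proof.
move=> /= F mF tF mUF; apply: cvg_toP.
  apply: ereal_nondecreasing_is_cvgn => i j ij.
  by apply: lee_sum_nneg_natr => // k _ _; exact: m_ge0.
rewrite [RHS]ge0_integral_bigcup//; exact: measurable_funTS.
Qed.

HB.instance Definition _ := isMeasure.Build _ _ _ m m0 m_ge0 m_sigma_additive.

Let m_setT : m setT = 1%E.
Proof.
rewrite /exp_density_measure EFin_avg ?mass1//; exact: bounded_measurable_expR.
Qed.

HB.instance Definition _ := @Measure_isProbability.Build _ _ R m m_setT.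

Lemma exp_density_exists : exists mu : probability T R, has_exp_density mu nu v.
Proof. by exists m. Qed.

End exp_density_measure.

Lemma avg_pushforward d d' (T : measurableType d) (T' : measurableType d')
    (R : realType) (mu : probability T R) (nu : probability T' R)
    (phi : T -> T') (a : T' -> R) : measurable_fun setT phi ->
  (forall A, measurable A -> pushforward mu phi A = nu A) ->
  bounded_measurable a -> avg mu (fun z => a (phi z)) = avg nu a.
Proof.
move=> mphi phinu ba; pose X : {mfun T >-> T'} := mfun_Sub (mem_set mphi).
rewrite /avg /Rintegral; congr fine; apply/esym.
transitivity (\int[distribution mu X]_y (a y)%:E)%E.
  by apply: eq_measure_integral => A mA _; apply: esym; exact: phinu.
rewrite integral_distribution//; first exact/measurable_EFinP/(proj1 ba).
exact/bounded_measurable_integrable/(bounded_measurable_comp ba mphi).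
Qed.

Section plane_measures.
Variable R : realType.
Implicit Types mu : probability (plane R) R.
Local Notation U := (uniform01 R).

Lemma measurable_unit_square : measurable (unit_square R : set (plane R)).
Proof. by apply: measurableX; exact: measurable_itv. Qed.

Lemma uniform01_off_itv : U (~` `[0, 1]%classic) = 0%E.
Proof.
rewrite /uniform01/= /uniform_prob integral_uniform_pdf.
by rewrite setICl integral_set0.
Qed.

Section given_marginals.
Variable mu : probability (plane R) R.
Hypothesis hmu : uniform_marginals mu.

Let mitvC : measurable (~` `[0, 1]%classic : set (measurableTypeR R)).
Proof. by apply: measurableC; exact: measurable_itv. Qed.

Lemma off_unit_square : mu (~` unit_square R) = 0%E.
Proof.
have [h1 h2] := hmu mitvC.
have m1 : measurable (fst @^-1` (~` `[0, 1]%classic) : set (plane R)).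
  by rewrite -[X in measurable X]setTI; exact: measurable_fst.
have m2 : measurable (snd @^-1` (~` `[0, 1]%classic) : set (plane R)).
  by rewrite -[X in measurable X]setTI; exact: measurable_snd.
apply/eqP; rewrite eq_le measure_ge0 andbT.
pose C : set (measurableTypeR R) := ~` `[0, 1]%classic.
have z1 : mu (fst @^-1` C) = 0%E := etrans h1 uniform01_off_itv.
have z2 : mu (snd @^-1` C) = 0%E := etrans h2 uniform01_off_itv.
have : (mu (fst @^-1` C `|` snd @^-1` C) <= mu (fst @^-1` C) + mu (snd @^-1` C))%E.
  exact: measureU2.
rewrite z1 z2 adde0; apply: le_trans; rewrite le_measure ?inE//.
- by apply: measurableC; exact: measurable_unit_square.
- exact: measurableU.
by move=> [x y] /=; rewrite /unit_square /= => /not_andP.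
Qed.

Lemma mean_avg (f : R * R -> R) :
  bounded_measurable (fun z : plane R => f (clamp z.1, clamp z.2)) ->
  mean mu f = avg mu (fun z => f (clamp z.1, clamp z.2)).
Proof.
move=> bf; transitivity (\int[mu]_(z in unit_square R) f (clamp z.1, clamp z.2)).
  apply: eq_Rintegral => -[x y]; rewrite inE => -[/= hx hy].
  by rewrite !clamp_id.
have mN : measurable (~` unit_square R : set (plane R)).
  by apply: measurableC; exact: measurable_unit_square.
have ifc := bounded_measurable_integrable mu bf.
have off := off_unit_square.
rewrite /avg /Rintegral; congr fine; apply/esym.
by apply: etrans (negligible_integral mN measurableT ifc off) _; rewrite setDE setCK setTI.
Qed.

Lemma avg_marginal1 (a : measurableTypeR R -> R) : bounded_measurable a ->
  avg mu (fun z => a z.1) = avg U a.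
Proof.
by move=> ba; apply: (avg_pushforward measurable_fst) => // A /hmu[].
Qed.

Lemma avg_marginal2 (b : measurableTypeR R -> R) : bounded_measurable b ->
  avg mu (fun z => b z.2) = avg U b.
Proof.
by move=> bb; apply: (avg_pushforward measurable_snd) => // A /hmu[].
Qed.

End given_marginals.

Lemma exp_density_marginals mu (v : plane R -> R) : bounded_measurable v ->
  has_exp_density mu (uniform_square R) v ->
  (forall x, avg U (fun y => expR (v (x, y))) = 1) ->
  (forall y, avg U (fun x => expR (v (x, y))) = 1) ->
  uniform_marginals mu.
Proof.
move=> bv hd row col A mA.
have be := bounded_measurable_expR bv.
have b1A : bounded_measurable (\1_A : measurableTypeR R -> R).
  split; first exact: measurable_indic.
  by exists 1 => x; rewrite indicE; case: (_ \in _); rewrite ?normr0 ?normr1.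
have UA : U A = (avg U \1_A)%:E.
  by rewrite -EFin_avg// integral_indic// setIT.
have half (pr : plane R -> measurableTypeR R) : measurable_fun setT pr ->
    mu (pr @^-1` A) = (avg (uniform_square R) (fun z => expR (v z) * \1_A (pr z)))%:E.
  move=> mpr; rewrite hd; last by rewrite -[X in measurable X]setTI; exact: mpr.
  rewrite integral_mkcond -EFin_avg; last first.
    by apply: bounded_measurableM => //; exact: (bounded_measurable_comp b1A mpr).
  apply: eq_integral => z _; rewrite patchE indicE /=.
  have -> : (z \in pr @^-1` A) = (pr z \in A) by apply/idP/idP; rewrite !inE.
  by case: (pr z \in A); rewrite ?mulr1 ?mulr0.
split; rewrite /pushforward half//.
  have bF : bounded_measurable (fun z : plane R => expR (v z) * \1_A z.1).
    by apply: bounded_measurableM => //; exact: (bounded_measurable_comp b1A measurable_fst).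
  rewrite (avg_prod12 U U bF) UA; congr (_%:E); congr avg; apply/funext => x /=.
  rewrite -[RHS]mulr1 -(row x) -avgZ; last exact: bounded_measurable_pair1 be x.
  by congr avg; apply/funext => y; rewrite mulrC.
have bF : bounded_measurable (fun z : plane R => expR (v z) * \1_A z.2).
  by apply: bounded_measurableM => //; exact: (bounded_measurable_comp b1A measurable_snd).
rewrite (avg_prod21 U U bF) UA; congr (_%:E); congr avg; apply/funext => y /=.
rewrite -[RHS]mulr1 -(col y) -avgZ; last exact: bounded_measurable_pair2 be y.
by congr avg; apply/funext => x; rewrite mulrC.
Qed.

Lemma mean_perm_measure n (s : 'S_n) (f : R * R -> R) :
  bounded_measurable (fun z : plane R => f (clamp z.1, clamp z.2)) ->
  mean (perm_measure R s) f = perm_stat f s / n%:R.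
Proof.
set fc := fun z => f (clamp z.1, clamp z.2); move=> bf.
have fcE i : fc (perm_point R s i) = f (perm_point R s i).
  by have [h1 h2] := perm_point_clamp R s i; rewrite /fc h1 h2 -surjective_pairing.
have inside i : unit_square R (perm_point R s i).
  have [h1 h2] := perm_point_clamp R s i; split.
    by have := clamp_in (perm_point R s i).1; rewrite h1.
  by have := clamp_in (perm_point R s i).2; rewrite h2.
have ge0E (g : plane R -> R) : measurable_fun setT g -> (forall z, 0 <= g z) ->
    (\int[perm_measure R s]_(z in unit_square R) (g z)%:E =
     ((\sum_(i < n) g (perm_point R s i)) / n%:R)%:E)%E.
  move=> mg g0; have mg' : measurable_fun (unit_square R) (fun z => (g z)%:E).
    by apply: measurable_funTS; exact/measurable_EFinP.
  rewrite ge0_integral_mscale//=; [|exact: measurable_unit_square|by move=> z _; rewrite lee_fin].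
  rewrite ge0_integral_measure_sum//; [|exact: measurable_unit_square|by move=> z _; rewrite lee_fin].
  rewrite mulrC EFinM -sumEFin; congr (_ * _)%E; apply: eq_bigr => i _.
  rewrite valK integral_dirac//; last exact: measurable_unit_square.
  by rewrite diracE mem_set ?mul1e//; exact: inside.
have [mf _] := bf.
rewrite /mean /Rintegral; transitivity (fine (\int[perm_measure R s]_(z in unit_square R) (fc z)%:E)%E).
  congr fine; apply: eq_integral => -[x y]; rewrite inE => -[/= hx hy].
  by rewrite /fc /= !clamp_id.
rewrite integralE.
have pos : (\int[perm_measure R s]_(z in unit_square R) ((fun z => (fc z)%:E)^\+ z) =
    ((\sum_(i < n) Num.max (fc (perm_point R s i)) 0) / n%:R)%:E)%E.
  rewrite -(ge0E (fun z => Num.max (fc z) 0)); last 2 first.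
  - by apply: measurable_maxr => //; exact: measurable_cst.
  - by move=> z; rewrite le_max lexx orbT.
  by apply: eq_integral => z _; rewrite funeposE -EFin_max.
have neg : (\int[perm_measure R s]_(z in unit_square R) ((fun z => (fc z)%:E)^\- z) =
    ((\sum_(i < n) Num.max (- fc (perm_point R s i)) 0) / n%:R)%:E)%E.
  rewrite -(ge0E (fun z => Num.max (- fc z) 0)); last 2 first.
  - apply: measurable_maxr; [exact: measurableT_comp|exact: measurable_cst].
  - by move=> z; rewrite le_max lexx orbT.
  by apply: eq_integral => z _; rewrite funenegE -EFinN -EFin_max.
rewrite pos neg -EFinB /= -mulrBl; congr (_ / _); rewrite -sumrB.
apply: eq_bigr => i _; rewrite fcE; set x := f _.
have [x0|x0] := leP x 0.
  by rewrite (max_l (_ : 0 <= - x)) ?oppr_ge0// sub0r opprK.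
by rewrite (max_r (_ : - x <= 0)) ?subr0// oppr_le0 ltW.
Qed.

End plane_measures.

(** * Lebesgue densities and uniqueness of the potentials *)

Section lebesgue_transfer.
Variable R : realType.
Local Notation U := (uniform01 R).
Local Notation leb := (@lebesgue_measure R).

Lemma ge0_integral_uniform01 (g : R -> \bar R) : measurable_fun setT g ->
  (forall x, (0 <= g x)%E) -> (\int[U]_x g x = \int[leb]_(x in `[0%R, 1%R]) g x)%E.
Proof.
by move=> mg g0; rewrite /uniform01 integral_uniform// subr0 invr1 mul1e.
Qed.

Lemma ge0_integral_uniform_square (g : plane R -> \bar R) : measurable_fun setT g ->
  (forall z, (0 <= g z)%E) ->
  (\int[uniform_square R]_z g z = \int[leb \x leb]_(z in unit_square R) g z)%E.
Proof.
move=> mg g0.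
have msq := @measurable_unit_square R.
rewrite [LHS](@fubini_tonelli1 _ _ _ _ _ U U g mg g0) ge0_integral_uniform01; last 2 first.
- exact: measurable_fun_fubini_tonelli_F.
- by move=> x; exact: integral_ge0.
rewrite [in RHS]integral_mkcond.
have mg' : measurable_fun setT (g \_ (unit_square R)).
  by apply/(measurable_restrictT _ msq); exact: measurable_funTS.
have g'0 z : (0 <= (g \_ (unit_square R)) z)%E.
  by rewrite patchE; case: ifP.
rewrite [RHS](@fubini_tonelli1 _ _ _ _ _ leb leb _ mg' g'0) integral_mkcond.
apply: eq_integral => x _; rewrite /fubini_F patchE; case: ifPn => hx.
  rewrite ge0_integral_uniform01//; last exact: measurable_fun_pair2.
  rewrite [LHS]integral_mkcond; apply: eq_integral => y _; rewrite !patchE.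
  rewrite (_ : ((x, y) \in unit_square R) = (y \in `[0, 1]%classic))//.
  by apply/idP/idP; rewrite !inE /unit_square/=; [case|move=> hy; split => //; rewrite inE in hx].
rewrite integral0_eq// => y _; rewrite patchE ifN//.
by apply: contra hx; rewrite !inE /unit_square/= => -[].
Qed.

Lemma ge0_integral_uniform_square_in (A : set (plane R)) (g : plane R -> \bar R) :
  measurable A -> measurable_fun setT g -> (forall z, (0 <= g z)%E) ->
  (\int[uniform_square R]_(z in A) g z =
   \int[leb \x leb]_(z in A `&` unit_square R) g z)%E.
Proof.
move=> mA mg g0; rewrite integral_mkcond ge0_integral_uniform_square; last 2 first.
- by apply/(measurable_restrictT _ mA); exact: measurable_funTS.
- by move=> z; rewrite patchE; case: ifP.
by rewrite setIC [RHS]integral_mkcondr.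
Qed.

Lemma lebesgue01 : leb `[0, 1]%classic = 1%E.
Proof. by rewrite lebesgue_measure_itv/= lte_fin ltr01 -EFinD subr0. Qed.

Lemma bounded_measurable_L1_01 (a : R -> R) :
  bounded_measurable (a : measurableTypeR R -> R) -> L1_01 a.
Proof.
move=> [ma [M hM]]; apply: measurable_bounded_integrable => //.
- by rewrite [X in (X < _)%E](_ : _ = 1%E) ?ltry//; exact: lebesgue01.
- exact: measurable_funTS.
by exists M; split; [exact: num_real|move=> N MN x _; exact: le_trans (hM x) (ltW MN)].
Qed.

Lemma avg_uniform01 (a : R -> R) : bounded_measurable (a : measurableTypeR R -> R) ->
  avg U a = \int[leb]_(x in `[0, 1]) a x.
Proof.
move=> ba; have [M M0 hM] := bounded_measurable_bound ba.
have bc : bounded_measurable (fun _ : measurableTypeR R => M) by exact: bounded_measurable_cst.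
have sum0 x : 0 <= a x + M by have /ler_normlP[] := hM x; lra.
have : avg U (fun x => a x + M) = \int[leb]_(x in `[0, 1]) (a x + M).
  rewrite /avg /Rintegral ge0_integral_uniform01//.
  by apply/measurable_EFinP; apply: measurable_funD; [case: ba|exact: measurable_cst].
rewrite avgD// avg_cst RintegralD//; last 2 first.
- exact: bounded_measurable_L1_01.
- exact: (bounded_measurable_L1_01 bc).
rewrite Rintegral_cst// [X in fine X](_ : _ = 1%E) ?mulr1; last exact: lebesgue01.
by move/addIr.
Qed.

End lebesgue_transfer.

Section potentials_uniqueness.
Variable R : realType.
Local Notation leb := (@lebesgue_measure R).

Let ae_leb_filter : Filter (nbhs (almost_everywhere leb)).
Proof. exact: (ae_filter_ringOfSetsType leb). Qed.
Existing Instance ae_leb_filter.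

Lemma ae_itv_exists (P : R -> Prop) :
  {ae leb, forall x, x \in `[0, 1] -> P x} -> exists2 x, x \in `[0, 1] & P x.
Proof.
move=> [N [mN N0 hN]]; apply: contrapT => nex.
have sub : `[0, 1]%classic `<=` N.
  move=> x /= x01; apply: hN => /= h; apply: nex; exists x => //; exact: h.
have : (leb `[0%R, 1%R]%classic <= leb N)%E.
  by apply: le_measure; rewrite ?inE//; exact: measurable_itv.
by rewrite N0 [X in (X <= _)%E](_ : _ = 1%E) ?lee_fin ?ler10//; exact: lebesgue01.
Qed.

Lemma ae_sections (Q : R -> R -> Prop) :
  {ae (leb \x leb)%E, forall z, unit_square R z -> Q z.1 z.2} ->
  {ae leb, forall x, x \in `[0, 1] -> {ae leb, forall y, y \in `[0, 1] -> Q x y}}.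
Proof.
move=> [N [mN N0 hN]].
have mF : measurable_fun setT (leb \o xsection N).
  exact: measurable_fun_xsection.
have : ae_eq leb setT (leb \o xsection N) (cst 0%E).
  apply/ae_eq_integral_abs => //.
  under eq_integral do rewrite gee0_abs//.
  exact: N0.
apply: filterS => x /(_ I) /= Nx x01.
exists (xsection N x); split => //; first exact: measurable_xsection.
move=> y /= nQ; rewrite /xsection /= inE; apply: hN => /= hQ; apply: nQ => y01.
by apply: (hQ); split.
Qed.

(** A sum of a function of [x] and a function of [y] that vanishes almost
    everywhere has constant terms: compare all rows with a single good row. *)
Lemma separated_constant (p q : R -> R) :
  {ae (leb \x leb)%E, forall z, unit_square R z -> p z.1 + q z.2 = 0} ->
  exists c, {ae leb, forall x, x \in `[0, 1] -> p x = c /\ q x = - c}.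
Proof.
move=> /(ae_sections (Q := fun x y => p x + q y = 0)) rows.
have [x0 x01 row0] := ae_itv_exists rows.
exists (p x0).
have qE : {ae leb, forall y, y \in `[0, 1] -> q y = - p x0}.
  by move: row0; apply: filterS => y h /h /eqP; rewrite addr_eq0 => /eqP ->; rewrite opprK.
move: (rows) (qE); apply: filterS2 => x hx qx xin; split; last exact: qx.
have both : {ae leb, forall y, y \in `[0, 1] -> p x + q y = 0 /\ q y = - p x0}.
  by move: (hx xin) (qE); apply: filterS2 => y h1 h2 yin; split; [exact: h1|exact: h2].
have [y _ [h1 h2]] := ae_itv_exists both.
by move: h1; rewrite h2 => /eqP; rewrite subr_eq0 => /eqP.
Qed.

Variables (f : R * R -> R) (theta : R) (a b : R -> R).
Let fc z := f (clamp z.1, clamp z.2).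
Hypothesis bf : bounded_measurable (fc : plane R -> R).

Lemma measurable_exp_density (a' b' : R -> R) : L1_01 a' -> L1_01 b' ->
  measurable_fun (unit_square R : set (plane R))
    (fun z : plane R => (exp_density f theta a' b' z)%:E).
Proof.
move=> /integrableP[/measurable_EFinP ma _] /integrableP[/measurable_EFinP mb _].
apply/measurable_EFinP.
apply: (eq_measurable_fun (fun z : plane R => expR (theta * fc z + a' z.1 + b' z.2))).
  by move=> [x y]; rewrite inE /exp_density /fc => -[/= hx hy]; rewrite !clamp_id.
have msq := @measurable_unit_square R.
apply: (measurableT_comp (@measurable_expR R)); apply: measurable_funD.
  apply: measurable_funD.
    by apply: measurable_funM => //; apply: measurable_funTS; case: bf.
  apply: (@measurable_comp _ _ _ _ _ _ (`[0, 1]%classic : set (measurableTypeR R)) a') => //.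
    by move=> _ [z [hx hy] <-].
  by apply: measurable_funTS; exact: measurable_fst.
apply: (@measurable_comp _ _ _ _ _ _ (`[0, 1]%classic : set (measurableTypeR R)) b') => //.
  by move=> _ [z [hx hy] <-].
by apply: measurable_funTS; exact: measurable_snd.
Qed.

Hypothesis ba : bounded_measurable (a : measurableTypeR R -> R).
Hypothesis bb : bounded_measurable (b : measurableTypeR R -> R).

(** Two densities of the same measure agree almost everywhere, so the potentials
    differ by a separated function that vanishes. *)
Lemma potentials_unique (mu : probability (plane R) R) (a' b' : R -> R) :
  L1_01 a' -> L1_01 b' ->
  has_density mu (exp_density f theta a b) ->
  has_density mu (exp_density f theta a' b') ->
  exists c : R, {ae leb, forall x, x \in `[0, 1] -> a' x = a x + c /\ b' x = b x - c}.
Proof.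
move=> La' Lb' hd hd'.
have msq := @measurable_unit_square R.
have La := bounded_measurable_L1_01 ba; have Lb := bounded_measurable_L1_01 bb.
have mg := measurable_exp_density La Lb; have mg' := measurable_exp_density La' Lb'.
have ig : (leb \x leb)%E.-integrable (unit_square R)
    (fun z : plane R => (exp_density f theta a b z)%:E).
  apply/integrableP; split => //.
  under eq_integral do rewrite gee0_abs ?lee_fin ?expR_ge0//.
  have := hd setT measurableT; rewrite setTI => <-.
  by rewrite probability_setT ltry.
have aeg : ae_eq (leb \x leb)%E (unit_square R)
    (fun z : plane R => (exp_density f theta a b z)%:E)
    (fun z : plane R => (exp_density f theta a' b' z)%:E).
  apply: integral_ae_eq => // E Esq mE.
  by have := hd E mE; rewrite (hd' E mE) setIidl.
have : {ae (leb \x leb)%E, forall z, unit_square R z -> (a' z.1 - a z.1) + (b' z.2 - b z.2) = 0}.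
  by move: aeg; apply: filterS => z h /h[] /expR_inj; lra.
move=> /(separated_constant (p := fun x => a' x - a x) (q := fun y => b' y - b y))[c hc].
exists c; move: hc; apply: filterS => x h /h[h1 h2]; split; lra.
Qed.

End potentials_uniqueness.

(** * The model at a fixed parameter *)

Section fixed_parameter.
Variables (R : realType) (f : R * R -> R) (theta : R) (a b : R -> R).
Local Notation U := (uniform01 R).
Let fc z := f (clamp z.1, clamp z.2).
Hypothesis ufc : clamped_uc fc.
Hypothesis pot : potentials (fun z => theta * fc z) a b.
Let v := tilted (fun z => theta * fc z) a b.
Let L := - (avg U a + avg U b).

Let bfc : bounded_measurable (fc : plane R -> R).
Proof. exact: clamped_uc_bounded_measurable. Qed.
Let ba := bounded_measurable_row_potential pot.
Let bb := bounded_measurable_col_potential pot.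
Let uv : clamped_uc v := tilted_clamped_uc pot.
Let bv : bounded_measurable (v : plane R -> R) := clamped_uc_bounded_measurable uv.
Let mass1 : avg (uniform_square R) (fun z => expR (v z)) = 1.
Proof. exact: (avg_density1 uv (potentials_row pot)). Qed.

(** Uniform marginals see the potentials only through their integrals. *)
Lemma mean_marginals (mu : probability (plane R) R) : uniform_marginals mu ->
  theta * mean mu f = L + avg mu v.
Proof.
move=> hmu; rewrite (mean_avg hmu bfc) -/fc.
have b1 : bounded_measurable (fun z : plane R => a z.1).
  exact: (bounded_measurable_comp ba measurable_fst).
have b2 : bounded_measurable (fun z : plane R => b z.2).
  exact: (bounded_measurable_comp bb measurable_snd).
have b0 := bounded_measurableZ theta bfc.
rewrite /v /tilted avgD//; last exact: bounded_measurableD.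
rewrite avgD// avgZ// (avg_marginal1 hmu ba) (avg_marginal2 hmu bb) /L.
by move: (avg mu fc) (avg U a) (avg U b) => x y z; ring.
Qed.

(** The objective is [L] minus the entropy of the measure relative to the scaled
    density. *)
Lemma objective_le (mu : probability (plane R) R) : uniform_marginals mu ->
  (objective f theta mu <= L%:E)%E /\
  (objective f theta mu = L%:E -> has_exp_density mu (uniform_square R) v).
Proof.
move=> hmu; rewrite /objective (mean_marginals hmu).
have [le eq] := gibbs_variational mu bv mass1.
move: (KL mu (uniform_square R)) (avg mu v) le eq => [k| |] r; rewrite ?leeNy_eq//=.
  rewrite lee_fin => kr eq; rewrite -EFinB lee_fin; split; first by lra.
  by move=> [e]; apply: eq; congr (_%:E); lra.
by move=> _ _; split; rewrite ?leNye.
Qed.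

Section maximizing_measure.
Variable mu : probability (plane R) R.
Hypothesis hd : has_exp_density mu (uniform_square R) v.

Lemma marginals_of_density : uniform_marginals mu.
Proof.
exact: (exp_density_marginals bv hd (potentials_row pot) (potentials_col pot)).
Qed.

Lemma objective_density : objective f theta mu = L%:E.
Proof.
rewrite /objective (mean_marginals marginals_of_density) (KL_has_exp_density bv hd).
by rewrite -EFinB addrK.
Qed.

Lemma ZsupE : Zsup f theta = L%:E.
Proof.
apply/eqP; rewrite eq_le; apply/andP; split.
  by apply: ge_ereal_sup => _ [m hm <-]; case: (objective_le hm).
by apply: ereal_sup_ubound; exists mu; [exact: marginals_of_density|exact: objective_density].
Qed.

Lemma unique_maximizer_density : unique_maximizer f theta mu.
Proof.
split; first by split; [exact: marginals_of_density|rewrite objective_density ZsupE].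
move=> m [hm mE] A mA; rewrite ZsupE in mE.
by rewrite hd// ((objective_le hm).2 mE).
Qed.

Lemma has_density_maximizer : has_density mu (exp_density f theta a b).
Proof.
move=> A mA; rewrite hd// ge0_integral_uniform_square_in//.
- apply: eq_integral => -[x y]; rewrite inE => -[_ [/= hx hy]].
  by rewrite /exp_density /v /tilted /fc /= !clamp_id.
- by apply/measurable_EFinP; case: (bounded_measurable_expR bv).
Qed.

Lemma mean_density (h : R * R -> R) :
  bounded_measurable (fun z : plane R => h (clamp z.1, clamp z.2)) ->
  mean mu h = avg (uniform_square R) (fun z => expR (v z) * h (clamp z.1, clamp z.2)).
Proof.
move=> bh; rewrite (mean_avg marginals_of_density bh).
exact: avg_exp_density bv hd bh.
Qed.

Lemma perm_stat_clamp (h : R * R -> R) n (s : 'S_n) :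
  perm_stat (fun z => h (clamp z.1, clamp z.2)) s = perm_stat h s.
Proof.
apply: eq_bigr => i _; have [-> ->] := perm_point_clamp R s i.
by rewrite -surjective_pairing.
Qed.

Lemma ZnE n : Zn n f theta = ln (gibbs_sum n (fun z => theta * fc z)).
Proof.
rewrite /Zn /gibbs_sum; congr ln; apply: eq_bigr => s _.
by rewrite perm_statZ perm_stat_clamp.
Qed.

Lemma QnE n (s : 'S_n) : Qn f theta s = gibbs_prob (fun z => theta * fc z) s.
Proof.
rewrite /Qn expRB ZnE lnK ?posrE ?gibbs_sum_gt0//.
by rewrite /gibbs_prob perm_statZ perm_stat_clamp.
Qed.

Lemma weak_convergence : weakly_in_prob (Qn f theta) (@perm_measure R) mu.
Proof.
move=> h ch e e0; have uh := within_continuous_clamped_uc ch.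
have bh := clamped_uc_bounded_measurable uh.
have := kernel_concentration pot uh e0; rewrite -/v -(mean_density bh).
have -> // : (fun n => \sum_(s : 'S_n | e <= `|perm_stat (fun z => h (clamp z.1, clamp z.2)) s / n%:R
    - mean mu h|) gibbs_prob (fun z => theta * fc z) s) =
  (fun n => \sum_(s : 'S_n | e <= `|mean (perm_measure R s) h - mean mu h|) Qn f theta s).
apply/funext => n; apply: eq_big => s; last by rewrite QnE.
by rewrite (mean_perm_measure s bh) perm_stat_clamp.
Qed.

Lemma Zn_limit : (Zn n f theta - Zn n f 0) / n%:R @[n --> \oo] --> Zlim f theta.
Proof.
rewrite /Zlim ZsupE /=.
have := log_gibbs_sum_cvg pot; rewrite -/L.
have -> // : (fun n => (ln (gibbs_sum n (fun z => theta * fc z)) - ln n`!%:R) / n%:R) =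
   (fun n => (Zn n f theta - Zn n f 0) / n%:R).
apply/funext => n; rewrite ZnE; congr ((_ - _) / _).
rewrite /Zn; congr ln; under [RHS]eq_bigr do rewrite mul0r expR0.
by rewrite sumr_const card_Sn.
Qed.

(** The average of a bounded statistic converges because it concentrates. *)
Lemma average_stat_limit :
  (\sum_(s : 'S_n) Qn f theta s * (perm_stat f s / n%:R)) @[n --> \oo] --> mean mu f.
Proof.
have [H H0 hH] := bounded_measurable_bound bfc.
rewrite (mean_density bfc) -/fc; set m := avg _ _.
have mH : `|m| <= H.
  rewrite /m -(avg_exp_density bv hd bfc); exact: avg_norm_le.
apply/cvgrPdist_le => e e0; have e2 : 0 < e / 2 by rewrite divr_gt0.
have d0 : 0 < e / (4 * H) by rewrite divr_gt0// mulr_gt0.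
have := kernel_concentration pot ufc e2; rewrite -/v -/m.
move=> /cvgrPdist_le/(_ _ d0); apply: filterS => n; rewrite sub0r normrN.
set P := gibbs_prob _; have P0 (s : 'S_n) : 0 <= P n s by exact: gibbs_prob_ge0.
rewrite ger0_norm; last by apply: sumr_ge0.
move=> small.
have -> : \sum_(s : 'S_n) Qn f theta s * (perm_stat f s / n%:R) =
    \sum_(s : 'S_n) P n s * (perm_stat fc s / n%:R).
  by apply: eq_bigr => s _; rewrite QnE perm_stat_clamp.
have -> : m = \sum_(s : 'S_n) P n s * m by rewrite -mulr_suml sum_gibbs_prob mul1r.
rewrite -sumrB; apply: (le_trans (ler_norm_sum _ _ _)).
apply: (@le_trans _ _ (\sum_(s : 'S_n) P n s * (e / 2) +
   \sum_(s : 'S_n | e / 2 <= `|perm_stat fc s / n%:R - m|) P n s * (2 * H))).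
  rewrite [X in _ <= _ + X]big_mkcond -big_split/=; apply: ler_sum => s _.
  rewrite -mulrBr normrM (ger0_norm (P0 s)) distrC.
  have statH : `|perm_stat fc s / n%:R| <= H.
    have [n0|n0] := posnP n.
      by rewrite (_ : n%:R = 0 :> R) ?n0// invr0 mulr0 normr0 ltW.
    have nR : 0 < n%:R :> R by rewrite ltr0n.
    rewrite normrM (ger0_norm (_ : 0 <= n%:R^-1)) ?invr_ge0// ler_pdivrMr// mulrC.
    exact: perm_stat_norm.
  case: ifPn => [_|]; last first.
    by rewrite -ltNge addr0 => /ltW; exact: ler_wpM2l.
  rewrite -mulrDr ler_wpM2l// (le_trans (ler_normB _ _))//; lra.
rewrite -mulr_suml sum_gibbs_prob mul1r -mulr_suml.
have : (\sum_(s : 'S_n | e / 2 <= `|perm_stat fc s / n%:R - m|) P n s) * (2 * H) <= e / 2.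
  apply: (le_trans (ler_wpM2r _ small)); first by rewrite mulr_ge0// ltW.
  rewrite le_eqVlt; apply/orP; left; apply/eqP; field.
  by rewrite gt_eqF.
lra.
Qed.

End maximizing_measure.
End fixed_parameter.

(** * Dependence on the parameter *)

Lemma expR_strongly_monotone (R : realType) (p q M : R) : `|p| <= M -> `|q| <= M ->
  expR (- M) * (p - q) ^+ 2 <= (expR p - expR q) * (p - q).
Proof.
wlog pq : p q / q <= p => [hw|] pM qM.
  have [/hw|/ltW/hw] := leP q p; first exact.
  by move=> /(_ qM pM); rewrite -sqrrN opprB -[leRHS]mulrNN !opprB.
have qm : expR (- M) <= expR q by rewrite ler_expR; have /ler_normlP[] := qM; lra.
have pq0 : 0 <= p - q by rewrite subr_ge0.
rewrite expr2 mulrA ler_wpM2r//.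
have h := expR_ge1Dx (p - q); rewrite expRB ler_pdivlMr ?expR_gt0// in h.
have := ler_wpM2r pq0 qm; lra.
Qed.

Section parameter_family.
Variables (R : realType) (f : R * R -> R) (fC : class_C f).
Local Notation U := (uniform01 R).
Let fc z := f (clamp z.1, clamp z.2).

Let ufc : clamped_uc fc.
Proof. by case: fC => cf _ _ _; exact: within_continuous_clamped_uc. Qed.

Let bfc : bounded_measurable (fc : plane R -> R).
Proof. exact: clamped_uc_bounded_measurable. Qed.

Variables (a b : R -> R -> R) (mu : R -> probability (plane R) R).
Hypothesis pot : forall t, potentials (fun z => t * fc z) (a t) (b t).
Let v t := tilted (fun z => t * fc z) (a t) (b t).
Hypothesis hd : forall t, has_exp_density (mu t) (uniform_square R) (v t).
Let m t := mean (mu t) f.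
Let L t := - (avg U (a t) + avg U (b t)).
Let k t := avg (mu t) (v t).

Let ba t := bounded_measurable_row_potential (pot t).
Let bb t := bounded_measurable_col_potential (pot t).
Let bv t : bounded_measurable (v t : plane R -> R).
Proof. exact/clamped_uc_bounded_measurable/(tilted_clamped_uc (pot t)). Qed.
Let marg t : uniform_marginals (mu t) := marginals_of_density (pot t) (hd t).
Let ZE t : Zlim f t = L t.
Proof. by rewrite /Zlim (ZsupE ufc (pot t) (hd t)). Qed.
Let KLE t : KL (mu t) (uniform_square R) = (k t)%:E.
Proof. exact: KL_has_exp_density (bv t) (hd t). Qed.
Let mean_v s t : t * m s = L t + avg (mu s) (v t).
Proof. exact: (mean_marginals ufc (pot t) (marg s)). Qed.
Let mE t : m t = avg (uniform_square R) (fun z => expR (v t z) * fc z).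
Proof. exact: (mean_density (pot t) (hd t) bfc). Qed.
Let mass1 t : avg (uniform_square R) (fun z => expR (v t z)) = 1.
Proof. exact: (avg_density1 (tilted_clamped_uc (pot t)) (potentials_row (pot t))). Qed.

(** The maximizer for [t] competes in the problem for [s]. *)
Lemma Zlim_subgradient s t : Zlim f t + (s - t) * m t <= Zlim f s.
Proof.
have [] := objective_le ufc (pot s) (marg t).
rewrite -/(L s) -ZE /objective KLE -EFinB lee_fin -/(m t) => + _.
by rewrite !ZE; have := mean_v t t; rewrite -/(k t); lra.
Qed.

(** Conversely the variational principle, applied to the density for [t] tilted
    towards [s], bounds every competitor for [s]. *)
Lemma Zlim_upper (H : R) s t : (forall z, `|fc z| <= H) -> `|s - t| * H <= 2^-1 ->
  Zlim f s <= Zlim f t + (s - t) * m t + 2 * ((s - t) * H) ^+ 2.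
Proof.
move=> fcH st.
have bu : bounded_measurable (fun z : plane R => v t z + (s - t) * fc z).
  by apply: bounded_measurableD => //; exact: bounded_measurableZ.
have A0 := avg_expR_gt0 (uniform_square R) bu.
have := avg_tilt_le (tilted_clamped_uc (pot t)) (potentials_row (pot t)) bfc fcH st.
rewrite -/(v t) -mE.
have [A AE] : exists A, A = avg (uniform_square R) (fun z => expR (v t z + (s - t) * fc z)).
  by eexists.
rewrite -AE in A0 * => Ale.
have bc := @bounded_measurable_cst _ (plane R) R (ln A).
have bu' := bounded_measurableB bu bc.
have mass' : avg (uniform_square R) (fun z => expR (v t z + (s - t) * fc z - ln A)) = 1.
  transitivity (avg (uniform_square R) (fun z => A^-1 * expR (v t z + (s - t) * fc z))).
    by congr avg; apply/funext => z; rewrite expRB lnK ?posrE// mulrC.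
  by rewrite avgZ -?AE ?mulVf ?gt_eqF//; exact: bounded_measurable_expR.
have [+ _] := gibbs_variational (mu s) bu' mass'.
rewrite KLE lee_fin avgB// avg_cst avgD//; last exact: bounded_measurableZ.
rewrite avgZ// -(mean_avg (marg s) bfc) -/(m s) !ZE.
have lnA : ln A <= A - 1.
  by have := @le_ln1Dx _ (A - 1); rewrite (addrC 1) subrK; apply; lra.
have := mean_v s s; have := mean_v s t; rewrite -/(k s).
move: (avg (mu s) (v t)) (ln A) lnA => x y lnA e1 e2 h.
by move: (L s) (L t) (k s) (m s) (m t) Ale lnA e1 e2 h => *; lra.
Qed.

Let common_bound s t : exists2 C : R, 0 < C & forall z, `|v s z| <= C /\ `|v t z| <= C.
Proof.
have [C C0 hC] := bounded_measurable_bound (bv s).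
have [D D0 hD] := bounded_measurable_bound (bv t).
exists (C + D); first by rewrite addr_gt0.
move=> z; split; first by rewrite (le_trans (hC z))// lerDl ltW.
by rewrite (le_trans (hD z))// lerDr ltW.
Qed.

Lemma avg_row0 x : avg U (fun y => fc (x, y)) = 0.
Proof.
case: fC => _ _ row _; rewrite avg_uniform01; last exact: bounded_measurable_pair1 bfc x.
apply: etrans (row _ (clamp_in x)); apply: eq_Rintegral => y; rewrite inE /= => hy.
by rewrite /fc /= (clamp_id hy).
Qed.

Lemma avg_col0 y : avg U (fun x => fc (x, y)) = 0.
Proof.
case: fC => _ _ _ col; rewrite avg_uniform01; last exact: bounded_measurable_pair2 bfc y.
apply: etrans (col _ (clamp_in y)); apply: eq_Rintegral => x; rewrite inE /= => hx.
by rewrite /fc /= (clamp_id hx).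
Qed.

(** By continuity [f] stays away from zero on a whole cell around a point where
    it does not vanish, and a cell has positive mass. *)
Lemma avg_square_gt0 : 0 < avg (uniform_square R) (fun z => fc z * fc z).
Proof.
case: fC => _ [z0 z0sq fz0] _ _.
have fcz0 : fc z0 != 0.
  by case: z0 z0sq fz0 => x y [/= hx hy]; rewrite /fc /= !clamp_id.
set e := `|fc z0| / 2; have e0 : 0 < e by rewrite divr_gt0// normr_gt0.
have [K K0 mesh] := clamped_uc_mesh ufc e0.
have KR : 0 < K%:R :> R by rewrite ltr0n.
have cell_at (x : R) : exists i : 'I_K, cell K i x != 0.
  apply: contrapT => /forallNP none; have := sum_cell x K0.
  rewrite big1 => [/eqP|i _]; first by rewrite eq_sym oner_eq0.
  by apply/eqP; rewrite -[_ == _]negbK; apply/negP; exact: none.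
have [i hi] := cell_at z0.1; have [j hj] := cell_at z0.2.
have bc := bounded_measurable_cell2 R K i j.
apply: (@lt_le_trans _ _ (e ^+ 2 * K%:R ^- 2)).
  by rewrite mulr_gt0 ?exprn_gt0// invr_gt0 exprn_gt0.
rewrite -(avg_cell2 R (ltn_ord i) (ltn_ord j)) -avgZ//.
apply: avg_le => [||z]; [exact: bounded_measurableZ|exact: bounded_measurableM|].
have [->|zi] := eqVneq (cell K i z.1) 0; first by rewrite mul0r mulr0 -expr2 sqr_ge0.
have [->|zj] := eqVneq (cell K j z.2) 0; first by rewrite !mulr0 -expr2 sqr_ge0.
have near (x y : R) (l : 'I_K) : cell K l x != 0 -> cell K l y != 0 ->
    `|clamp x - clamp y| <= 3 / K%:R.
  move=> /(cell_close (ltn_ord l))/ler_normlP[h1 h2].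
  move=> /(cell_close (ltn_ord l))/ler_normlP[h3 h4].
  have : 0 < K%:R^-1 :> R by rewrite invr_gt0.
  by move=> ?; apply/ler_normlP; split; lra.
have fz : e <= `|fc z|.
  have := mesh z0 z (near _ _ _ hi zi) (near _ _ _ hj zj).
  have := ler_normD (fc z0 - fc z) (fc z); rewrite subrK /e; lra.
have cell1 (l : 'I_K) (x : R) : cell K l x <= 1.
  rewrite -(sum_cell x K0) (bigD1 l)//= lerDl.
  by apply: sumr_ge0 => ? _; exact: cell_ge0.
have c1 : cell K i z.1 * cell K j z.2 <= 1 by rewrite mulr_ile1 ?cell_ge0 ?cell1.
apply: (@le_trans _ _ (e ^+ 2)).
  by rewrite -[leRHS]mulr1 ler_wpM2l// sqr_ge0.
rewrite -expr2 -[leRHS]real_normK ?num_real// lerXn2r// nnegrE ltW//.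
Qed.

(** Both densities have uniform marginals, so the potentials drop out of the
    difference of the means; what remains is controlled by the part of [f] that
    no sum of a function of [x] and a function of [y] can cancel. *)
Lemma mean_increasing s t : s < t -> m s < m t.
Proof.
move=> st; have ts0 : 0 < t - s by rewrite subr_gt0.
have [C C0 hC] := common_bound s t.
pose g z := v t z - v s z.
have bg : bounded_measurable (g : plane R -> R) by exact: bounded_measurableB.
have gapE : (t - s) * (m t - m s) = avg (mu t) g - avg (mu s) g.
  rewrite !avgB//; have := mean_v t t; have := mean_v t s; have := mean_v s t; have := mean_v s s.
  move: (avg _ _) (avg _ _) (avg _ _) (avg _ _) => w1 w2 w3 w4; lra.
have avg_g r : avg (mu r) g = avg (uniform_square R) (fun z => expR (v r z) * g z).
  exact: avg_exp_density (bv r) (hd r) bg.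
have lower : expR (- C) * avg (uniform_square R) (fun z => g z * g z) <=
    (t - s) * (m t - m s).
  rewrite gapE !avg_g -avgB; last 2 first.
  - by apply: bounded_measurableM => //; exact: bounded_measurable_expR.
  - by apply: bounded_measurableM => //; exact: bounded_measurable_expR.
  rewrite -avgZ; last exact: bounded_measurableM.
  apply: avg_le => [||z].
  - by apply: bounded_measurableZ; exact: bounded_measurableM.
  - by apply: bounded_measurableB; apply: bounded_measurableM => //; exact: bounded_measurable_expR.
  rewrite -mulrBl -expr2; have [h1 h2] := hC z; exact: expR_strongly_monotone.
have lo2 : (t - s) ^+ 2 * avg (uniform_square R) (fun z => fc z * fc z) <=
    avg (uniform_square R) (fun z => g z * g z).
  pose al x := a t x - a s x; pose be y := b t y - b s y.
  have bal : bounded_measurable (al : measurableTypeR R -> R) by exact: bounded_measurableB.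
  have bbe : bounded_measurable (be : measurableTypeR R -> R) by exact: bounded_measurableB.
  have b1 : bounded_measurable (fun z : plane R => al z.1 * fc z).
    by apply: bounded_measurableM => //; exact: (bounded_measurable_comp bal measurable_fst).
  have b2 : bounded_measurable (fun z : plane R => be z.2 * fc z).
    by apply: bounded_measurableM => //; exact: (bounded_measurable_comp bbe measurable_snd).
  have o1 : avg (uniform_square R) (fun z => al z.1 * fc z) = 0.
    rewrite (avg_prod12 U U b1) -[RHS](avg_cst U); congr avg; apply/funext => x /=.
    by rewrite avgZ ?avg_row0 ?mulr0//; exact: bounded_measurable_pair1 bfc x.
  have o2 : avg (uniform_square R) (fun z => be z.2 * fc z) = 0.
    rewrite (avg_prod21 U U b2) -[RHS](avg_cst U); congr avg; apply/funext => y /=.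
    by rewrite avgZ ?avg_col0 ?mulr0//; exact: bounded_measurable_pair2 bfc y.
  have bff : bounded_measurable (fun z : plane R => fc z * fc z) by exact: bounded_measurableM.
  have -> : (t - s) ^+ 2 * avg (uniform_square R) (fun z => fc z * fc z) =
      avg (uniform_square R) (fun z => (t - s) ^+ 2 * (fc z * fc z)
        + (2 * (t - s) * (al z.1 * fc z) + 2 * (t - s) * (be z.2 * fc z))).
    rewrite avgD; [|exact: bounded_measurableZ|]; last first.
      by apply: bounded_measurableD; exact: bounded_measurableZ.
    rewrite avgD; [|exact: bounded_measurableZ|exact: bounded_measurableZ].
    rewrite (avgZ _ ((t - s) ^+ 2) bff) (avgZ _ (2 * (t - s)) b1) (avgZ _ (2 * (t - s)) b2).
    by rewrite o1 o2 mulr0 !addr0.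
  apply: avg_le => [||z].
  - apply: bounded_measurableD; first exact: bounded_measurableZ.
    by apply: bounded_measurableD; exact: bounded_measurableZ.
  - exact: bounded_measurableM.
  (* Expanding the square, the terms linear in [fc] are those that average to
     zero, and the square of the separated part is nonnegative. *)
  have gE : g z = (t - s) * fc z + (al z.1 + be z.2).
    by rewrite /g /v /tilted /al /be; ring.
  rewrite gE; have := sqr_ge0 (al z.1 + be z.2).
  move: (al z.1) (be z.2) (fc z) => x y w h; nra.
have pos : 0 < expR (- C) * ((t - s) ^+ 2 * avg (uniform_square R) (fun z => fc z * fc z)).
  by rewrite mulr_gt0 ?expR_gt0// mulr_gt0 ?exprn_gt0// avg_square_gt0.
have := lt_le_trans pos (le_trans (ler_wpM2l (expR_ge0 _) lo2) lower).
by rewrite pmulr_rgt0// subr_gt0.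
Qed.

End parameter_family.

(** A function pinched between an affine function and a parabola above it, at
    every point and with the same slope, is convex with that slope as
    derivative, and the slope is locally Lipschitz. *)
Section quadratic_pinching.
Variables (R : realType) (Z m : R -> R) (H : R).
Hypothesis H0 : 0 < H.
Hypothesis below : forall s t, Z t + (s - t) * m t <= Z s.
Hypothesis above : forall s t, `|s - t| * H <= 2^-1 ->
  Z s <= Z t + (s - t) * m t + 2 * ((s - t) * H) ^+ 2.

Lemma pinched_convex : convex_function setT Z.
Proof.
move=> t x y _ _; rewrite [X in Z X <= _]convRE [leRHS]convRE.
have t0 : 0 <= t%:num by []. have t1 : t%:num <= 1 by [].
set p : R := _ + _.
have h1 := ler_wpM2l t0 (below x p).
have t1' : 0 <= 1 - t%:num by lra.
have h2 := ler_wpM2l t1' (below y p).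
have pE : p = t%:num * x + (1 - t%:num) * y by [].
suff e : t%:num * (Z p + (x - p) * m p) + (1 - t%:num) * (Z p + (y - p) * m p) = Z p.
  by rewrite -e; exact: lerD.
have -> : t%:num * (Z p + (x - p) * m p) + (1 - t%:num) * (Z p + (y - p) * m p) =
   Z p + (t%:num * x + (1 - t%:num) * y - p) * m p by ring.
by rewrite -pE subrr mul0r addr0.
Qed.

Let quotient_cvg t : (fun h => h^-1 *: (Z (h + t) - Z t)) @ (0 : R)^' --> m t.
Proof.
apply/cvgrPdist_le => e e0.
have d1 : 0 < (2 * H)^-1 by rewrite invr_gt0 mulr_gt0.
have d2 : 0 < e / (2 * H ^+ 2) by rewrite divr_gt0// mulr_gt0// exprn_gt0.
near=> h.
have h0 : h != 0 by near: h; exact: nbhs_dnbhs_neq.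
have h1 : `|h| <= (2 * H)^-1 by near: h; exact: dnbhs0_le.
have h2 : `|h| <= e / (2 * H ^+ 2) by near: h; exact: dnbhs0_le.
have hH : `|h + t - t| * H <= 2^-1.
  by rewrite addrK -ler_pdivlMr// -invfM.
have lo := below (h + t) t; have up := above hH; rewrite addrK in lo up.
rewrite /GRing.scale /=.
have -> : m t - h^-1 * (Z (h + t) - Z t) = - (h^-1 * (Z (h + t) - Z t - h * m t)).
  by field.
rewrite normrN normrM normfV ger0_norm; last lra.
rewrite mulrC ler_pdivrMr ?normr_gt0//.
apply: (@le_trans _ _ (2 * (h * H) ^+ 2)); first by lra.
rewrite exprMn -(real_normK (num_real h)).
have H2 : 0 < 2 * H ^+ 2 by rewrite mulr_gt0// exprn_gt0.
rewrite ler_pdivlMr// in h2.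
have := ler_wpM2r (normr_ge0 h) h2; lra.
Unshelve. all: by end_near. Qed.

Lemma pinched_derivable t : derivable Z t 1.
Proof.
rewrite /derivable; apply/cvg_ex; exists (m t).
have -> // : (fun h : R => h^-1 *: ((Z \o shift t) (h *: 1) - Z t)) =
   (fun h => h^-1 *: (Z (h + t) - Z t)).
by apply/funext => h /=; rewrite [h *: 1]mulr1.
Qed.

Lemma pinched_derive1 : derive1 Z = m.
Proof. by apply/funext => t; apply/cvg_lim => //; exact: quotient_cvg. Qed.

Lemma pinched_slope_continuous : continuous m.
Proof.
move=> t; apply/cvgrPdist_le => e e0.
have d1 : 0 < (2 * H)^-1 by rewrite invr_gt0 mulr_gt0.
have d2 : 0 < e / (4 * H ^+ 2) by rewrite divr_gt0// mulr_gt0// exprn_gt0.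
apply/nbhs_ballP; exists (Num.min (2 * H)^-1 (e / (4 * H ^+ 2))) => /=.
  by rewrite lt_min d1.
move=> s; rewrite /ball/= lt_min => /andP[/ltW s1 /ltW s2].
have sH : `|t - s| * H <= 2^-1 by rewrite -ler_pdivlMr// -invfM.
have sH' : `|s - t| * H <= 2^-1 by rewrite distrC.
have u1 := above sH; have u2 := above sH'; have l1 := below s t; have l2 := below t s.
have [->|ts] := eqVneq s t; first by rewrite subrr normr0 ltW.
have key : `|t - s| * `|m t - m s| <= 4 * ((t - s) * H) ^+ 2.
  rewrite -normrM ger0_norm; last by lra.
  lra.
have n0 : 0 < `|t - s| by rewrite normr_gt0 subr_eq0 eq_sym.
rewrite -(ler_pM2l n0); apply: (le_trans key).
rewrite exprMn -(real_normK (num_real (t - s))).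
have H4 : 0 < 4 * H ^+ 2 by rewrite mulr_gt0// exprn_gt0.
rewrite ler_pdivlMr// in s2.
have := ler_wpM2l (normr_ge0 (t - s)) s2; lra.
Qed.

End quadratic_pinching.

Section log_partition_derivative.
Variable R : realType.

Lemma is_derive_bigsum (I : Type) (l : seq I) (g : I -> R -> R) (dg : I -> R) (x : R) :
  (forall i, is_derive x 1 (g i) (dg i)) ->
  is_derive x 1 (fun t => \sum_(i <- l) g i t) (\sum_(i <- l) dg i).
Proof.
move=> hg; elim: l => [|i l ih].
  by under eq_fun do rewrite big_nil; rewrite big_nil; exact: is_derive_cst.
under eq_fun do rewrite big_cons; rewrite big_cons.
exact: is_deriveD.
Qed.

Lemma derive1_Zn (f : R * R -> R) n theta :
  derive1 (Zn n f) theta = \sum_(s : 'S_n) Qn f theta s * perm_stat f s.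
Proof.
pose F t := \sum_(s : 'S_n) expR (t * perm_stat f s).
have F0 t : 0 < F t.
  rewrite /F (bigD1 (1%g : 'S_n))//= ltr_wpDr ?expR_gt0//.
  by apply: sumr_ge0 => s _; exact: expR_ge0.
have dF : is_derive theta 1 F (\sum_(s : 'S_n) expR (theta * perm_stat f s) * perm_stat f s).
  apply: is_derive_bigsum => s.
  have dl : is_derive theta (1 : R) (fun t : R => t * perm_stat f s) (perm_stat f s).
    have -> : (fun t : R => t * perm_stat f s) = (perm_stat f s) \*: id.
      by apply/funext => t; rewrite /= mulrC.
    have := is_deriveZ (perm_stat f s) (is_derive_id theta (1 : R)).
    by rewrite [_ *: 1]mulr1.
  exact: (is_derive1_comp (is_derive_expR _) dl).
have dZ : is_derive theta 1 (Zn n f)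
    ((F theta)^-1 * \sum_(s : 'S_n) expR (theta * perm_stat f s) * perm_stat f s).
  exact: (is_derive1_comp (is_derive1_ln (F0 theta)) dF).
rewrite derive1E (@derive_val _ _ _ _ _ _ _ dZ) mulr_sumr; apply: eq_bigr => s _.
by rewrite /Qn expRB /Zn -/(F theta) lnK ?posrE//; ring.
Qed.

End log_partition_derivative.

Theorem theorem1p4 (R : realType) (f : R * R -> R) (fC : class_C f) :
  (forall theta : R,
     Zsup f theta \is a fin_num /\
     (Zn n f theta - Zn n f 0) / n%:R @[n --> \oo] --> Zlim f theta) /\
  exists mu : R -> probability (plane R) R,
    [/\ (forall theta : R, unique_maximizer f theta (mu theta)),
        (forall theta : R,
           weakly_in_prob (Qn f theta) (@perm_measure R) (mu theta)),
        (forall theta : R, exists a b : R -> R,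
           [/\ L1_01 a, L1_01 b,
               has_density (mu theta) (exp_density f theta a b),
               (forall a' b' : R -> R, L1_01 a' -> L1_01 b' ->
                  has_density (mu theta) (exp_density f theta a' b') ->
                  exists c : R,
                    {ae @lebesgue_measure R, forall x, x \in `[0, 1] ->
                       a' x = a x + c /\ b' x = b x - c}) &
               Zsup f theta =
                 (- \int[lebesgue_measure]_(x in `[0, 1]) (a x + b x))%:E]) &
        [/\ (forall theta : R, derivable (Zlim f) theta 1),
            convex_function setT (Zlim f),
            continuous (derive1 (Zlim f)),
            {homo derive1 (Zlim f) : s t / s < t} &
            forall theta : R,
              n%:R^-1 * derive1 (Zn n f) theta @[n --> \oo]
                --> derive1 (Zlim f) theta /\
              derive1 (Zlim f) theta = mean (mu theta) f]].
Proof.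
have [cf _ _ _] := fC.
have ufc := within_continuous_clamped_uc cf.
have bfc := clamped_uc_bounded_measurable ufc.
have /choice[a /choice[b pot]] : forall theta, exists a b,
    potentials (fun z => theta * f (clamp z.1, clamp z.2)) a b.
  by move=> theta; apply: potentials_exist; exact: clamped_ucZ.
pose v theta := tilted (fun z => theta * f (clamp z.1, clamp z.2)) (a theta) (b theta).
have uv theta : clamped_uc (v theta) := tilted_clamped_uc (pot theta).
have bv theta := clamped_uc_bounded_measurable (uv theta).
have mass theta := avg_density1 (uv theta) (potentials_row (pot theta)).
have /choice[mu hd] : forall theta, exists mu : probability (plane R) R,
    has_exp_density mu (uniform_square R) (v theta).
  by move=> theta; exact: (exp_density_exists (bv theta) (mass theta)).
have [H H0 fcH] := bounded_measurable_bound bfc.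
have below := Zlim_subgradient fC pot hd.
have above s t := Zlim_upper fC pot hd (s := s) (t := t) fcH.
have dZ := pinched_derive1 H0 below above.
split.
  move=> theta; rewrite (ZsupE ufc (pot theta) (hd theta)); split => //.
  exact: (Zn_limit ufc (pot theta) (hd theta)).
exists mu; split.
- by move=> theta; exact: (unique_maximizer_density ufc (pot theta) (hd theta)).
- by move=> theta; exact: (weak_convergence (pot theta) (hd theta)).
- move=> theta; have ba := bounded_measurable_row_potential (pot theta).
  have bb := bounded_measurable_col_potential (pot theta).
  have hdens := has_density_maximizer (pot theta) (hd theta).
  exists (a theta), (b theta); split => //.
  + exact: bounded_measurable_L1_01.
  + exact: bounded_measurable_L1_01.
  + by move=> a' b' La Lb hd'; exact: (potentials_unique bfc ba bb La Lb hdens hd').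
  + rewrite (ZsupE ufc (pot theta) (hd theta)) -avgD//; congr (- _)%:E.
    by rewrite avg_uniform01//; exact: bounded_measurableD.
split.
- exact: (pinched_derivable H0 below above).
- exact: (pinched_convex below).
- by rewrite dZ; exact: (pinched_slope_continuous H0 below above).
- by move=> s t st; rewrite dZ; exact: (mean_increasing fC pot hd st).
- move=> theta; rewrite dZ; split => //.
  have := average_stat_limit ufc (pot theta) (hd theta).
  have -> // : (fun n => \sum_(s : 'S_n) Qn f theta s * (perm_stat f s / n%:R)) =
     (fun n => n%:R^-1 * derive1 (Zn n f) theta).
  apply/funext => n; rewrite derive1_Zn mulr_sumr; apply: eq_bigr => s _.
  by rewrite [RHS]mulrCA [n%:R^-1 * _]mulrC.
Qed.
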